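(* Let $A$ be a unital AF-algebra, $A=\overline{\bigcup_{n\in\mathbb N}A_n}^{\|\cdot\|_A}$, where $(A_n)_{n\in\mathbb N}$ is an increasing sequence of finite-dimensional C*-subalgebras of $A$ containing $1_A$ with $A_0=\mathbb C1_A$, and let $\tau$ be a faithful tracial state on $A$. For $n\in\mathbb N$ let $E_n:A\to A_n$ be the unique $\tau$-preserving conditional expectation onto $A_n$. Let $(\beta(n))_{n\in\mathbb N}$ be a sequence in $(0,\infty)$ converging to $0$ and such that $\left(\frac{\beta(n)}{\beta(n-1)}\right)_{n\ge 1}$ converges to $0$. For $a\in A$ let $$L_\beta(a)=\sup\left\{\frac{\|a-E_n(a)\|_A}{\beta(n)}:n\in\mathbb N\right\}.$$ Let $F(x_1,x_2,x_3,x_4)=2(x_1x_4+x_2x_3)$, $G(x,y,z)=F(x,y,z,z)$ and $H(x,y)=F(x,x,y,y)$. For every norm-closed two-sided ideal $I$ of $A$, let $1^I_n$ be the unit of the finite-dimensional C*-algebra $I\cap A_n$ ($n\in\mathbb N$), let $\langle\omega,\nu\rangle_I=\omega\nu^*$ for $\omega,\nu\in I$, let $$D_I(\omega)=\max\left\{L_\beta(\omega),\ \|\omega\|_A,\ \sup_{n\in\mathbb N}\frac{\|\omega-\omega1^I_n\|_A}{\beta(n)}\right\}\qquad(\omega\in I),$$ and let $\Omega^\beta_I=(I,\langle\cdot,\cdot\rangle_I,D_I,A,L_\beta)$, which is an $(F,G,H)$-metrized quantum vector bundle. Then the map $$I\in Ideals(A)\longmapsto\Omega^\beta_I$$ is continuous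 with respect to the Fell topology on $Ideals(A)$ and the topology induced by the modular Gromov-Hausdorff propinquity $\Lambda^{mod}$ on $(F,G,H)$-metrized quantum vector bundles.
   Context: Conventions. $\mathbb N$ includes $0$. $Ideals(A)$ is the set of norm-closed two-sided ideals of $A$ (including $\{0\}$ and $A$). For a C*-algebra $A$, $sa(A)$ is the set of self-adjoint elements, $S(A)$ the state space, $\mathfrak R a=\frac{a+a^*}2$, $\mathfrak I a=\frac{a-a^*}{2i}$, $a\circ b=\frac{ab+ba}2$, $\{a,b\}=\frac{ab-ba}{2i}$. Seminorms and norms ''defined on a dense subspace'' are extended by the value $+\infty$ outside it; the domain is the set where the value is finite. In $(A,L_\beta)$ the seminorm $L_\beta$ is understood as restricted to $sa(A)$. If $I\cap A_n=\{0\}$ then $1^I_n=0$. $\mathrm{Haus}_\rho$ denotes the Hausdorff distance between sets for a (pseudo)metric $\rho$. Fell topology on $Ideals(A)$. Let $\mathrm{Prim}(A)$ be the primitive ideal space with the Jacobson (hull-kernel) topology; $I\mapsto\{P\in\mathrm{Prim}(A):I\subseteq P\}$ is a bijection from $Ideals(A)$ onto the closed subsets of $\mathrm{Prim}(A)$. The closed subsets carry Fell's topology, with basis the sets $\{Y\text{ closed}:Y\cap C=\emptyset,\ Y\cap U\ne\emptyset\text{ for all }U\in\Phi\}$, for $C$ compact and $\Phi$ a finite family of open sets. The Fell topology on $Ideals(A)$ is the transported topology. Admissible functions. $F:[0,\infty)^4\to[0,\infty)$ is admissible if it is nondecreasing in each variable (for the coordinatewise order) and $x_1x_4+x_2x_3\le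 F(x_1,x_2,x_3,x_4)$. A triple $(F,G,H)$ is admissible if $F$ is admissible, $G:[0,\infty)^3\to[0,\infty)$ is coordinatewise nondecreasing with $(x+y)z\le G(x,y,z)$, and $H:[0,\infty)^2\to[0,\infty)$ is coordinatewise nondecreasing with $2xy\le H(x,y)$. Quantum compact metric spaces. For $F$ admissible, an $F$-Leibniz quantum compact metric space $(A,L)$ is a unital C*-algebra $A$ with a seminorm $L$ defined on a dense Jordan-Lie subalgebra $dom(L)$ of $sa(A)$ such that: (1) $\{a\in dom(L):L(a)=0\}=\mathbb R1_A$; (2) $mk_L(\varphi,\psi)=\sup\{|\varphi(a)-\psi(a)|:a\in sa(A),L(a)\le1\}$ metrizes the weak* topology of $S(A)$; (3) $\{a\in sa(A):L(a)\le1\}$ is norm closed; (4) $\max\{L(a\circ b),L(\{a,b\})\}\le F(\|a\|_A,\|b\|_A,L(a),L(b))$ for all $a,b\in dom(L)$. Metrized quantum vector bundles. For an admissible triple $(F,G,H)$, an $(F,G,H)$-metrized quantum vector bundle $\Omega=(M,\langle\cdot,\cdot\rangle_M,D_M,A,L)$ consists of an $F$-Leibniz quantum compact metric space $(A,L)$, a left Hilbert C*-module $(M,\langle\cdot,\cdot\rangle_M)$ over $A$ (inner product $A$-linear in the first variable, $M$ complete for $\|\omega\|_M=\sqrt{\|\langle\omega,\omega\rangle_M\|_A}$), and a norm $D_M$ defined on a dense $\mathbb C$-subspace of $M$ such that: (1) $\|\cdot\|_M\le D_M$; (2) $\{\omega\in M:D_M(\omega)\le1\}$ is compact for $\|\cdot\|_M$;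 (3) $D_M(a\omega)\le G(\|a\|_A,L(a),D_M(\omega))$ for all $a\in sa(A)$, $\omega\in M$; (4) $\max\{L(\mathfrak R\langle\omega,\eta\rangle_M),L(\mathfrak I\langle\omega,\eta\rangle_M)\}\le H(D_M(\omega),D_M(\eta))$ for all $\omega,\eta\in M$. Modular Gromov-Hausdorff propinquity $\Lambda^{mod}$ (Latrémolière). Fix an admissible triple $(F,G,H)$. For $\Omega=(M,\langle\cdot,\cdot\rangle_M,D_M,A,L)$ let $\mathcal D_1(\Omega)=\{\omega\in M:D_M(\omega)\le1\}$ and $k_\Omega(\omega,\eta)=\sup\{\|\langle\omega,\xi\rangle_M-\langle\eta,\xi\rangle_M\|_A:\xi\in\mathcal D_1(\Omega)\}$. Let $\Omega_A=(M,\langle\cdot,\cdot\rangle_M,D_M,A,L_A)$ and $\Omega_B=(N,\langle\cdot,\cdot\rangle_N,D_N,B,L_B)$ be $(F,G,H)$-metrized quantum vector bundles. A modular bridge $\gamma$ from $\Omega_A$ to $\Omega_B$ consists of a unital C*-algebra $E$; an element $x\in E$ with $\|x\|_E\le1$ such that $S_1(E|x)=\{\varphi\in S(E):\varphi((1_E-x)^*(1_E-x))=\varphi((1_E-x)(1_E-x)^* )=0\}$ is nonempty; unital injective *-homomorphisms $\pi_A:A\to E$ and $\pi_B:B\to E$; a nonempty set $J$; and families $(\omega_j)_{j\in J}$ in $\mathcal D_1(\Omega_A)$ and $(\eta_j)_{j\in J}$ in $\mathcal D_1(\Omega_B)$. Put $bn_\gamma(a,b)=\|\pi_A(a)x-x\pi_B(b)\|_E$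 and $dn_\gamma(\omega,\eta)=\sup_{j\in J}\max\{bn_\gamma(\langle\omega,\omega_j\rangle_M,\langle\eta,\eta_j\rangle_N),\,bn_\gamma(\langle\omega_j,\omega\rangle_M,\langle\eta_j,\eta\rangle_N)\}$. Define: - height $\varsigma(\gamma)=\max\{\mathrm{Haus}_{mk_{L_A}}(S(A),\{\varphi\circ\pi_A:\varphi\in S_1(E|x)\}),\ \mathrm{Haus}_{mk_{L_B}}(S(B),\{\varphi\circ\pi_B:\varphi\in S_1(E|x)\})\}$; - basic reach $\varrho_b(\gamma)=\mathrm{Haus}_{\|\cdot\|_E}(\{\pi_A(a)x:a\in sa(A),L_A(a)\le1\},\{x\pi_B(b):b\in sa(B),L_B(b)\le1\})$; - modular reach $\varrho^\#(\gamma)=\sup_{j\in J}dn_\gamma(\omega_j,\eta_j)$; - imprint $\varpi(\gamma)=\max\{\mathrm{Haus}_{k_{\Omega_A}}(\{\omega_j:j\in J\},\mathcal D_1(\Omega_A)),\ \mathrm{Haus}_{k_{\Omega_B}}(\{\eta_j:j\in J\},\mathcal D_1(\Omega_B))\}$; - length $\lambda(\gamma)=\max\{\varsigma(\gamma),\varrho_b(\gamma),\varrho^\#(\gamma)+\varpi(\gamma)\}$. A modular trek from $\Omega_A$ to $\Omega_B$ is a finite sequence of modular bridges $\gamma_1,\dots,\gamma_k$ between $(F,G,H)$-metrized quantum vector bundles, starting at $\Omega_A$ and ending at $\Omega_B$, the target of $\gamma_i$ being the source of $\gamma_{i+1}$; its length is $\sum_i\lambda(\gamma_i)$. $\Lambda^{mod}(\Omega_A,\Omega_B)$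 is the infimum of the lengths of all modular treks from $\Omega_A$ to $\Omega_B$. It is a pseudometric on $(F,G,H)$-metrized quantum vector bundles (a metric up to a natural notion of isomorphism), and ''the topology induced by $\Lambda^{mod}$'' is the corresponding (pseudo)metric topology. *)

(* Defs.v *)
From HB Require Import structures.
From mathcomp Require Import all_boot all_order all_algebra.
From mathcomp Require Import all_classical all_reals all_analysis.
From mathcomp Require Import complex ring lra.

Set Implicit Arguments.
Unset Strict Implicit.
Unset Printing Implicit Defensive.

Import Order.TTheory GRing.Theory Num.Theory.
Import numFieldNormedType.Exports.

Local Open Scope classical_set_scope.
Local Open Scope ring_scope.
Local Open Scope complex_scope.

(* Real-valued norm: over [R[i]] the library norm takes its values in [R[i]]. *)
Definition rnorm (R : realType) (V : normedZmodType R[i]) (v : V) : R :=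
  complex.Re `|v|.

(* The hierarchy has no join of rings and normed modules, so the norm is a field
   of the C*-structure; the normed module over [R[i]] that it induces is then
   declared on every C*-algebra. [algType] makes C*-algebras unital, nonzero. *)
HB.mixin Record isCStar (R : realType) A & GRing.Algebra R[i] A := {
  cnorm : A -> R;
  star : A -> A;
  cnormD : forall a b, cnorm (a + b) <= cnorm a + cnorm b;
  cnormZ : forall (c : R[i]) a, cnorm (c *: a) = rnorm c * cnorm a;
  cnorm0_eq0 : forall a, cnorm a = 0 -> a = 0;
  cnorm_complete : forall u : nat -> A,
    (forall e : R, 0 < e -> exists N, forall m n, (N <= m)%N -> (N <= n)%N ->
       cnorm (u m - u n) < e) ->
    exists l, forall e : R, 0 < e -> exists N, forall n, (N <= n)%N ->
       cnorm (u n - l) < e;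
  cnormM : forall a b, cnorm (a * b) <= cnorm a * cnorm b;
  starD : forall a b, star (a + b) = star a + star b;
  starZ : forall (c : R[i]) a, star (c *: a) = c^* *: star a;
  starM : forall a b, star (a * b) = star b * star a;
  starK : involutive star;
  cnorm_star : forall a, cnorm (star a * a) = cnorm a ^+ 2
}.

#[short(type="cstarType")]
HB.structure Definition CStar (R : realType) :=
  {A of isCStar R A & GRing.Algebra R[i] A}.

Section CStarNormedModule.
Variables (R : realType) (A : cstarType R).

Let norm (a : A) : R[i] := (cnorm a)%:C.

Let norm_ler_normD (a b : A) : norm (a + b) <= norm a + norm b.
Proof. by rewrite /norm -rmorphD lecR; exact: cnormD. Qed.

Let norm_normrZ (c : R[i]) (a : A) : norm (c *: a) = `|c| * norm a.
Proof. by rewrite /norm cnormZ rmorphM /rnorm; congr (_ * _); rewrite RRe_real ?normr_real. Qed.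

Let norm_eq0 (a : A) : norm a = 0 -> a = 0.
Proof. by move=> /complexI; exact: cnorm0_eq0. Qed.

HB.instance Definition _ := Lmodule_isNormed.Build R[i] (CStar.sort A)
  norm_ler_normD norm_normrZ norm_eq0.

End CStarNormedModule.

Section SelfAdjoint.
Variables (R : realType) (A : cstarType R).
Implicit Types a b : A.

Definition sa : set A := [set a | star a = a].
Definition re_part a : A := (2 : R[i])^-1 *: (a + star a).
Definition im_part a : A := (2 * 'i : R[i])^-1 *: (a - star a).
Definition jordan a b : A := (2 : R[i])^-1 *: (a * b + b * a).
Definition lie a b : A := (2 * 'i : R[i])^-1 *: (a * b - b * a).

Record is_state (phi : A -> R[i]) : Prop := {
  state_linear : forall (c : R[i]) a b, phi (c *: a + b) = c * phi a + phi b;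
  state_pos : forall a, 0 <= phi (star a * a);
  state_unit : phi 1 = 1 }.

Record is_faithful_tracial_state (tau : A -> R[i]) : Prop := {
  fts_state : is_state tau;
  fts_trace : forall a b, tau (a * b) = tau (b * a);
  fts_faithful : forall a, tau (star a * a) = 0 -> a = 0 }.

Record is_fd_subalgebra (B : set A) : Prop := {
  fds0 : B 0;
  fdsD : forall a b, B a -> B b -> B (a + b);
  fdsZ : forall (c : R[i]) a, B a -> B (c *: a);
  fdsM : forall a b, B a -> B b -> B (a * b);
  fds_star : forall a, B a -> B (star a);
  fds_fin : exists s : seq A, forall b, B b ->
    exists c : nat -> R[i], b = \sum_(i < size s) c i *: s`_i }.

Record is_cond_exp (B : set A) (E : A -> A) : Prop := {
  ce_linear : forall (c : R[i]) a b, E (c *: a + b) = c *: E a + E b;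
  ce_range : forall a, B (E a);
  ce_id : forall b, B b -> E b = b;
  ce_contr : forall a, cnorm (E a) <= cnorm a;
  ce_pos : forall a, exists b, E (star a * a) = star b * b;
  ce_bimod : forall b a c, B b -> B c -> E (b * a * c) = b * E a * c }.

Record is_tau_cond_exp (tau : A -> R[i]) (B : set A) (E : A -> A) : Prop := {
  tce_ce : is_cond_exp B E;
  tce_tau : forall a, tau (E a) = tau a }.

End SelfAdjoint.

Record is_unital_star_mono (R : realType) (A B : cstarType R)
    (pi : A -> B) : Prop := {
  usm_linear : forall (c : R[i]) a b, pi (c *: a + b) = c *: pi a + pi b;
  usm_mul : forall a b, pi (a * b) = pi a * pi b;
  usm_one : pi 1 = 1;
  usm_star : forall a, pi (star a) = star (pi a);
  usm_inj : injective pi }.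

Record is_inner_product (R : realType) (H : completeNormedModType R[i])
    (ip : H -> H -> R[i]) : Prop := {
  ip_linear : forall (c : R[i]) x y z, ip (c *: x + y) z = c * ip x z + ip y z;
  ip_conj : forall x y, ip y x = (ip x y)^*;
  ip_norm : forall x, ip x x = `|x| ^+ 2 }.

Record is_irrep (R : realType) (A : cstarType R) (H : completeNormedModType R[i])
    (ip : H -> H -> R[i]) (pi : A -> H -> H) : Prop := {
  irr_linl : forall (c : R[i]) a b x, pi (c *: a + b) x = c *: pi a x + pi b x;
  irr_linr : forall a (c : R[i]) x y, pi a (c *: x + y) = c *: pi a x + pi a y;
  irr_mul : forall a b x, pi (a * b) x = pi a (pi b x);
  irr_star : forall a x y, ip (pi a x) y = ip x (pi (star a) y);
  irr_cont : forall a, continuous (pi a);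
  irr_neq0 : exists a x, pi a x <> 0;
  irr_irr : forall K : set H, closed K -> K 0 ->
    (forall (c : R[i]) x y, K x -> K y -> K (c *: x + y)) ->
    (forall a x, K x -> K (pi a x)) -> K = [set 0] \/ K = setT }.

Definition is_primitive (R : realType) (A : cstarType R) (P : set A) : Prop :=
  exists (H : completeNormedModType R[i]) (ip : H -> H -> R[i])
         (pi : A -> H -> H),
    [/\ is_inner_product ip, is_irrep ip pi &
        P = [set a | forall x, pi a x = 0]].

Lemma irrep_kernel_prime (R : realType) (A : cstarType R)
    (H : completeNormedModType R[i]) (ip : H -> H -> R[i])
    (pi : A -> H -> H) (s t : A) :
  is_irrep ip pi -> (exists x, pi s x <> 0) -> (exists x, pi t x <> 0) ->
  exists a x, pi (s * a * t) x <> 0.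
Proof.
move=> irr [x0 sx0] [x tx].
have pi0 a : pi a 0 = 0.
  have := irr_linr irr a 1 0 0; rewrite !scale1r addr0 => /eqP.
  by rewrite -subr_eq0 opprD addrA subrr sub0r oppr_eq0 => /eqP.
apply: contrapT => nsat.
pose N := [set y | forall a, pi a y = 0].
have sing0 : closed ([set 0] : set H).
  exact/accessible_closed_set1/hausdorff_accessible/norm_hausdorff.
have Ncl : closed N.
  have -> : N = \bigcap_a (pi a @^-1` [set 0]).
    by apply/seteqP; split => [y Ny a _|y Ny a]; [exact: Ny|exact: (Ny a I)].
  apply: closed_bigI => a _; apply: closed_comp => // y _.
  exact: (irr_cont irr).
have Nlin (c : R[i]) y z : N y -> N z -> N (c *: y + z).
  by move=> Ny Nz a; rewrite (irr_linr irr) Ny Nz scaler0 addr0.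
have Ninv a y : N y -> N (pi a y) by move=> Ny b; rewrite Ny pi0.
have N0 : N = [set 0].
  have [//|NT] := irr_irr irr Ncl pi0 Nlin Ninv.
  have [a [z]] := irr_neq0 irr.
  by have /(_ a) -> : N z by rewrite NT.
pose K0 := [set pi a (pi t x) | a in setT].
have K0lin (c : R[i]) y z : K0 y -> K0 z -> K0 (c *: y + z).
  by move=> [a _ <-] [b _ <-]; exists (c *: a + b); rewrite ?(irr_linl irr).
have kerK : closure K0 `<=` [set y | pi s y = 0].
  rewrite closureE; apply: smallest_sub.
    rewrite -[X in closed X]/(pi s @^-1` [set 0]).
    by apply: closed_comp => // y _; exact: (irr_cont irr).
  move=> _ [a _ <-] /=; rewrite -!(irr_mul irr).
  by apply: contrapT => nz; apply: nsat; exists a, x.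
have mapcl (f : H -> H) : continuous f ->
    (forall u, K0 u -> closure K0 (f u)) ->
    forall u, closure K0 u -> closure K0 (f u).
  move=> fc fK; rewrite {1}closureE; apply: smallest_sub => //.
  by apply: closed_comp => // *; exact: closed_closure.
have Kcl0 : closure K0 0.
  apply: subset_closure; exists 0 => //.
  have := irr_linl irr (-1) 0 0 (pi t x).
  by rewrite scaler0 addr0 scaleN1r addNr.
have Klin (c : R[i]) y z :
    closure K0 y -> closure K0 z -> closure K0 (c *: y + z).
  move=> Ky Kz; apply: (mapcl (fun u => c *: u + z)) Ky => [u|u Ku].
    by apply: cvgD; [apply: cvgZl_tmp; exact: cvg_id|exact: cvg_cst].
  apply: (mapcl (fun v => c *: u + v)) Kz => [v|v Kv].
    by apply: cvgD; [exact: cvg_cst|exact: cvg_id].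
  by apply: subset_closure; exact: K0lin.
have Kinv a y : closure K0 y -> closure K0 (pi a y).
  apply: mapcl; first exact: (irr_cont irr).
  move=> _ [b _ <-]; apply: subset_closure; exists (a * b) => //.
  by rewrite (irr_mul irr).
have [K00|KT] := irr_irr irr (@closed_closure _ K0) Kcl0 Klin Kinv.
  apply: tx; suff : N (pi t x) by rewrite N0.
  move=> a; suff : closure K0 (pi a (pi t x)) by rewrite K00.
  by apply: subset_closure; exists a.
by apply: sx0; apply: kerK; rewrite KT.
Qed.

Record prim (R : realType) (A : cstarType R) := Prim {
  prim_set :> set A;
  primP : is_primitive prim_set }.

HB.instance Definition _ (R : realType) (A : cstarType R) :=
  gen_eqMixin (prim A).
HB.instance Definition _ (R : realType) (A : cstarType R) :=
  gen_choiceMixin (prim A).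

Section Jacobson.
Variables (R : realType) (A : cstarType R).

(* A primitive ideal contains [S] iff it contains the closed ideal generated by
   [S], so the closed sets are exactly the hulls of closed ideals. *)
Definition jacobson_open (U : set (prim A)) : Prop :=
  exists S : set A, U = ~` [set P : prim A | S `<=` P].

Let jacobson_openT : jacobson_open setT.
Proof.
exists setT; apply/seteqP; split => // -[P [H [ip [pi [_ irr PE]]]]] _ /= AP.
have [a [x]] := irr_neq0 irr; apply.
by have := AP a I; rewrite PE; exact.
Qed.

Let jacobson_openI : setI_closed jacobson_open.
Proof.
move=> _ _ [S ->] [T ->].
exists [set b | exists s a t, [/\ S s, T t & b = s * a * t]].
apply/seteqP; split => [P [/= SP TP] STP|P /= STP].
- case: P SP TP STP => P [H [ip [pi [_ irr PE]]]] /= SP TP STP.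
  have nz (X : set A) : ~ X `<=` P -> exists2 s, X s & exists x, pi s x <> 0.
    move=> XP; apply: contrapT => nX; apply: XP => s Xs; rewrite PE => x.
    by apply: contrapT => sx; apply: nX; exists s => //; exists x.
  have [s Ss sx] := nz _ SP; have [t Tt tx] := nz _ TP.
  have [a [x]] := irrep_kernel_prime irr sx tx; apply.
  have : P (s * a * t) by apply: STP; exists s, a, t.
  by rewrite PE; exact.
- case: P STP => P [H [ip [pi [_ irr PE]]]] /= STP.
  have pi0 a : pi a 0 = 0.
    have := irr_linr irr a 1 0 0; rewrite !scale1r addr0 => /eqP.
    by rewrite -subr_eq0 opprD addrA subrr sub0r oppr_eq0 => /eqP.
  split=> XP; apply: STP => _ [s [a [t [Ss Tt ->]]]]; rewrite PE => x.
    rewrite !(irr_mul irr); have := XP _ Ss; rewrite PE; exact.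
  by rewrite !(irr_mul irr); have := XP _ Tt; rewrite PE => ->; rewrite !pi0.
Qed.

Let jacobson_open_bigU (I : Type) (f : I -> set (prim A)) :
  (forall i, jacobson_open (f i)) -> jacobson_open (\bigcup_i f i).
Proof.
move=> /choice[S SE]; exists (\bigcup_i S i); apply/seteqP; split => P /=.
- by move=> [i _]; rewrite SE /= => + SP; apply => a Sa; apply: SP; exists i.
- move=> nSP; apply: contrapT => nf; apply: nSP => a [i _ Sa].
  apply: contrapT => nPa; apply: nf; exists i => //.
  by rewrite SE /= => SP; apply: nPa; exact: SP.
Qed.

HB.instance Definition _ := isOpenTopological.Build (prim A)
  jacobson_openT jacobson_openI jacobson_open_bigU.

End Jacobson.

Record closed_set (X : topologicalType) := ClosedSet {
  closed_set_val :> set X;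
  closed_setP : closed closed_set_val }.

HB.instance Definition _ (X : topologicalType) := gen_eqMixin (closed_set X).
HB.instance Definition _ (X : topologicalType) :=
  gen_choiceMixin (closed_set X).

Section Fell.
Variable X : topologicalType.

Definition fell_index : set (set X * set (set X)) :=
  [set CPhi | [/\ compact CPhi.1, finite_set CPhi.2 & CPhi.2 `<=` open]].

Definition fell_basic (CPhi : set X * set (set X)) : set (closed_set X) :=
  [set Y : closed_set X | Y `&` CPhi.1 = set0 /\
     forall U, CPhi.2 U -> Y `&` U !=set0].

Let fell_cover : \bigcup_(CPhi in fell_index) fell_basic CPhi = setT.
Proof.
apply/seteqP; split => // Y _; exists (set0, set0); split => //=.
- exact: compact0.
- by rewrite setI0.
Qed.

Let fell_join CPhi DPsi Y : fell_index CPhi -> fell_index DPsi ->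
  fell_basic CPhi Y -> fell_basic DPsi Y ->
  exists K, [/\ fell_index K, fell_basic K Y &
    fell_basic K `<=` fell_basic CPhi `&` fell_basic DPsi].
Proof.
move=> [cC fPhi oPhi] [cD fPsi oPsi] [YC YPhi] [YD YPsi].
exists (CPhi.1 `|` DPsi.1, CPhi.2 `|` DPsi.2); split => /=.
- split=> /=; first exact: compactU.
    by rewrite finite_setU.
  by rewrite subUset.
- split=> /=; first by rewrite setIUr YC YD setU0.
  by move=> U [/YPhi|/YPsi].
- move=> Z [/= + ZU]; rewrite setIUr setU_eq0 => -[ZC ZD].
  by split; split => // U UU; apply: ZU; [left|right].
Qed.

HB.instance Definition _ := isBaseTopological.Build (closed_set X)
  fell_cover fell_join.

End Fell.

Record is_closed_ideal (R : realType) (A : cstarType R) (I : set A) : Prop := {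
  ideal0 : I 0;
  idealD : forall a b, I a -> I b -> I (a + b);
  idealMl : forall a b, I b -> I (a * b);
  idealMr : forall a b, I a -> I (a * b);
  ideal_closed : closed I }.

Record ideals (R : realType) (A : cstarType R) := Ideal {
  ideal_set :> set A;
  idealP : is_closed_ideal ideal_set }.

HB.instance Definition _ (R : realType) (A : cstarType R) :=
  gen_eqMixin (ideals A).
HB.instance Definition _ (R : realType) (A : cstarType R) :=
  gen_choiceMixin (ideals A).

Lemma hull_closed (R : realType) (A : cstarType R) (I : ideals A) :
  closed [set P : prim A | I `<=` P].
Proof. by rewrite -openC; exists I. Qed.

Definition hull (R : realType) (A : cstarType R) (I : ideals A) :
    closed_set (prim A) :=
  ClosedSet (@hull_closed R A I).

HB.instance Definition _ (R : realType) (A : cstarType R) :=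
  Topological.copy (ideals A) (initial_topology (@hull R A)).

Section AdmissibleFunctions.
Variable R : realType.

Record is_admissible4 (F : R -> R -> R -> R -> R) : Prop := {
  adm4_mono : forall x1 x2 x3 x4 y1 y2 y3 y4,
    0 <= x1 <= y1 -> 0 <= x2 <= y2 -> 0 <= x3 <= y3 -> 0 <= x4 <= y4 ->
    F x1 x2 x3 x4 <= F y1 y2 y3 y4;
  adm4_ge : forall x1 x2 x3 x4, 0 <= x1 -> 0 <= x2 -> 0 <= x3 -> 0 <= x4 ->
    x1 * x4 + x2 * x3 <= F x1 x2 x3 x4 }.

Record is_admissible3 (G : R -> R -> R -> R) : Prop := {
  adm3_mono : forall x y z x' y' z',
    0 <= x <= x' -> 0 <= y <= y' -> 0 <= z <= z' -> G x y z <= G x' y' z';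
  adm3_ge : forall x y z, 0 <= x -> 0 <= y -> 0 <= z ->
    (x + y) * z <= G x y z }.

Record is_admissible2 (H : R -> R -> R) : Prop := {
  adm2_mono : forall x y x' y', 0 <= x <= x' -> 0 <= y <= y' -> H x y <= H x' y';
  adm2_ge : forall x y, 0 <= x -> 0 <= y -> 2 * x * y <= H x y }.

(* The functions are only meaningful on nonnegative arguments, where they are
   nonnegative as a consequence of the lower bounds. *)
Record admissible_triple := AdmissibleTriple {
  admF : R -> R -> R -> R -> R;
  admG : R -> R -> R -> R;
  admH : R -> R -> R;
  admFP : is_admissible4 admF;
  admGP : is_admissible3 admG;
  admHP : is_admissible2 admH }.

End AdmissibleFunctions.

(* [L : A -> \bar R] stands for its restriction to [sa A]: only the values on
   self-adjoint elements are ever used. The value +oo encodes being outside of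
   the domain, and bounds by [F], [G], [H] are required on the domains. *)
Section QuantumMetric.
Variables (R : realType) (A : cstarType R) (L : A -> \bar R).

Definition dom : set A := [set a | sa a /\ (L a < +oo)%E].

Definition lip_ball : set A := [set a | sa a /\ (L a <= 1)%E].

Definition mk (phi psi : A -> R[i]) : \bar R :=
  ereal_sup [set (rnorm (phi a - psi a))%:E | a in lip_ball].

(* The weak* topology of the state space is the trace of pointwise convergence. *)
Definition metrizes_weak_star : Prop :=
  (forall phi psi, is_state phi -> is_state psi -> (mk phi psi < +oo)%E) /\
  forall phi : {ptws A -> R[i]^o}, is_state phi ->
    within [set psi : {ptws A -> R[i]^o} | is_state psi] (nbhs phi) =
    filter_from [set e : R | 0 < e]
      (fun e => [set psi | is_state psi /\ (mk phi psi < e%:E)%E]).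

Record is_qcms (F : R -> R -> R -> R -> R) : Prop := {
  lip_ge0 : forall a, sa a -> (0 <= L a)%E;
  lipZ : forall (r : R) a, sa a -> L (r%:C *: a) = (`|r|%:E * L a)%E;
  lipD : forall a b, sa a -> sa b -> (L (a + b)%R <= L a + L b)%E;
  lip_dense : @sa R A `<=` closure dom;
  lip_jordan : forall a b, dom a -> dom b -> dom (jordan a b);
  lip_lie : forall a b, dom a -> dom b -> dom (lie a b);
  lip_ker : [set a | dom a /\ L a = 0%E] = [set r%:C *: 1 | r in [set: R]];
  lip_mk : metrizes_weak_star;
  lip_closed : closed lip_ball;
  lip_leibniz : forall a b, dom a -> dom b ->
    (maxe (L (jordan a b)) (L (lie a b)) <=
      (F (cnorm a) (cnorm b) (fine (L a)) (fine (L b)))%:E)%E }.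

End QuantumMetric.

Record bundle_data (R : realType) := BundleData {
  bd_alg : cstarType R;
  bd_lip : bd_alg -> \bar R;
  bd_mod : normedModType R[i];
  bd_act : bd_alg -> bd_mod -> bd_mod;
  bd_inner : bd_mod -> bd_mod -> bd_alg;
  bd_norm : bd_mod -> \bar R }.

Record is_hilbert_module (R : realType) (A : cstarType R)
    (M : normedModType R[i]) (act : A -> M -> M) (inner : M -> M -> A) : Prop := {
  hm_actDl : forall a b w, act (a + b) w = act a w + act b w;
  hm_actDr : forall a w v, act a (w + v) = act a w + act a v;
  hm_actM : forall a b w, act (a * b) w = act a (act b w);
  hm_act1 : forall w, act 1 w = w;
  hm_actZl : forall (c : R[i]) a w, act (c *: a) w = c *: act a w;
  hm_actZr : forall (c : R[i]) a w, act a (c *: w) = c *: act a w;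
  hm_innerD : forall w v u, inner (w + v) u = inner w u + inner v u;
  hm_innerM : forall a w v, inner (act a w) v = a * inner w v;
  hm_star : forall w v, star (inner w v) = inner v w;
  hm_pos : forall w, exists b, inner w w = star b * b;
  hm_norm : forall w, rnorm w = Num.sqrt (cnorm (inner w w));
  hm_complete : forall F : set_system M, ProperFilter F -> cauchy F -> cvg F }.

Definition unit_ball (R : realType) (O : bundle_data R) : set (bd_mod O) :=
  [set w | (bd_norm w <= 1)%E].

Record is_mqvb (R : realType) (T : admissible_triple R) (O : bundle_data R) :
    Prop := {
  mqvb_qcms : is_qcms (@bd_lip R O) (admF T);
  mqvb_hilbert : is_hilbert_module (@bd_act R O) (@bd_inner R O);
  mqvb_normZ : forall (c : R[i]) (w : bd_mod O),
    bd_norm (c *: w) = ((rnorm c)%:E * bd_norm w)%E;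
  mqvb_normD : forall w v : bd_mod O,
    (bd_norm (w + v)%R <= bd_norm w + bd_norm v)%E;
  mqvb_dense : closure [set w : bd_mod O | (bd_norm w < +oo)%E] = setT;
  mqvb_norm_ge : forall w : bd_mod O, ((rnorm w)%:E <= bd_norm w)%E;
  mqvb_compact : compact (@unit_ball R O);
  mqvb_norm_act : forall (a : bd_alg O) (w : bd_mod O),
    dom (@bd_lip R O) a -> (bd_norm w < +oo)%E ->
    (bd_norm (bd_act a w) <=
      (admG T (cnorm a) (fine (bd_lip a)) (fine (bd_norm w)))%:E)%E;
  mqvb_lip_inner : forall w v : bd_mod O,
    (bd_norm w < +oo)%E -> (bd_norm v < +oo)%E ->
    (maxe (bd_lip (re_part (bd_inner w v))) (bd_lip (im_part (bd_inner w v))) <=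
      (admH T (fine (bd_norm w)) (fine (bd_norm v)))%:E)%E }.

Record mqvb (R : realType) (T : admissible_triple R) := MQVB {
  mqvb_data :> bundle_data R;
  mqvbP : is_mqvb T mqvb_data }.

Definition haus (R : realType) (X : Type) (rho : X -> X -> \bar R)
    (P Q : set X) : \bar R :=
  maxe (ereal_sup [set ereal_inf [set rho p q | q in Q] | p in P])
       (ereal_sup [set ereal_inf [set rho p q | p in P] | q in Q]).

Definition k_dist (R : realType) (O : bundle_data R) (w v : bd_mod O) : \bar R :=
  ereal_sup [set (cnorm (bd_inner w x - bd_inner v x))%:E | x in @unit_ball R O].

Definition one_level (R : realType) (E : cstarType R) (x : E) :
    set (E -> R[i]) :=
  [set phi | [/\ is_state phi, phi (star (1 - x) * (1 - x)) = 0 &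
                 phi ((1 - x) * star (1 - x)) = 0]].

Record modular_bridge (R : realType) (P Q : bundle_data R) := ModularBridge {
  br_alg : cstarType R;
  br_pivot : br_alg;
  br_pivot_norm : cnorm br_pivot <= 1;
  br_level_neq0 : one_level br_pivot !=set0;
  br_l : bd_alg P -> br_alg;
  br_lP : is_unital_star_mono br_l;
  br_r : bd_alg Q -> br_alg;
  br_rP : is_unital_star_mono br_r;
  br_J : Type;
  br_J_inhabited : inhabited br_J;
  br_anchor : br_J -> bd_mod P;
  br_anchorP : forall j, @unit_ball R P (br_anchor j);
  br_coanchor : br_J -> bd_mod Q;
  br_coanchorP : forall j, @unit_ball R Q (br_coanchor j) }.

Arguments br_anchor {R P Q} m.
Arguments br_coanchor {R P Q} m.

Section BridgeLength.
Variables (R : realType) (P Q : bundle_data R) (g : modular_bridge P Q).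
Let E := br_alg g.
Let x : E := br_pivot g.

Definition br_bn (a : bd_alg P) (b : bd_alg Q) : R :=
  cnorm (br_l g a * x - x * br_r g b).

Definition br_dn (w : bd_mod P) (v : bd_mod Q) : \bar R :=
  ereal_sup [set maxe
      (br_bn (bd_inner w (br_anchor g j)) (bd_inner v (br_coanchor g j)))%:E
      (br_bn (bd_inner (br_anchor g j) w) (bd_inner (br_coanchor g j) v))%:E
    | j in [set: br_J g]].

Definition br_height : \bar R :=
  maxe (haus (mk (@bd_lip R P)) [set phi | is_state phi]
             [set phi \o br_l g | phi in one_level x])
       (haus (mk (@bd_lip R Q)) [set phi | is_state phi]
             [set phi \o br_r g | phi in one_level x]).

Definition br_basic_reach : \bar R :=
  haus (fun a b : E => (cnorm (a - b))%:E)
    [set br_l g a * x | a in lip_ball (@bd_lip R P)]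
    [set x * br_r g b | b in lip_ball (@bd_lip R Q)].

Definition br_modular_reach : \bar R :=
  ereal_sup [set br_dn (br_anchor g j) (br_coanchor g j) | j in [set: br_J g]].

Definition br_imprint : \bar R :=
  maxe (haus (@k_dist R P) (range (br_anchor g)) (@unit_ball R P))
       (haus (@k_dist R Q) (range (br_coanchor g)) (@unit_ball R Q)).

Definition br_length : \bar R :=
  maxe br_height (maxe br_basic_reach (br_modular_reach + br_imprint)%E).

End BridgeLength.

Section Propinquity.
Variables (R : realType) (T : admissible_triple R).

Inductive trek : mqvb T -> mqvb T -> Type :=
| TrekBridge (P Q : mqvb T) : modular_bridge P Q -> trek P Q
| TrekCons (P Q S : mqvb T) : modular_bridge P Q -> trek Q S -> trek P S.

Fixpoint trek_length (P Q : mqvb T) (t : trek P Q) : \bar R :=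
  match t with
  | TrekBridge _ _ g => br_length g
  | TrekCons _ _ _ g t' => (br_length g + trek_length t')%E
  end.

Definition propinquity (P Q : mqvb T) : \bar R :=
  ereal_inf [set l | exists t : trek P Q, l = trek_length t].

(* [mqvb T] lives in a universe above the carriers of the library's topological
   spaces, hence the topology is given by its open sets as plain predicates. *)
Definition propinquity_open (U : mqvb T -> Prop) : Prop :=
  forall P, U P -> exists2 e : R, 0 < e &
    forall Q, (propinquity P Q < e%:E)%E -> U Q.

Definition propinquity_continuous (X : topologicalType) (f : X -> mqvb T) : Prop :=
  forall U, propinquity_open U -> open [set x | U (f x)].

End Propinquity.

Section IdealModule.
Variables (R : realType) (A : cstarType R) (I : ideals A).

Let memI : {pred A} := mem (ideal_set I).

Let memI_submod_closed : submod_closed memI.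
Proof.
have IP := idealP I; split; first by rewrite inE; exact: ideal0 IP.
move=> c a b; rewrite !inE => Ia Ib; apply: (idealD IP) => //.
by rewrite -mulr_algl; exact: (idealMl IP).
Qed.

HB.instance Definition _ := GRing.isSubmodClosed.Build R[i] A memI
  memI_submod_closed.

Definition ideal_mod : Type := {a : A | memI a}.

HB.instance Definition _ := SubChoice.on ideal_mod.
HB.instance Definition _ := [SubChoice_isSubLmodule of ideal_mod by <:].

Let norm (w : ideal_mod) : R[i] := `|val w : A|.

Let norm_ler_normD (w v : ideal_mod) : norm (w + v) <= norm w + norm v.
Proof. exact: ler_normD. Qed.

Let norm_normrZ (c : R[i]) (w : ideal_mod) : norm (c *: w) = `|c| * norm w.
Proof. exact: normrZ. Qed.

Let norm_eq0 (w : ideal_mod) : norm w = 0 -> w = 0.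
Proof. by move=> /normr0_eq0 w0; exact: val_inj. Qed.

HB.instance Definition _ := Lmodule_isNormed.Build R[i] ideal_mod
  norm_ler_normD norm_normrZ norm_eq0.

Lemma ideal_act_subproof (a : A) (w : ideal_mod) : memI (a * val w).
Proof. by have := valP w; rewrite !inE; exact: idealMl (idealP I) _ _. Qed.

Definition ideal_act (a : A) (w : ideal_mod) : ideal_mod :=
  exist _ (a * val w) (ideal_act_subproof a w).

Definition ideal_inner (w v : ideal_mod) : A := val w * star (val v).

End IdealModule.

Section IdealBundle.
Variables (R : realType) (A : cstarType R) (A_ : nat -> set A)
  (E : nat -> A -> A) (beta : nat -> R).

Definition L_beta (a : A) : \bar R :=
  ereal_sup (range (fun n => (cnorm (a - E n a) / beta n)%:E)).

(* The unit of [I `&` A_ n]; it is 0 when [I `&` A_ n = [set 0]]. *)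
Definition ideal_unit (I : ideals A) (n : nat) : A :=
  xget 0 [set e | (I `&` A_ n) e /\
                  forall b, (I `&` A_ n) b -> e * b = b /\ b * e = b].

Definition D_beta (I : ideals A) (w : ideal_mod I) : \bar R :=
  maxe (L_beta (val w)) (maxe (cnorm (val w))%:E
    (ereal_sup (range (fun n =>
      (cnorm (val w - val w * ideal_unit I n) / beta n)%:E)))).

Definition Omega_beta (I : ideals A) : bundle_data R :=
  BundleData L_beta (@ideal_act R A I) (@ideal_inner R A I) (@D_beta I).

End IdealBundle.

Section LatremoliereTriple.
Variable R : realType.

Definition F_beta (x1 x2 x3 x4 : R) : R := 2 * (x1 * x4 + x2 * x3).
Definition G_beta (x y z : R) : R := F_beta x y z z.
Definition H_beta (x y : R) : R := F_beta x x y y.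

Lemma F_beta_admissible : is_admissible4 F_beta.
Proof.
split=> [x1 x2 x3 x4 y1 y2 y3 y4|x1 x2 x3 x4 *]; rewrite /F_beta; last by nra.
move=> /andP[? ?] /andP[? ?] /andP[? ?] /andP[? ?].
by rewrite ler_wpM2l// lerD// ler_pM.
Qed.

Lemma G_beta_admissible : is_admissible3 G_beta.
Proof.
split=> [*|x y z *]; first exact: (adm4_mono F_beta_admissible).
by rewrite /G_beta /F_beta; nra.
Qed.

Lemma H_beta_admissible : is_admissible2 H_beta.
Proof.
split=> [*|x y *]; first exact: (adm4_mono F_beta_admissible).
by rewrite /H_beta /F_beta; nra.
Qed.

Definition triple_beta : admissible_triple R :=
  AdmissibleTriple F_beta_admissible G_beta_admissible H_beta_admissible.

End LatremoliereTriple.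

(* Main.v *)
(* If [I] and [J] meet [A_ n] in the same ideal, the trivial bridge (pivot [1] in
   [A], identity embeddings) anchored at their common elements in [A_ n] has zero
   height, basic reach and modular reach; its imprint is controlled by moving [w]
   to a rescaling of [E_n (w u_n)], [u_n] being the unit of [I `&` A_ n], and is at
   most [2 (beta n + max_(m < n) beta n / beta m)], which tends to 0.

   It remains to see that the [J] meeting [A_ n] like [I] form a Fell
   neighbourhood of [I]. Units of [J `&` A_ n] at distance [< 1] are equal, so by
   total boundedness there are finitely many of them. Such a unit [e] stays in
   [J] near [I] if [e] is in [I], by compactness of the set of primitive ideals
   missing [e], and stays outside [J] if [e] is not in [I], by openness of this set.
   Both need a primitive ideal above [J] missing a given projection [p] not in [J]
   of some [A_ k]. Choose decreasing minimal projections [q_n] of [A_ n], not in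
   [J], below [p]. Then [phi a = lim tau (q_n a q_n) / tau q_n] is a state that
   vanishes on [J] with [phi p = 1], and its GNS representation is irreducible
   because the [q_n] converge strongly to the rank-one projection on the cyclic
   vector. *)
From HB Require Import structures.
Require Import Defs.
From mathcomp Require Import all_boot all_order all_algebra.
From mathcomp Require Import all_classical all_reals all_analysis.
From mathcomp Require Import complex ring lra.

Set Implicit Arguments.
Unset Strict Implicit.
Unset Printing Implicit Defensive.

Import Order.TTheory GRing.Theory Num.Theory.
Import numFieldNormedType.Exports.

Local Open Scope classical_set_scope.
Local Open Scope ring_scope.
Local Open Scope complex_scope.

(** * Norms and C*-algebras *)

(** All bundles share [A] and [L_beta], so only the module side of a bridge can cost anything. For
    an element of [A_ n] the norm [D_beta] sees the ideal only through its units of index below [n],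
    and these are determined by the unit of index [n]; hence one equality of units makes the
    truncated unit balls coincide. The decay of the ratios of [beta] serves the truncation: cutting
    [w] down to level [n] costs a multiple of [beta n], which disturbs the constraint at a coarser
    level [m] by a multiple of [beta n / beta m], and rescaling into the unit ball pays for the
    excess. Functional calculus is avoided. Positivity estimates rest on a square root of [1 - h]
    obtained by a fixed point iteration, and projections in [A_ n] on orthogonal projection for the
    inner product of the faithful trace. Primitive ideals usually come from extreme points of the
    state space; here the trace compressed to minimal projections yields the pure states
    explicitly. *)

Section RealNorm.
Variables (R : realType) (V : normedZmodType R[i]).
Implicit Types v w : V.

Lemma rnormE v : `|v| = (rnorm v)%:C.
Proof. by rewrite /rnorm RRe_real ?normr_real. Qed.

Lemma rnorm_ge0 v : 0 <= rnorm v.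
Proof. by rewrite -(@lecR R 0) -rnormE; exact: normr_ge0. Qed.

Lemma rnorm0 : rnorm (0 : V) = 0.
Proof. by rewrite /rnorm normr0. Qed.

Lemma rnorm_eq0 v : rnorm v = 0 -> v = 0.
Proof. by move=> v0; apply: normr0_eq0; rewrite rnormE v0. Qed.

Lemma rnormD v w : rnorm (v + w) <= rnorm v + rnorm w.
Proof. by rewrite -lecR rmorphD /= -!rnormE ler_normD. Qed.

Lemma rnormN v : rnorm (- v) = rnorm v.
Proof. by rewrite /rnorm normrN. Qed.

Lemma rnorm_distC v w : rnorm (v - w) = rnorm (w - v).
Proof. by rewrite -rnormN opprB. Qed.

End RealNorm.

Section RealNormTopology.
Variables (R : realType) (V : normedModType R[i]).
Implicit Types v w : V.

(** Radii of balls live in [R[i]], but a positive complex number is real, so real radii suffice. *)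
Lemma rnorm_nbhs v (U : set V) :
  nbhs v U <-> exists2 e : R, 0 < e & forall w, rnorm (v - w) < e -> U w.
Proof.
split.
  move=> /nbhs_ballP[e /= e0 eU]; exists (complex.Re e).
    by move: e0; rewrite ltcE /= => /andP[].
  move=> w vw; apply: eU; rewrite -ball_normE /ball_ /= rnormE.
  by move: e0; rewrite !ltcE /= => /andP[/eqP <- _]; rewrite eqxx.
move=> [e e0 eU]; apply/nbhs_ballP; exists e%:C; first by rewrite /= ltcR.
by move=> w; rewrite -ball_normE /ball_ /= rnormE ltcR; exact: eU.
Qed.

Lemma rnorm_closure (S : set V) v :
  closure S v <-> forall e : R, 0 < e -> exists2 w, S w & rnorm (v - w) < e.
Proof.
split=> [Sv e e0|Sv U /rnorm_nbhs[e e0 eU]].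
  have /Sv[w [Sw vw]] : nbhs v [set w | rnorm (v - w) < e].
    by apply/rnorm_nbhs; exists e.
  by exists w.
by have [w Sw vw] := Sv _ e0; exists w; split => //; exact: eU.
Qed.

Lemma rnorm_closed (S : set V) :
  (forall v, (forall e : R, 0 < e -> exists2 w, S w & rnorm (v - w) < e) -> S v)
  -> closed S.
Proof. by move=> Sc v /rnorm_closure; exact: Sc. Qed.

Lemma rnorm_closedP (S : set V) v : closed S ->
  (forall e : R, 0 < e -> exists2 w, S w & rnorm (v - w) < e) -> S v.
Proof. by move=> Sc Sv; apply: Sc; apply/rnorm_closure. Qed.

End RealNormTopology.

Lemma rnormRC (R : realType) (r : R) : rnorm (r%:C : R[i]) = `|r|.
Proof. by rewrite /rnorm normc_def /= expr0n addr0 sqrtr_sqr. Qed.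

Lemma rnormM (R : realType) (c d : R[i]) : rnorm (c * d) = rnorm c * rnorm d.
Proof. by apply: (@complexI R); rewrite rmorphM /= -!rnormE normrM. Qed.

Section CStarBasics.
Variables (R : realType) (A : cstarType R).
Implicit Types a b c : A.

Lemma rnorm_cnorm a : rnorm a = cnorm a.
Proof. by []. Qed.

Lemma cnorm_ge0 a : 0 <= cnorm a.
Proof. exact: (@rnorm_ge0 R A). Qed.

Lemma cnorm0 : cnorm (0 : A) = 0.
Proof. exact: (@rnorm0 R A). Qed.

Lemma cnormN a : cnorm (- a) = cnorm a.
Proof. exact: (@rnormN R A). Qed.

Lemma cnorm_distC a b : cnorm (a - b) = cnorm (b - a).
Proof. by rewrite -cnormN opprB. Qed.

Lemma cnormB a b : cnorm (a - b) <= cnorm a + cnorm b.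
Proof. by rewrite -(cnormN b) cnormD. Qed.

Lemma cnorm_le_dist a b : cnorm a <= cnorm b + cnorm (a - b).
Proof. by rewrite -[in leLHS](subrK b a) addrC cnormD. Qed.

Lemma cnorm_triangle b a c : cnorm (a - c) <= cnorm (a - b) + cnorm (b - c).
Proof. by rewrite -[a - c](subrKA b) cnormD. Qed.

Lemma star0 : star (0 : A) = 0.
Proof. by have := starD (0 : A) 0; rewrite addr0 => /eqP; rewrite -subr_eq subrr => /eqP. Qed.

Lemma starN a : star (- a) = - star a.
Proof. by apply/eqP; rewrite -subr_eq0 opprK -starD addNr star0. Qed.

Lemma starB a b : star (a - b) = star a - star b.
Proof. by rewrite starD starN. Qed.

Lemma star1 : star (1 : A) = 1.
Proof. by rewrite -[LHS]mul1r -[X in X * _]starK -starM mul1r starK. Qed.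

Lemma starX a n : star (a ^+ n) = star a ^+ n.
Proof. by elim: n => [|n IH]; rewrite ?expr0 ?star1// exprS starM IH -exprSr. Qed.

Lemma cnorm_starE a : cnorm (star a) = cnorm a.
Proof.
have le b : cnorm b <= cnorm (star b).
  have := cnorm_star b; have := cnormM (star b) b.
  have [->|b0] := eqVneq (cnorm b) 0; first by move=> *; exact: cnorm_ge0.
  by move=> + E; rewrite E expr2 ler_pM2r// lt_neqAle eq_sym b0 cnorm_ge0.
by apply/eqP; rewrite eq_le le -{2}(starK a) le.
Qed.

Lemma cnorm1 : cnorm (1 : A) = 1.
Proof.
have := cnorm_star (1 : A); rewrite star1 mul1r => /eqP.
rewrite expr2 -subr_eq0 -[X in X - _]mulr1 -mulrBr mulf_eq0 => /orP[/eqP/cnorm0_eq0/eqP|].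
  by rewrite oner_eq0.
by rewrite subr_eq0 eq_sym => /eqP.
Qed.

Lemma cnorm_stars a : cnorm (a * star a) = cnorm a ^+ 2.
Proof. by rewrite -{1}(starK a) cnorm_star cnorm_starE. Qed.

Lemma star_eq0 a : star a * a = 0 -> a = 0.
Proof.
move=> a0; apply: cnorm0_eq0; apply/eqP.
by have /eqP := cnorm_star a; rewrite a0 cnorm0 eq_sym sqrf_eq0.
Qed.

Lemma stars_eq0 a : a * star a = 0 -> a = 0.
Proof. by rewrite -{1}(starK a) => /star_eq0 a0; rewrite -(starK a) a0 star0. Qed.

(** Each use of the C*-identity doubles the exponent; this keeps the powers in [dist_ideal_unit] at
    norm 1. *)
Lemma cnorm_saX a n : star a = a -> cnorm (a ^+ (2 ^ n)) = cnorm a ^+ (2 ^ n).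
Proof.
move=> sa_a; elim: n => [|n IH]; first by rewrite expn0 !expr1.
by rewrite expnSr !exprM -IH -cnorm_star starX sa_a expr2.
Qed.

Lemma cnormZr (r : R) a : cnorm (r%:C *: a) = `|r| * cnorm a.
Proof. by rewrite cnormZ rnormRC. Qed.

Lemma cnormZr_ge0 (r : R) a : 0 <= r -> cnorm (r%:C *: a) = r * cnorm a.
Proof. by move=> r0; rewrite cnormZr ger0_norm. Qed.

End CStarBasics.

Lemma invS_lt (R : realType) (e : R) : 0 < e ->
  exists N, forall n, (N <= n)%N -> n.+1%:R^-1 < e.
Proof.
move=> e0; have [N _ H] := near_infty_natSinv_lt (PosNum e0).
by exists N => n /H.
Qed.

(** * Completeness, total boundedness and compactness *)

Section Completeness.
Variables (R : realType) (V : normedModType R[i]).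

Definition cauchy_seq (u : nat -> V) : Prop := forall e : R, 0 < e ->
  exists N, forall m n, (N <= m)%N -> (N <= n)%N -> rnorm (u m - u n) < e.

Definition lim_seq (u : nat -> V) (l : V) : Prop := forall e : R, 0 < e ->
  exists N, forall n, (N <= n)%N -> rnorm (u n - l) < e.

Lemma seq_complete_cvg : (forall u, cauchy_seq u -> exists l, lim_seq u l) ->
  forall F : set_system V, ProperFilter F -> cauchy F -> cvg F.
Proof.
move=> Vc F FF /cauchyP Fc.
have /choice[u uF] : forall n, exists x : V,
    F [set y | rnorm (x - y) < n.+1%:R^-1].
  move=> n; have [|x Fx] := Fc (n.+1%:R^-1)%:C.
    by rewrite -[0]/(0%:C) ltcR invr_gt0.
  exists x; apply: filterS Fx => y.
  by rewrite -ball_normE /ball_ /= rnormE ltcR.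
have [|l ul] := Vc u.
  move=> e e0; have [N HN] := invS_lt (divr_gt0 e0 (ltr0n R 2)).
  exists N => m n Nm Nn.
  have [y [ym yn]] := filter_ex (filterI (uF m) (uF n)).
  have := rnormD (u m - y) (y - u n); rewrite subrKA => H.
  apply: le_lt_trans H _; rewrite [rnorm (y - _)]rnorm_distC.
  by rewrite [ltRHS]splitr ltrD//; [apply: lt_trans ym (HN _ Nm)|apply: lt_trans yn (HN _ Nn)].
apply/cvg_ex; exists l => U /rnorm_nbhs[e e0 eU].
have e2 := divr_gt0 e0 (ltr0n R 2).
have [N HN] := invS_lt e2; have [M HM] := ul _ e2.
apply: filterS (uF (maxn N M)) => y /= uy; apply: eU.
have := rnormD (l - u (maxn N M)) (u (maxn N M) - y); rewrite subrKA => H.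
apply: le_lt_trans H _; rewrite [rnorm (l - _)]rnorm_distC.
by rewrite [ltRHS]splitr ltrD ?HM ?leq_maxr// (lt_trans uy)// HN// leq_maxl.
Qed.

Definition tot_bounded (S : set V) : Prop := forall e : R, 0 < e ->
  exists s : seq V, forall v, S v -> exists2 x, x \in s & rnorm (v - x) < e.

(** An ultrafilter containing a finite union of balls contains one of them, so every ultrafilter on
    [S] is Cauchy. *)
Lemma tot_bounded_compact (S : set V) :
  (forall F : set_system V, ProperFilter F -> cauchy F -> cvg F) ->
  closed S -> tot_bounded S -> compact S.
Proof.
move=> Vc Scl Stb; rewrite compact_ultra => F FU FS.
have : cvg F.
  apply: Vc; apply/cauchyP => e e0.
  have eE : (complex.Re e)%:C = e by rewrite RRe_real// gtr0_real.
  have [|s sS] := Stb (complex.Re e); first by rewrite -ltcR eE.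
  have : F [set v | exists2 x, x \in s & ball x e v].
    apply: filterS FS => v /sS[x xs vx]; exists x => //.
    by rewrite -ball_normE /ball_ /= distrC rnormE -eE ltcR.
  elim: s {sS} => [|x s IH] FxU.
    by have [v [y]] := filter_ex FxU.
  have [Fx|Fx] := @in_ultra_setVsetC _ F (ball x e) FU; first by exists x.
  apply: IH; apply: filterS (filterI FxU Fx) => v [[y]].
  by rewrite inE => /orP[/eqP -> //|ys yv _]; exists y.
by move=> /cvg_ex[l Fl]; exists l; split => //;
  apply: (@closed_cvg _ _ F _ id S Scl) => //.
Qed.

Lemma tot_bounded_in (S : set V) : tot_bounded S -> forall e : R, 0 < e ->
  exists s : seq V, [set` s] `<=` S /\
    forall v, S v -> exists2 x, x \in s & rnorm (v - x) < e.
Proof.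
move=> Stb e e0; have [s] := Stb _ (divr_gt0 e0 (ltr0n R 2)).
(* Each ball of radius [e / 2] that meets [S] is replaced by the ball of radius [e] about one of its
   points in [S]; the others are dropped. *)
have: exists t : seq V, [set` t] `<=` S /\ forall v, S v ->
    (exists2 x, x \in s & rnorm (v - x) < e / 2) ->
    exists2 x, x \in t & rnorm (v - x) < e.
  elim: s => [|x s [t [tS Ht]]].
    by exists [::]; split => // v _ [].
  have [[y [Sy yx]]|nex] := pselect (exists y, S y /\ rnorm (y - x) < e / 2).
    exists (y :: t); split=> [z|v Sv [z]].
      by rewrite /= inE => /orP[/eqP -> //|]; exact: tS.
    rewrite inE => /orP[/eqP -> vx|zs vz].
      exists y; rewrite ?mem_head//.
      have := rnormD (v - x) (x - y); rewrite subrKA => H.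
      by apply: le_lt_trans H _; rewrite [rnorm (x - y)]rnorm_distC; lra.
    have [|w wt vw] := Ht v Sv; first by exists z.
    by exists w => //; rewrite inE wt orbT.
  exists t; split => // v Sv [z]; rewrite inE => /orP[/eqP -> vx|zs vz].
    by exfalso; apply: nex; exists v.
  by apply: Ht => //; exists z.
by move=> [t [tS Ht]] Hs; exists t; split => // v Sv; apply: Ht => //; exact: Hs.
Qed.

End Completeness.

Lemma cstar_complete (R : realType) (A : cstarType R) (F : set_system A) :
  ProperFilter F -> cauchy F -> cvg F.
Proof.
by apply: seq_complete_cvg => u uc; exact: cnorm_complete uc.
Qed.

Lemma expr_lt_eps (R : realType) (r e : R) : 0 <= r -> r < 1 -> 0 < e ->
  exists N, forall n, (N <= n)%N -> r ^+ n < e.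
Proof.
move=> r0 r1 e0; have rn : `|r| < 1 by rewrite ger0_norm.
have /cvgrPdist_lt/(_ _ e0)[N _ H] := cvg_expr rn.
by exists N => n /H; rewrite /= sub0r normrN ger0_norm// exprn_ge0.
Qed.

Lemma conjC_real (R : realType) (r : R) : Num.conj (r%:C : R[i]) = r%:C.
Proof. exact: (@conjc_real R r). Qed.

Lemma eps_cnorm_eq0 (R : realType) (A : cstarType R) (a : A) :
  (forall e : R, 0 < e -> cnorm a <= e) -> a = 0.
Proof.
move=> a_le; apply: cnorm0_eq0; apply/eqP; rewrite eq_le cnorm_ge0 andbT.
by apply/ler_addgt0Pr => e e0; rewrite add0r a_le.
Qed.

Section SquareRoot.
Variables (R : realType) (A : cstarType R) (h : A).
Hypotheses (h_sa : star h = h) (h_lt1 : cnorm h < 1).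

(** A fixed point [y] of [step] satisfies [(1 - y) * (1 - y) = 1 - h]. The ball of radius [rho] is
    invariant, and on it [step] contracts with ratio [rho < 1]. *)
Let rho := (1 + cnorm h) / 2.
Let half : R := 2^-1.
Let step (y : A) : A := half%:C *: (h + y * y).

Let rho_ge0 : 0 <= rho.
Proof. by rewrite /rho; have := cnorm_ge0 h; lra. Qed.

Let rho_lt1 : rho < 1.
Proof. by rewrite /rho; have := h_lt1; lra. Qed.

Let step_norm y : cnorm y <= rho -> cnorm (step y) <= rho.
Proof.
move=> yr; rewrite /step cnormZr_ge0 /half ?invr_ge0//.
have := cnormD h (y * y); have := cnormM y y.
have := cnorm_ge0 y; have := cnorm_ge0 h; move: h_lt1 yr; rewrite /rho.
by nra.
Qed.

Let step_contr y z : cnorm y <= rho -> cnorm z <= rho ->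
  cnorm (step y - step z) <= rho * cnorm (y - z).
Proof.
move=> yr zr; rewrite /step -scalerBr cnormZr_ge0 /half ?invr_ge0//.
have -> : h + y * y - (h + z * z) = y * (y - z) + (y - z) * z.
  by rewrite mulrBr mulrBl subrKA opprD addrACA subrr add0r.
have := cnormD (y * (y - z)) ((y - z) * z).
have := cnormM y (y - z); have := cnormM (y - z) z.
have := cnorm_ge0 (y - z); move: yr zr.
by nra.
Qed.

Let u n := iter n step 0.

Let u_norm n : cnorm (u n) <= rho.
Proof. by elim: n => [|n IH]; rewrite /u/= ?cnorm0//; exact: step_norm. Qed.

Let u_diff m k : cnorm (u (m + k)%N - u m) <= rho ^+ m.
Proof.
elim: m => [|m IH].
  by rewrite expr0 /= subr0 add0n (le_trans (u_norm k))// ltW.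
rewrite addSn exprS; apply: le_trans (step_contr (u_norm _) (u_norm _)) _.
by rewrite ler_wpM2l.
Qed.

Lemma sqrt_one_sub : exists2 w : A, star w = w & 1 - h = w * w.
Proof.
have [|l ul] := @cnorm_complete R A u.
  move=> e e0; have [N HN] := expr_lt_eps rho_ge0 rho_lt1 e0.
  exists N => m n; wlog mn : m n / (m <= n)%N => [W Nm Nn|Nm Nn].
    have [/W -> //|/ltnW/W nm] := leqP m n.
    by rewrite cnorm_distC nm.
  rewrite cnorm_distC -(subnKC mn).
  by apply: le_lt_trans (u_diff _ _) (HN _ Nm).
have l_norm : cnorm l <= rho.
  apply/ler_addgt0Pr => e /ul[N /(_ N (leqnn N)) uNl].
  have := cnorm_le_dist l (u N); rewrite cnorm_distC.
  by have := u_norm N; lra.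
have l_sa : star l = l.
  apply/eqP; rewrite -subr_eq0; apply/eqP; apply: eps_cnorm_eq0 => e e0.
  have [N /(_ N (leqnn N)) uNl] := ul _ (divr_gt0 e0 (ltr0n R 2)).
  have uN_sa : star (u N) = u N.
    elim: N {uNl} => [|N IH]; rewrite /u/= ?star0//.
    by rewrite -/(u N) /step starZ conjC_real starD starM IH h_sa.
  have := cnorm_triangle (u N) (star l) l.
  have -> : cnorm (star l - u N) = cnorm (u N - l).
    by rewrite -{1}uN_sa -starB cnorm_starE cnorm_distC.
  by move: uNl; lra.
have lE : l = step l.
  apply/eqP; rewrite -subr_eq0; apply/eqP; apply: eps_cnorm_eq0 => e e0.
  have [N HN] := ul _ (divr_gt0 e0 (ltr0n R 2)).
  have := cnorm_triangle (u N.+1) l (step l).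
  have : cnorm (u N.+1 - step l) <= rho * cnorm (u N - l) by exact: step_contr.
  have := HN N (leqnn _); have := HN N.+1 (leqnSn _).
  have : rho * cnorm (u N - l) <= cnorm (u N - l).
    by rewrite ler_piMl ?cnorm_ge0// ltW.
  by rewrite (cnorm_distC l (u N.+1)); lra.
exists (1 - l); first by rewrite starB star1 l_sa.
have ll : l + l = h + l * l.
  rewrite {1 2}lE /step -scalerDl -rmorphD /=.
  by have -> : half + half = 1; [rewrite /half; lra|rewrite scale1r].
have -> : h = l + l - l * l by rewrite ll addrK.
by rewrite mulrBl !mulrBr !mul1r mulr1 !opprD !opprK !addrA.
Qed.

End SquareRoot.

(** * States: Cauchy-Schwarz inequality and contractivity *)

Section States.
Variables (R : realType) (A : cstarType R) (phi : A -> R[i]).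
Hypothesis phiP : is_state phi.
Implicit Types a b : A.

Lemma stateD a b : phi (a + b) = phi a + phi b.
Proof. by have := state_linear phiP 1 a b; rewrite scale1r mul1r. Qed.

Lemma state0 : phi 0 = 0.
Proof. by have := stateD 0 0; rewrite addr0 => /eqP; rewrite -subr_eq subrr => /eqP. Qed.

Lemma stateZ (c : R[i]) a : phi (c *: a) = c * phi a.
Proof. by rewrite -[c *: a]addr0 (state_linear phiP) state0 addr0. Qed.

Lemma stateN a : phi (- a) = - phi a.
Proof. by rewrite -scaleN1r stateZ mulN1r. Qed.

Lemma stateB a b : phi (a - b) = phi a - phi b.
Proof. by rewrite stateD stateN. Qed.

Lemma state_form_ge0 (s t : R[i]) a b :
  0 <= s^*%C * s * phi (star a * a) + s^*%C * t * phi (star a * b) +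
       (t^*%C * s * phi (star b * a) + t^*%C * t * phi (star b * b)).
Proof.
have := state_pos phiP (s *: a + t *: b).
by rewrite starD !starZ mulrDr !mulrDl -!scalerAl -!scalerAr !scalerA !stateD
  !stateZ addrACA [X in _ <= _ + X]addrC addrACA [X in _ <= _ + X]addrC.
Qed.

(** Polarization: positivity at [1 + a] and at [1 + 'i *: a] makes [phi a + phi (star a)] and
    ['i * (phi a - phi (star a))] real. *)
Lemma state_star a : phi (star a) = (phi a)^*%C.
Proof.
have := state_form_ge0 1 1 1 a; have := state_form_ge0 1 'i 1 a.
rewrite star1 !mul1r !mulr1 (state_unit phiP).
have := state_pos phiP a.
case: (phi a) => x y; case: (phi (star a)) => x' y'; case: (phi (star a * a)) => p q.
rewrite !lecE /= => /andP[/eqP q0 _] /andP[/eqP h _] /andP[/eqP h' _].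
by congr (_ +i* _); move: q0 h h'; simpc; lra.
Qed.

Definition sqnorm a : R := complex.Re (phi (star a * a)).

Lemma sqnormE a : phi (star a * a) = (sqnorm a)%:C.
Proof. by rewrite /sqnorm RRe_real// ger0_real// state_pos. Qed.

Lemma sqnorm_ge0 a : 0 <= sqnorm a.
Proof. by rewrite -(@lecR R 0) -sqnormE; exact: state_pos. Qed.

Lemma state_CS a b : rnorm (phi (star b * a)) ^+ 2 <= sqnorm a * sqnorm b.
Proof.
have F s t := state_form_ge0 s t a b.
have E : phi (star a * b) = (phi (star b * a))^*%C.
  by rewrite -state_star starM starK.
move: F; rewrite E !sqnormE; have := sqnorm_ge0 a; have := sqnorm_ge0 b.
rewrite /rnorm normc_def /=.
move: (sqnorm a) (sqnorm b) (phi _) => p q [x y] /= q0 p0 F.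
rewrite sqr_sqrtr ?addr_ge0 ?sqr_ge0//.
(* Taking [k] times [phi (star b * a)] as second coefficient gives a real quadratic in [k]. It is
   evaluated at its minimum [- q^-1] or, when [q = 0], at a [k] that would make it negative. *)
have F' k : 0 <= p + k * (x ^+ 2 + y ^+ 2) * 2 + k ^+ 2 * (x ^+ 2 + y ^+ 2) * q.
  have := F 1 (k%:C * (x +i* y)); rewrite lecE /= => /andP[_]; simpc => /=.
  by congr (_ <= _); ring.
have [q_0|q1] := eqVneq q 0.
  have := F' (- (p + 1) / (x ^+ 2 + y ^+ 2)); rewrite q_0 !mulr0 addr0.
  have [->//|xy0] := eqVneq (x ^+ 2 + y ^+ 2) 0.
  by rewrite divfK//; move: p0; lra.
have := F' (- q^-1).
have -> : p + - q^-1 * (x ^+ 2 + y ^+ 2) * 2 + (- q^-1) ^+ 2 * (x ^+ 2 + y ^+ 2) * q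
   = (p * q - (x ^+ 2 + y ^+ 2)) / q by field.
by rewrite pmulr_lge0 ?invr_gt0 ?lt_def ?q1// subr_ge0.
Qed.

(** This is [star a * a <= cnorm a ^+ 2] compressed by [b]: for [c] slightly above [cnorm a ^+ 2],
    the element [1 - h] with [h = star a * a / c] is the square of a self-adjoint element. The slack
    [d] secures [cnorm h < 1]. *)
Lemma sqnorm_mul a b : sqnorm (a * b) <= cnorm a ^+ 2 * sqnorm b.
Proof.
apply/ler_addgt0Pr => e e0.
pose d := e / (sqnorm b + 1).
have b1 : 0 < sqnorm b + 1 by have := sqnorm_ge0 b; lra.
have d0 : 0 < d by rewrite divr_gt0.
pose c := cnorm a ^+ 2 + d.
have c0 : 0 < c by rewrite ltr_wpDl ?sqr_ge0.
pose h : A := (c^-1)%:C *: (star a * a).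
have [||w w_sa wE] := @sqrt_one_sub R A h.
- by rewrite /h starZ conjC_real starM starK.
- rewrite /h cnormZr_ge0 ?invr_ge0 ?ltW// cnorm_star.
  by rewrite ltr_pdivrMl// mulr1 /c ltrDl.
have : 0 <= phi (star (w * b) * (w * b)) by exact: state_pos.
rewrite starM w_sa -mulrA [w * (w * b)]mulrA -wE /h mulrBl mul1r mulrBr stateB.
rewrite -scalerAl -scalerAr stateZ.
have -> : star b * (star a * a * b) = star (a * b) * (a * b).
  by rewrite starM !mulrA.
rewrite !sqnormE -rmorphM -rmorphB /= -[0]/(0%:C) lecR subr_ge0 => H.
have : sqnorm (a * b) <= c * sqnorm b by rewrite -ler_pdivrMl.
have : d * sqnorm b <= e.
  by rewrite /d mulrAC ler_pdivrMr// ler_pM2l//; lra.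
by rewrite /c mulrDl; lra.
Qed.

Lemma sqnorm_le a : sqnorm a <= cnorm a ^+ 2.
Proof.
have := sqnorm_mul a 1.
by rewrite mulr1 /sqnorm star1 mulr1 (state_unit phiP) mulr1.
Qed.

Lemma state_le a : rnorm (phi a) <= cnorm a.
Proof.
rewrite -(@ler_pXn2r _ 2) ?nnegrE ?cnorm_ge0 ?rnorm_ge0//.
have := state_CS a 1; rewrite star1 mul1r => /le_trans; apply.
have -> : sqnorm 1 = 1 by rewrite /sqnorm star1 mulr1 (state_unit phiP).
by rewrite mulr1 sqnorm_le.
Qed.

End States.

(** * Finite-dimensional subalgebras *)

Section Span.
Variables (R : realType) (V : lmodType R[i]).
Implicit Types (s : seq V) (S : set V).

Definition lspan s : set V :=
  [set v | exists c : nat -> R[i], v = \sum_(i < size s) c i *: s`_i].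

Record is_subspace S : Prop := {
  subsp0 : S 0;
  subspD : forall v w, S v -> S w -> S (v + w);
  subspZ : forall (c : R[i]) v, S v -> S (c *: v) }.

Lemma subspB S v w : is_subspace S -> S v -> S w -> S (v - w).
Proof.
by move=> SP Sv Sw; apply: subspD => //; rewrite -scaleN1r; exact: subspZ.
Qed.

Lemma subspI S T : is_subspace S -> is_subspace T -> is_subspace (S `&` T).
Proof.
move=> [S0 SD SZ] [T0 TD TZ]; split => // [v w [? ?] [? ?]|c v [? ?]].
  by split; [exact: SD|exact: TD].
by split; [exact: SZ|exact: TZ].
Qed.

Lemma lspan_nil : lspan [::] = [set 0].
Proof.
apply/seteqP; split=> v /=; first by move=> [c ->]; rewrite big_ord0.
by move=> ->; exists (fun=> 0); rewrite big_ord0.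
Qed.

Lemma lspan_cons x s v :
  lspan (x :: s) v <-> exists c : R[i], exists2 w, lspan s w & v = c *: x + w.
Proof.
split=> [[c ->]|[c [_ [d ->] ->]]].
  rewrite big_ord_recl /=; exists (c 0%N); eexists; last by [].
  by exists (c \o S).
by exists (fun n => if n is m.+1 then d m else c); rewrite big_ord_recl.
Qed.

Lemma lspan_subspace s : is_subspace (lspan s).
Proof.
split=> [|_ _ [c ->] [d ->]|k _ [c ->]].
- by exists (fun=> 0); rewrite big1// => i _; rewrite scale0r.
- exists (fun n => c n + d n); rewrite -big_split /=.
  by apply: eq_bigr => i _; rewrite scalerDl.
- exists (fun n => k * c n); rewrite scaler_sumr.
  by apply: eq_bigr => i _; rewrite scalerA.
Qed.

Lemma lin_dependence s k (f : 'I_k -> V) : (forall i, lspan s (f i)) ->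
  (size s < k)%N -> exists a : 'I_k -> R[i],
    (exists i, a i != 0) /\ \sum_i a i *: f i = 0.
Proof.
move=> /choice[c fE] sk.
pose C : 'M[R[i]]_(k, size s) := \matrix_(i, j) c i j.
have : kermx C != 0.
  rewrite kermx_eq0 -row_leq_rank -ltnNge.
  exact: leq_ltn_trans (rank_leq_col C) sk.
move=> /rowV0Pn[u /sub_kermxP uC /rV0Pn[i ui]].
exists (u 0); split; first by exists i.
transitivity (\sum_(j < size s) (u *m C) 0 j *: s`_j); last first.
  by rewrite uC big1// => j _; rewrite mxE scale0r.
under eq_bigr do rewrite fE scaler_sumr.
rewrite exchange_big /=; apply: eq_bigr => j _; rewrite mxE scaler_suml.
by apply: eq_bigr => l _; rewrite mxE scalerA.
Qed.

End Span.

Lemma complex_net (R : realType) (K e : R) : 0 < e ->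
  exists s : seq R[i], forall c : R[i], rnorm c <= K ->
    exists2 d, d \in s & rnorm (c - d) < e.
Proof.
move=> e0; have e2 := divr_gt0 e0 (ltr0n R 2); have e4 := divr_gt0 e2 (ltr0n R 2).
have [s Hs] : exists s : seq R, forall r, `|r| <= K ->
    exists2 q, q \in s & `|r - q| < e / 2.
  exists [seq - K + i%:R * (e / 2 / 2) | i <- iota 0 (Num.truncn ((K + K) / (e / 2 / 2))).+1].
  move=> r; rewrite ler_norml => /andP[Kr rK].
  pose n := Num.truncn ((r + K) / (e / 2 / 2)).
  exists (- K + n%:R * (e / 2 / 2)).
    apply/mapP; exists n => //; rewrite mem_iota add0n ltnS /=.
    by rewrite /n; apply: le_truncn; rewrite ler_pM2r ?invr_gt0// lerD2r.
  have : 0 <= (r + K) / (e / 2 / 2) by apply: divr_ge0; [lra|exact: ltW].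
  move=> /truncn_itv; rewrite -/n => /andP[].
  rewrite ler_pdivlMr// ltr_pdivrMr// -[n.+1%:R]natr1 mulrDl mul1r => H1 H2.
  by rewrite ltr_norml; apply/andP; split; lra.
exists [seq x +i* y | x <- s, y <- s] => -[x y] cK.
have H : `|x| <= K /\ `|y| <= K.
  move: cK; rewrite /rnorm normc_def /= => cK.
  split; apply: le_trans cK; rewrite -sqrtr_sqr ler_sqrt ?addr_ge0 ?sqr_ge0//.
    by rewrite lerDl sqr_ge0.
  by rewrite lerDr sqr_ge0.
have [/Hs[x' x's xx'] /Hs[y' y's yy']] := H.
exists (x' +i* y'); first by apply: allpairs_f.
rewrite /rnorm normc_def /=.
have -> : e = Num.sqrt (e ^+ 2) by rewrite sqrtr_sqr gtr0_norm.
rewrite ltr_sqrt ?exprn_gt0//.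
have sq z : `|z| < e / 2 -> z ^+ 2 < (e / 2) ^+ 2.
  by move=> z2; rewrite -real_normK ?num_real// ltr_pXn2r// ?nnegrE ?ltW.
have := sq _ xx'; have := sq _ yy'; have := exprn_gt0 2 e0.
have -> : (e / 2) ^+ 2 = e ^+ 2 / 4 by field.
by lra.
Qed.

Section SpanBounded.
Variables (R : realType) (V : normedModType R[i]).

Lemma rnormZ (c : R[i]) (v : V) : rnorm (c *: v) = rnorm c * rnorm v.
Proof.
apply: (@complexI R); rewrite rmorphM /= -(rnormE (c *: v)) -(rnormE v) normrZ.
by rewrite -(rnormE c).
Qed.

(** Induction on the generators, without extracting a basis. If [x] stays at distance [d > 0] from
    [lspan s], its coefficient is at most [M / d] and nets combine; otherwise [x] can be replaced by
    an element of [lspan s] up to any error. *)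
Lemma lspan_tot_bounded (s : seq V) (M : R) :
  tot_bounded [set v | lspan s v /\ rnorm v <= M].
Proof.
elim: s M => [|x s IH] M e e0.
  exists [:: 0] => v []; rewrite lspan_nil => -> _.
  by exists 0; rewrite ?mem_head// subrr rnorm0.
have sP := lspan_subspace s.
have [[d [d0 dH]]|nd] := pselect (exists d, 0 < d /\
    forall v, lspan s v -> d <= rnorm (x - v)).
  have x0 := rnorm_ge0 x.
  have x1 : 0 < rnorm x + 1 by lra.
  have [sc Hc] := @complex_net R (M / d) (e / 2 / (rnorm x + 1))
    (divr_gt0 (divr_gt0 e0 (ltr0n R 2)) x1).
  have [sv Hv] := IH (M + M / d * rnorm x) _ (divr_gt0 e0 (ltr0n R 2)).
  exists [seq c *: x + v | c <- sc, v <- sv] => _ [/lspan_cons[c [v sv_v ->]]] cvM.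
  have cM : rnorm c <= M / d.
    rewrite ler_pdivlMr//; have [->|c0] := eqVneq c 0.
      by rewrite {1}/rnorm normr0 mul0r (le_trans (rnorm_ge0 _) cvM).
    have := dH (- (c^-1 *: v)); rewrite opprK => dv.
    apply: le_trans cvM; rewrite -[v in leRHS](scalerKV c0) -scalerDr rnormZ.
    by rewrite ler_wpM2l ?rnorm_ge0//; apply: dv; rewrite -scaleNr; exact: subspZ.
  have vM : rnorm v <= M + M / d * rnorm x.
    have := rnormD (c *: x + v) (- (c *: x)); rewrite addrAC subrr add0r rnormN rnormZ.
    by move=> /le_trans; apply; rewrite lerD// ler_wpM2r.
  have [c' c's cc'] := Hc _ cM; have [v' v's vv'] := Hv _ (conj sv_v vM).
  exists (c' *: x + v'); first exact: allpairs_f.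
  rewrite opprD addrACA -scalerBl; apply: le_lt_trans (rnormD _ _) _.
  rewrite rnormZ [ltRHS]splitr ler_ltD//.
  apply: le_trans (ler_wpM2r x0 (ltW cc')) _.
  by rewrite mulrAC ler_pdivrMr// ler_pM2l ?divr_gt0//; lra.
have Hx d : 0 < d -> exists2 v, lspan s v & rnorm (x - v) < d.
  move=> d0; apply: contrapT => nv; apply: nd; exists d; split => // v sv.
  by rewrite leNgt; apply/negP => xv; apply: nv; exists v.
(* The bound 1 keeps the replaced vector in the ball of radius [M + 1]; the bound [e / 2] leaves the
   other half to the net. *)
pose m := Num.min 1 (e / 2).
have m0 : 0 < m by rewrite lt_min ltr01 divr_gt0.
have [sv Hv] := IH (M + 1) _ (divr_gt0 e0 (ltr0n R 2)).
exists sv => _ [/lspan_cons[c [v sv_v ->]]] cvM.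
have c0 : 0 <= rnorm c := rnorm_ge0 c.
have c1 : 0 < rnorm c + 1 by lra.
have [y sy xy] := Hx _ (divr_gt0 m0 c1).
have diff : rnorm ((c *: x + v) - (c *: y + v)) < m.
  rewrite opprD addrACA subrr addr0 -scalerBr rnormZ.
  apply: le_lt_trans (_ : rnorm c * (m / (rnorm c + 1)) < m).
    by rewrite ler_wpM2l// ltW.
  by rewrite mulrCA -[ltRHS]mulr1 ltr_pM2l// ltr_pdivrMr// mul1r; lra.
have [|z zs zy] := Hv (c *: y + v).
  split; first by apply: subspD => //; exact: subspZ.
  have := rnormD (c *: x + v) (- (c *: x + v - (c *: y + v))).
  rewrite opprB subrKC (rnorm_distC (c *: y + v)) => /le_trans; apply.
  by rewrite lerD// ltW// (lt_le_trans diff)// ge_min lexx.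
exists z => //; have := rnormD (c *: x + v - (c *: y + v)) (c *: y + v - z).
rewrite subrKA => /le_lt_trans; apply; rewrite [ltRHS]splitr ltrD//.
by rewrite (lt_le_trans diff)// ge_min lexx orbT.
Qed.

End SpanBounded.

(** * Projections and their distance to closed ideals *)

Section Projections.
Variables (R : realType) (A : cstarType R).
Implicit Types p q e : A.

Definition is_proj p : Prop := star p = p /\ p * p = p.

Lemma is_projB p e : is_proj p -> is_proj e -> e * p = e -> is_proj (p - e).
Proof.
move=> [ps pp] [es ee] ep; have pe : p * e = e by rewrite -es -ps -starM ep es.
by split; rewrite ?starB ?ps ?es// mulrBl !mulrBr pp pe ep ee subrr subr0.
Qed.

Lemma is_proj1 : is_proj 1.
Proof. by split; rewrite ?star1 ?mulr1. Qed.

Lemma proj_cnorm_le1 p : is_proj p -> cnorm p <= 1.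
Proof.
move=> [ps pp]; have := cnorm_star p; rewrite ps pp expr2.
have [->|p0] := eqVneq (cnorm p) 0; first by rewrite ler01.
by move=> /esym/(canRL (mulfK p0)); rewrite divff// => ->.
Qed.

Lemma pow_near_ideal (I : set A) a y n : is_closed_ideal I -> I y ->
  exists2 z, I z & cnorm (a ^+ n.+1 - z) <= cnorm (a - y) ^+ n.+1.
Proof.
move=> IP Iy; elim: n => [|n [z Iz az]]; first by exists y; rewrite ?expr1.
(* Chosen so that the new error factors as [(a - y) * (a ^+ n.+1 - z)]: submultiplicativity of the
   quotient norm. *)
exists (y * a ^+ n.+1 + (a - y) * z).
  by apply: (idealD IP); [exact: (Defs.idealMr IP)|exact: (idealMl IP)].
rewrite !(exprS _ n.+1) [in X in X <= _](_ : _ - _ = (a - y) * (a ^+ n.+1 - z)).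
  by rewrite (le_trans (cnormM _ _))// ler_wpM2l// cnorm_ge0.
by rewrite mulrBr [(a - y) * a ^+ _]mulrBl opprD addrA.
Qed.

(* The powers of [p] all equal [p], but their distance to the ideal decays
   geometrically. *)
Lemma proj_near_ideal (I : set A) p y : is_closed_ideal I -> is_proj p ->
  I y -> cnorm (p - y) < 1 -> I p.
Proof.
move=> IP [_ pp] Iy py1; apply: (rnorm_closedP (ideal_closed IP)) => e e0.
have pX n : p ^+ n.+1 = p by elim: n => [|n IH]; rewrite ?expr1// exprS IH.
have [N HN] := expr_lt_eps (cnorm_ge0 _) py1 e0.
have [z Iz pz] := pow_near_ideal p N IP Iy; exists z => //.
by rewrite rnorm_cnorm -(pX N); apply: le_lt_trans pz (HN _ (leqnSn N)).
Qed.

End Projections.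

Section FiniteDimensional.
Variables (R : realType) (A : cstarType R) (tau : A -> R[i]).
Hypothesis tauP : is_faithful_tracial_state tau.

Let tauB a b : tau (a - b) = tau a - tau b.
Proof. exact: (stateB (fts_state tauP)). Qed.

Let tauD a b : tau (a + b) = tau a + tau b.
Proof. exact: (stateD (fts_state tauP)). Qed.

Let tauZ (c : R[i]) a : tau (c *: a) = c * tau a.
Proof. exact: (stateZ (fts_state tauP)). Qed.

(** Gram-Schmidt for the inner product [tau (star y * z)], definite because [tau] is faithful. No
    generators of [V] are given, so the induction passes to the intersection of [V] with [lspan s],
    of codimension at most one in [V]. *)
Lemma orth_projection (s : seq A) (V : set A) (z : A) :
  is_subspace V -> V `<=` lspan s ->
  exists2 e, V e & forall y, V y -> tau (star y * (z - e)) = 0.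
Proof.
elim: s V z => [|x s IH] V z VP Vs.
  exists 0 => [|y /Vs]; first exact: subsp0.
  by rewrite lspan_nil => /= ->; rewrite star0 mul0r (state0 (fts_state tauP)).
have [Vs'|] := pselect (V `<=` lspan s); first exact: IH.
move=> /existsNP[v] /not_implyP[Vv vs].
have sP := lspan_subspace s; have WP := subspI VP sP.
have WI t := IH (V `&` lspan s) t WP (@subIsetr _ _ _).
have [e1 [Ve1 _] e1P] := WI z; have [v1 [Vv1 sv1] v1P] := WI v.
pose r := v - v1; have Vr : V r by exact: subspB.
have r0 : r <> 0 by move=> /eqP; rewrite subr_eq0 => /eqP vv1; apply: vs; rewrite vv1.
pose N := tau (star r * r).
have N0 : N != 0 by apply/eqP => /(fts_faithful tauP).
pose k := tau (star r * (z - e1)) / N.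
exists (e1 + k *: r); first by apply: subspD => //; exact: subspZ.
move=> y Vy.
(* Comparing the coefficients of [x] in [y] and [v] gives the multiple of [r] to subtract so that
   the remainder falls in [lspan s]. *)
have [c [w [Vw sw] ->]] : exists c, exists2 w, (V `&` lspan s) w & y = w + c *: r.
  have /lspan_cons[cy [y0 sy0 yE]] := Vs _ Vy.
  have /lspan_cons[cv [v0 sv0 vE]] := Vs _ Vv.
  have cv0 : cv != 0 by apply/eqP => c0; apply: vs; rewrite vE c0 scale0r add0r.
  exists (cy / cv), (y - (cy / cv) *: r); last by rewrite subrK.
  split; first by apply: subspB => //; exact: subspZ.
  rewrite /r {1}yE vE scalerBr scalerDr scalerA divfK// opprB addrCA.
  rewrite [_ + y0]addrC addrKA.
  by apply: subspD => //; [exact: subspZ|apply: subspB => //; exact: subspZ].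
rewrite starD starZ mulrDl tauD opprD addrA mulrBr tauB e1P// -scalerAr tauZ.
rewrite v1P// mulr0 subr0 add0r -scalerAl tauZ mulrBr tauB -scalerAr tauZ.
by rewrite divfK// subrr mulr0.
Qed.

Variable B : set A.
Hypotheses (BP : is_fd_subalgebra B) (B1 : B 1).

Lemma fds_subspace : is_subspace B.
Proof. by split; [exact: fds0 BP|exact: fdsD BP|exact: fdsZ BP]. Qed.

Lemma fdsB a b : B a -> B b -> B (a - b).
Proof. exact: subspB fds_subspace. Qed.

(* [e] is the [tau]-orthogonal projection of [1] onto [L]. *)
Lemma left_ideal_proj (L : set A) : is_subspace L -> L `<=` B ->
  (forall b x, B b -> L x -> L (b * x)) ->
  exists e, [/\ L e, is_proj e & forall x, L x -> x * e = x].
Proof.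
move=> LP LB BL; have [s Bs] := fds_fin BP.
have [e Le eP] := orth_projection 1 LP (subset_trans LB Bs).
have Be := LB _ Le.
have Lr x : L x -> x * e = x.
  move=> Lx; suff /eqP : x * (1 - e) = 0.
    by rewrite mulrBr mulr1 subr_eq0 => /eqP.
  have Bx := LB _ Lx; have Bsx := fds_star BP Bx.
  apply: (fts_faithful tauP).
  have /eP : L (star x * x - star x * x * e).
    by apply: subspB => //; apply: BL => //; exact: (fdsM BP).
  rewrite -[X in X - _]mulr1 -mulrBr.
  by rewrite !starM starK -!mulrA.
exists e; split => //; split; last exact: Lr.
(* Self-adjointness needs the trace property: it moves [star e] to the front, and [w * e] lies in
   [L], hence is orthogonal to [1 - e]. Once [w = 0], [star e] equals the self-adjoint
   [e * star e]. *)
pose w := (1 - e) * star e.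
have Bw : B w by apply: (fdsM BP); [exact: fdsB|exact: (fds_star BP)].
have w0 : w = 0.
  apply: (fts_faithful tauP); rewrite {2}/w mulrA (fts_trace tauP) mulrA.
  by rewrite -starM eP//; apply: BL.
have : star e = e * star e.
  by apply/eqP; rewrite -subr_eq0; move: w0; rewrite /w mulrBl mul1r => /eqP.
by move=> E; have := congr1 star E; rewrite starM !starK -E.
Qed.

Lemma ideal_subalg_unit (I : set A) : is_closed_ideal I ->
  exists e, [/\ (I `&` B) e, is_proj e &
    forall b, (I `&` B) b -> e * b = b /\ b * e = b].
Proof.
move=> IP; pose L := I `&` B.
have LP : is_subspace L.
  apply: subspI fds_subspace; split; [exact: ideal0 IP|exact: idealD IP|].
  by move=> c v Iv; rewrite -mulr_algl; exact: (idealMl IP).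
have [||e [Le eP eL]] := @left_ideal_proj L LP.
- by move=> x [].
- move=> b x Bb [Ix Bx]; split; first exact: (idealMl IP).
  exact: (fdsM BP).
exists e; split => // x Lx; split; last exact: eL.
have [Ix Bx] := Lx; have [Ie Be] := Le.
(* The right unit [e] is also a left unit for the self-adjoint [y * star y], while [e * y = 0]; so
   [y] vanishes. *)
pose y := x - e * x.
have Ly : L y.
  by apply: subspB => //; split; [exact: (idealMl IP)|exact: (fdsM BP)].
have ey : e * y = 0 by rewrite /y mulrBr mulrA (proj2 eP) subrr.
have : y = 0.
  apply: stars_eq0.
  have : L (y * star y).
    split; first exact: (Defs.idealMr IP _ (proj1 Ly)).
    by apply: (fdsM BP); [exact: (proj2 Ly)|apply: (fds_star BP); exact: (proj2 Ly)].
  move=> /eL/(congr1 (@star R A)); rewrite !starM !starK (proj1 eP).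
  by rewrite [e * _]mulrA ey mul0r.
by move=> /eqP; rewrite subr_eq0 => /eqP.
Qed.

(** Nonzero orthogonal projections are linearly independent. The bound ensures termination in
    [minimal_proj]. *)
Lemma orth_family_size (s l : seq A) : B `<=` lspan s ->
  (forall i, (i < size l)%N -> [/\ B l`_i, is_proj l`_i & l`_i <> 0]) ->
  (forall i j, (i < size l)%N -> (j < size l)%N -> i <> j -> l`_i * l`_j = 0) ->
  (size l <= size s)%N.
Proof.
move=> Bs lP lO; rewrite leqNgt; apply/negP => sl.
have [|a [[i ai]]] := @lin_dependence R A s (size l) (fun i => l`_i) _ sl.
  by move=> i; have [/Bs] := lP _ (ltn_ord i).
have [_ [_ lll] l0] := lP _ (ltn_ord i).
move=> /(congr1 (fun x => x * l`_i)); rewrite mul0r mulr_suml (bigD1 i)//=.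
rewrite big1 ?addr0 => [|j ji]; last first.
  by rewrite -scalerAl lO ?scaler0// => /val_inj/eqP; rewrite (negbTE ji).
rewrite -scalerAl lll => /eqP; rewrite scaler_eq0 (negbTE ai) => /eqP.
exact: l0.
Qed.

(* Some [x - z] with [x] in the corner [q B q] is not left invertible there; the
   left ideal it generates contains a proper nonzero subprojection of [q]. *)
Lemma proj_split q : B q -> is_proj q -> q <> 0 ->
  ~ (forall x, B x -> exists c : R[i], q * x * q = c *: q) ->
  exists e, [/\ B e, is_proj e, e * q = e, e <> 0 & e <> q].
Proof.
move=> Bq [qs qq] q0 /existsNP[x0 /not_implyP[Bx0 x0q]].
pose x := q * x0 * q; have Bx : B x by do 2![apply: (fdsM BP) => //].
have qx : q * x = x by rewrite /x !mulrA qq.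
have xq : x * q = x by rewrite /x -!mulrA qq.
have [s Bs] := fds_fin BP.
have BX n : B (x ^+ n) by elim: n => // n IH; rewrite exprS; exact: (fdsM BP).
(* Dependent powers of [x] give a polynomial annihilating [x] in the corner. If all its linear
   factors were left invertible there, their product could not vanish. *)
have [|a [[i0 ai0] a0]] := @lin_dependence R A s (size s).+1
    (fun i => x ^+ i * q) _ (ltnSn _).
  by move=> i; apply: Bs; apply: (fdsM BP).
pose P : {poly R[i]} := \poly_(i < (size s).+1) a (inord i).
have P0 : P != 0.
  apply/eqP => /polyP/(_ i0); rewrite coef0 coef_poly ltn_ord inord_val.
  by move/eqP; apply/negP.
have Pq : horner_alg x P * q = 0.
  rewrite -[RHS]a0 /P poly_def rmorph_sum mulr_suml; apply: eq_bigr => i _.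
  by rewrite -mul_polyC rmorphM rmorphXn /= horner_algX horner_algC inord_val
    mulr_algl -scalerAl.
have [r rP] := closed_field_poly_normal P.
have rq0 : \prod_(z <- r) (x - z%:A) * q = 0.
  have : lead_coef P *: (\prod_(z <- r) (x - z%:A) * q) = 0.
    rewrite -[RHS]Pq [in RHS]rP -mul_polyC rmorphM rmorph_prod /= horner_algC.
    rewrite mulr_algl -scalerAl; congr (_ *: (_ * _)).
    by apply: eq_bigr => z _; rewrite rmorphB /= horner_algX horner_algC.
  by move=> /eqP; rewrite scaler_eq0 lead_coef_eq0 (negbTE P0) => /eqP.
have [z zP] : exists z : R[i], forall b, B b -> b * ((x - z%:A) * q) <> q.
  apply: contrapT => nz; suff H : forall r, \prod_(z <- r) (x - z%:A) * q <> 0.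
    by have := H r.
  elim=> [|z r' IH]; first by rewrite big_nil mul1r.
  rewrite big_cons -mulrA; set y := _ * q in IH *.
  have qy : q * y = y.
    rewrite /y; elim: (r') => [|z' r'' IH']; first by rewrite big_nil mul1r.
    rewrite big_cons -!mulrA mulrBl mulr_algl mulrBr -scalerAr IH'.
    by rewrite [q * (x * _)]mulrA qx.
  move=> xzy; have /existsNP[b /not_implyP[Bb /contrapT bq]] :
      ~ forall b, B b -> b * ((x - z%:A) * q) <> q.
    by move=> H; apply: nz; exists z.
  by apply: IH; rewrite -qy -bq -!mulrA qy xzy mulr0.
pose k := (x - z%:A) * q.
have kE : k = x - z *: q by rewrite /k mulrBl xq mulr_algl.
have Bk : B k by rewrite kE; apply: fdsB => //; exact: (fdsZ BP).
pose L := [set b * k | b in B].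
have LP : is_subspace L.
  split; first by exists 0; [exact: (fds0 BP)|rewrite mul0r].
    by move=> _ _ [b Bb <-] [c Bc <-]; exists (b + c); [exact: (fdsD BP)|rewrite mulrDl].
  by move=> c _ [b Bb <-]; exists (c *: b); [exact: (fdsZ BP)|rewrite scalerAl].
have [||e [[b Bb be] eP eL]] := left_ideal_proj LP.
- by move=> _ [b Bb <-]; exact: (fdsM BP).
- move=> b _ Bb [c Bc <-]; exists (b * c); last by rewrite mulrA.
  exact: (fdsM BP).
exists e; split => //.
- by rewrite -be; exact: (fdsM BP).
- by rewrite -be /k -!mulrA qq.
- move=> e0; apply: x0q; exists z; apply/eqP; rewrite -subr_eq0 -kE.
  by rewrite -[k]eL ?e0 ?mulr0//; exists 1; rewrite ?mul1r.
- by move=> eq; apply: (zP b Bb); rewrite -/k be.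
Qed.

(** If [p] is not minimal it splits as [e + (p - e)], and one summand is outside [I]. That one is
    kept and the other joins the orthogonal family [l], whose size is bounded by [orth_family_size];
    [n] counts the room left. *)
Lemma minimal_proj (I : set A) p : is_closed_ideal I -> B p -> is_proj p ->
  ~ I p -> exists q, [/\ B q, is_proj q, ~ I q, q * p = q &
    forall x, B x -> exists c : R[i], q * x * q = c *: q].
Proof.
move=> IP; have [s Bs] := fds_fin BP.
suff H n : forall l p, (size s < size l + n)%N ->
    (forall i, (i < size l)%N -> [/\ B l`_i, is_proj l`_i, l`_i <> 0 & l`_i * p = 0]) ->
    (forall i j, (i < size l)%N -> (j < size l)%N -> i <> j -> l`_i * l`_j = 0) ->
    B p -> is_proj p -> ~ I p -> exists q, [/\ B q, is_proj q, ~ I q, q * p = q &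
      forall x, B x -> exists c : R[i], q * x * q = c *: q].
  exact: (H (size s).+1 [::]).
elim: n => [|n IH] l {}p.
  rewrite addn0 ltnNge => /negP sl lP lO; exfalso; apply: sl.
  by apply: (orth_family_size Bs) => // i il; have [] := lP i il.
move=> sl lP lO Bp pP Ip.
have [pmin|pmin] := pselect (forall x, B x -> exists c : R[i], p * x * p = c *: p).
  by exists p; split => //; exact: (proj2 pP).
have [|e [Be eP ep e0 e_p]] := proj_split Bp pP _ pmin.
  by move=> p0; apply: Ip; rewrite p0; exact: ideal0 IP.
have [ps pp] := pP; have [es ee] := eP.
have pe : p * e = e by rewrite -es -ps -starM ep es.
have peP := is_projB pP eP ep.
have pep : (p - e) * p = p - e by rewrite mulrBl pp ep.
have pe0 : p - e <> 0 by move=> /eqP; rewrite subr_eq0 => /eqP /esym.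
have step f g : B f -> is_proj f -> f * p = f -> f <> 0 -> B g -> is_proj g ->
    p * g = g -> g * p = g -> f * g = 0 -> ~ I g ->
    exists q, [/\ B q, is_proj q, ~ I q, q * p = q &
      forall x, B x -> exists c : R[i], q * x * q = c *: q].
  move=> Bf fP fp f0 Bg gP pg gp fg Ig.
  have [fs _] := fP.
  have lf i : (i < size l)%N -> l`_i * f = 0.
    by move=> /lP[_ _ _ lp]; rewrite -fs -fp starM ps mulrA lp mul0r.
  have fl i : (i < size l)%N -> f * l`_i = 0.
    by move=> il; have [_ [ls _] _ _] := lP _ il; rewrite -fs -ls -starM lf// star0.
  have [|||q [Bq qP Iq qg qmin]] := IH (f :: l) g _ _ _ Bg gP Ig.
  - by rewrite /= addSnnS.
  - move=> [|i] /=; first by [].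
    by rewrite ltnS => il; have [? ? ? lp] := lP i il; split=> //; rewrite -pg mulrA lp mul0r.
  - move=> [|i] [|j] //=; rewrite !ltnS => il jl ij; [exact: fl|exact: lf|].
    by apply: lO => // E; apply: ij; rewrite E.
  by exists q; split=> //; rewrite -qg -mulrA gp.
have [Ie|Ie] := pselect (I e).
  apply: (step e (p - e)) => //.
  - exact: fdsB.
  - by rewrite mulrBr pp pe.
  - by rewrite mulrBr ep ee subrr.
  - by move=> Ipe; apply: Ip; rewrite -(subrK e p); exact: (idealD IP).
apply: (step (p - e) e) => //; first exact: fdsB.
by rewrite mulrBl pe ee subrr.
Qed.

End FiniteDimensional.

(** * Conditional expectations and the seminorm *)

Lemma scale_half (R : realType) (V : lmodType R[i]) (a : V) :
  (2^-1 : R[i]) *: (a + a) = a.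
Proof.
by rewrite -[a in X in _ *: X]scale1r -scalerDl scalerA mulVf ?pnatr_eq0// scale1r.
Qed.

Lemma double_inj (R : realType) (V : lmodType R[i]) (a b : V) :
  a + a = b + b -> a = b.
Proof. by move=> /(congr1 (GRing.scale (2^-1 : R[i]))); rewrite !scale_half. Qed.

Section CondExp.
Variables (R : realType) (A : cstarType R) (B : set A) (E : A -> A).
Hypotheses (EP : is_cond_exp B E) (B1 : B 1).
Implicit Types (a b : A) (c : R[i]).

Lemma ceD a b : E (a + b) = E a + E b.
Proof. by have := ce_linear EP 1 a b; rewrite !scale1r. Qed.

Lemma ce0 : E 0 = 0.
Proof. by have := ceD 0 0; rewrite addr0 => /eqP; rewrite -subr_eq subrr => /eqP. Qed.

Lemma ceZ c a : E (c *: a) = c *: E a.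
Proof. by rewrite -[c *: a]addr0 (ce_linear EP) ce0 addr0. Qed.

Lemma ceN a : E (- a) = - E a.
Proof. by rewrite -scaleN1r ceZ scaleN1r. Qed.

Lemma ceB a b : E (a - b) = E a - E b.
Proof. by rewrite ceD ceN. Qed.

Lemma ceMl b a : B b -> E (b * a) = b * E a.
Proof. by move=> Bb; have := ce_bimod EP a Bb B1; rewrite !mulr1. Qed.

Lemma ceMr a b : B b -> E (a * b) = E a * b.
Proof. by move=> Bb; have := ce_bimod EP a B1 Bb; rewrite !mul1r. Qed.

(** Polarization writes [a + a] through elements [star x * x], whose images are self-adjoint by
    [ce_pos]. *)
Lemma ce_sa a : star a = a -> star (E a) = E a.
Proof.
move=> sa_a.
have pos x : star (E (star x * x)) = E (star x * x).
  by have [b ->] := ce_pos EP x; rewrite starM starK.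
have aE : a + a = star (a + 1) * (a + 1) - star a * a - star 1 * 1.
  rewrite starD sa_a star1 mulrDr !mulrDl !mulr1 !mul1r [a * a + a]addrC.
  by rewrite addrACA [a * a + 1]addrC addrA !addrK.
have : star (E (a + a)) = E (a + a) by rewrite aE !ceB !starB !pos.
by rewrite ceD starD => /double_inj.
Qed.

Lemma ce_star a : E (star a) = star (E a).
Proof.
pose h := a + star a; pose k : A := 'i *: (a - star a).
have h_sa : star h = h by rewrite /h starD starK addrC.
have k_sa : star k = k.
  rewrite /k starZ starB starK (_ : Num.conj 'i = - 'i); last exact: conjCi.
  by rewrite scaleNr -scalerN opprB.
have aE : a + a = h - 'i *: k.
  by rewrite /h /k scalerA -expr2 sqrCi scaleN1r opprK addrACA subrr addr0.
have saE : star a + star a = h + 'i *: k.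
  by rewrite /h /k scalerA -expr2 sqrCi scaleN1r opprB [a + _]addrC addrACA subrr addr0.
clearbody h k; have : E (star a + star a) = star (E (a + a)).
  rewrite saE aE ceD ceB !ceZ starB starZ !ce_sa// (_ : Num.conj 'i = - 'i); last exact: conjCi.
  by rewrite scaleNr opprK.
by rewrite !ceD starD => /double_inj.
Qed.

(** The factor 2 of [F_beta] originates here: [E] is a bimodule map over [B] only, so
    [a * (b - E b)] occurs once as it is and once under [E]. *)
Lemma ce_leibniz a b :
  cnorm (a * b - E (a * b)) <=
  2 * cnorm a * cnorm (b - E b) + cnorm (a - E a) * cnorm b.
Proof.
have -> : a * b - E (a * b) =
    a * (b - E b) + (a - E a) * E b - E (a * (b - E b)).
  rewrite [in E (a * (b - _))]mulrBr ceB (ceMr _ (ce_range EP b)) mulrBr mulrBl.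
  by rewrite opprB !subrKA.
apply: le_trans (cnormB _ _) _.
have := ce_contr EP (a * (b - E b)); have := cnormM a (b - E b).
have := cnormD (a * (b - E b)) ((a - E a) * E b); have := cnormM (a - E a) (E b).
have := ler_wpM2l (cnorm_ge0 (a - E a)) (ce_contr EP b).
by move=> *; lra.
Qed.

End CondExp.

Record af_setting (R : realType) (A : cstarType R) (A_ : nat -> set A)
    (tau : A -> R[i]) (E : nat -> A -> A) (beta : nat -> R) : Prop := {
  af_fd : forall n, is_fd_subalgebra (A_ n);
  af_unital : forall n, A_ n 1;
  af_incr : forall n, A_ n `<=` A_ n.+1;
  af_zero : A_ 0%N = [set c *: 1 | c in [set: R[i]]];
  af_dense : closure (\bigcup_n A_ n) = [set: A];
  af_tau : is_faithful_tracial_state tau;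
  af_ce : forall n, is_tau_cond_exp tau (A_ n) (E n);
  af_beta_gt0 : forall n, 0 < beta n;
  af_beta_cvg0 : beta @ \oo --> (0 : R) }.

Section SelfAdjointParts.
Variables (R : realType) (A : cstarType R).
Implicit Types a b : A.

Lemma conjC_half : Num.conj (2^-1 : R[i]) = 2^-1.
Proof. by rewrite fmorphV /= rmorph_nat. Qed.

Lemma conjC_halfi : Num.conj ((2 * 'i)^-1 : R[i]) = - (2 * 'i)^-1.
Proof. by rewrite fmorphV rmorphM /= conjCi rmorph_nat mulrN invrN. Qed.

Lemma sa_re a : sa (re_part a).
Proof. by rewrite /sa /re_part /= starZ conjC_half starD starK addrC. Qed.

Lemma sa_im a : sa (im_part a).
Proof.
by rewrite /sa /im_part /= starZ conjC_halfi starB starK scaleNr -scalerN opprB.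
Qed.

Lemma re_im a : a = re_part a + 'i *: im_part a.
Proof.
rewrite /im_part scalerA invfM mulrCA mulfV ?neq0Ci// mulr1 /re_part -scalerDr.
by rewrite addrACA subrr addr0 scale_half.
Qed.

Lemma sa_jordan a b : sa a -> sa b -> sa (jordan a b).
Proof.
rewrite /sa /jordan /= => sa_a sb.
by rewrite starZ conjC_half starD !starM sa_a sb addrC.
Qed.

Lemma sa_lie a b : sa a -> sa b -> sa (lie a b).
Proof.
rewrite /sa /lie /= => sa_a sb.
by rewrite starZ conjC_halfi starB !starM sa_a sb scaleNr -scalerN opprB.
Qed.

Lemma sa_closed : closed (@sa R A).
Proof.
apply: rnorm_closed => a Ha; apply/eqP; rewrite -subr_eq0; apply/eqP.
apply: eps_cnorm_eq0 => e e0.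
have [b bs ab] := Ha _ (divr_gt0 e0 (ltr0n R 2)).
have := cnorm_triangle b (star a) a; rewrite -{1}bs -starB cnorm_starE.
by move: ab; rewrite rnorm_cnorm (cnorm_distC b); lra.
Qed.

End SelfAdjointParts.

Section LipschitzSeminorm.
Variables (R : realType) (A : cstarType R) (A_ : nat -> set A)
  (tau : A -> R[i]) (E : nat -> A -> A) (beta : nat -> R).
Hypothesis AF : af_setting A_ tau E beta.
Implicit Types a b : A.

Let EP n : is_cond_exp (A_ n) (E n) := tce_ce (af_ce AF n).
Let unitA n : A_ n 1 := af_unital AF n.
Let beta_gt0 n : 0 < beta n := af_beta_gt0 AF n.

Lemma af_le m n : (m <= n)%N -> A_ m `<=` A_ n.
Proof.
elim: n => [|n IH]; first by rewrite leqn0 => /eqP ->.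
rewrite leq_eqVlt => /orP[/eqP -> //|]; rewrite ltnS => /IH mn a /mn.
exact: af_incr AF _ _.
Qed.

Lemma af_approx a (e : R) : 0 < e -> exists n, exists2 b, A_ n b & cnorm (a - b) < e.
Proof.
move=> e0; have : closure (\bigcup_n A_ n) a by rewrite (af_dense AF).
by move=> /rnorm_closure/(_ e e0)[b [n _ Anb] ab]; exists n, b.
Qed.

Lemma af_beta_small (e : R) : 0 < e -> exists N, forall n, (N <= n)%N -> beta n < e.
Proof.
move=> e0; have /cvgrPdist_lt/(_ e e0)[N _ H] := af_beta_cvg0 AF.
by exists N => n /H; rewrite /= sub0r normrN gtr0_norm.
Qed.

Lemma ce_ge m n a : (m <= n)%N -> E n (E m a) = E m a.
Proof.
by move=> mn; apply: (ce_id (EP n)); apply: (af_le mn); exact: (ce_range (EP m)).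
Qed.

(** The difference lies in [A_ m], and preservation of [tau] makes it orthogonal to [A_ m], hence to
    itself. *)
Lemma ce_tower m n a : (m <= n)%N -> E m (E n a) = E m a.
Proof.
move=> mn; apply/eqP; rewrite -subr_eq0; apply/eqP.
apply: (fts_faithful (af_tau AF)); set d := _ - _.
have Ad : A_ m d.
  exact: (fdsB (af_fd AF m)) (ce_range (EP m) _) (ce_range (EP m) _).
have Asd := fds_star (af_fd AF m) Ad.
have tauE k x : tau (E k x) = tau x := tce_tau (af_ce AF k) x.
rewrite {2}/d mulrBr (stateB (fts_state (af_tau AF))).
rewrite -!(ceMl (EP m) (unitA m)) // !tauE.
rewrite -(ceMl (EP n) (unitA n)); last exact: (af_le mn).
by rewrite tauE subrr.
Qed.

Lemma ce_diff_le m n a : (m <= n)%N -> cnorm (E n a - E m a) <= cnorm (a - E m a).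
Proof.
move=> mn; rewrite -{1}(ce_ge a mn) -(ceB (EP n)).
exact: (ce_contr (EP n)).
Qed.

Lemma L_beta_le a (r : R) : (L_beta E beta a <= r%:E)%E <->
  forall n, cnorm (a - E n a) <= r * beta n.
Proof.
split=> [H n|H].
  rewrite -ler_pdivrMr// -lee_fin; apply: le_trans H.
  by apply: ereal_sup_ubound; exists n.
by apply: ge_ereal_sup => _ [n _ <-]; rewrite lee_fin ler_pdivrMr.
Qed.

Lemma L_beta_ge0 a : (0 <= L_beta E beta a)%E.
Proof.
apply: ereal_sup_ge; exists (cnorm (a - E 0%N a) / beta 0%N)%:E; first by exists 0%N.
by rewrite lee_fin divr_ge0 ?cnorm_ge0// ltW.
Qed.

Lemma L_beta_fin a : (L_beta E beta a < +oo)%E ->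
  L_beta E beta a = (fine (L_beta E beta a))%:E /\ 0 <= fine (L_beta E beta a).
Proof.
move=> Lfin; split; last by rewrite fine_ge0// L_beta_ge0.
by rewrite fineK// ge0_fin_numE// L_beta_ge0.
Qed.

Lemma L_beta_fineP a : (L_beta E beta a < +oo)%E ->
  forall n, cnorm (a - E n a) <= fine (L_beta E beta a) * beta n.
Proof.
by move=> /L_beta_fin[Lf _]; apply/L_beta_le; rewrite -Lf.
Qed.

Lemma L_beta_subalg n a : A_ n a -> (L_beta E beta a < +oo)%E.
Proof.
move=> Ana; pose M := \sum_(k < n) cnorm (a - E k a) / beta k.
have f0 k : 0 <= cnorm (a - E k a) / beta k by rewrite divr_ge0 ?cnorm_ge0// ltW.
have M0 : 0 <= M by apply: sumr_ge0.
apply: (@le_lt_trans _ _ M%:E); last by rewrite ltry.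
apply/L_beta_le => k; rewrite -ler_pdivrMr//.
have [kn|nk] := ltnP k n.
  by rewrite /M (bigD1 (Ordinal kn))//= lerDl sumr_ge0.
by rewrite (ce_id (EP k)) ?subrr ?cnorm0 ?mul0r//; exact: (af_le nk).
Qed.

Lemma L_betaZ (c : R[i]) a :
  L_beta E beta (c *: a) = ((rnorm c)%:E * L_beta E beta a)%E.
Proof.
rewrite /L_beta -ereal_supZl ?rnorm_ge0//; last first.
  by apply/set0P; eexists; exists 0%N.
congr ereal_sup; rewrite image_comp; apply: eq_imagel => n _ /=.
by rewrite (ceZ (EP n)) -scalerBr cnormZ -EFinM mulrA.
Qed.

Lemma L_betaD a b : (L_beta E beta (a + b)%R <= L_beta E beta a + L_beta E beta b)%E.
Proof.
apply: ge_ereal_sup => _ [n _ <-].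
apply: (@le_trans _ _ ((cnorm (a - E n a) / beta n)%:E + (cnorm (b - E n b) / beta n)%:E)%E).
  rewrite -EFinD lee_fin -mulrDl ler_pM2r ?invr_gt0//.
  by rewrite (ceD (EP n)) opprD addrACA cnormD.
by apply: leeD; apply: ereal_sup_ubound; exists n.
Qed.

Lemma L_beta_star a : L_beta E beta (star a) = L_beta E beta a.
Proof.
congr ereal_sup; apply: eq_imagel => n _.
by rewrite (ce_star (EP n)) -starB cnorm_starE.
Qed.

Lemma L_betaM a b : (L_beta E beta a < +oo)%E -> (L_beta E beta b < +oo)%E ->
  (L_beta E beta (a * b)%R <=
    (F_beta (cnorm a) (cnorm b) (fine (L_beta E beta a)) (fine (L_beta E beta b)))%:E)%E.
Proof.
move=> La Lb; apply/L_beta_le => n; rewrite /F_beta.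
have := ce_leibniz (EP n) (unitA n) a b.
have := L_beta_fineP La n; have := L_beta_fineP Lb n.
have [_ la0] := L_beta_fin La; have [_ lb0] := L_beta_fin Lb.
move: (fine (L_beta E beta a)) (fine (L_beta E beta b)) la0 lb0 => la lb la0 lb0 Hb Ha.
have := ler_wpM2l (cnorm_ge0 a) Hb; have := ler_wpM2r (cnorm_ge0 b) Ha.
have : 0 <= cnorm b * la * beta n by rewrite !mulr_ge0 ?cnorm_ge0// ltW.
by move=> *; lra.
Qed.

Lemma L_beta_half (c : R[i]) a b : rnorm c = 2^-1 ->
  (L_beta E beta (c *: (a + b))%R <=
    maxe (L_beta E beta a) (L_beta E beta b))%E.
Proof.
move=> c2; rewrite L_betaZ c2.
have : (L_beta E beta (a + b)%R <=
    maxe (L_beta E beta a) (L_beta E beta b) + maxe (L_beta E beta a) (L_beta E beta b))%E.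
  by apply: le_trans (L_betaD a b) _; apply: leeD; rewrite le_max lexx ?orbT.
have := L_beta_ge0 (a + b).
have : (0 <= maxe (L_beta E beta a) (L_beta E beta b))%E by rewrite le_max L_beta_ge0.
case: (maxe _ _) => [m||]//; last by move=> *; rewrite leey.
case: (L_beta _ _ _) => [l||]//; rewrite -EFinD !lee_fin => m0 l0 lm.
by lra.
Qed.

Lemma rnorm_half : rnorm (2^-1 : R[i]) = 2^-1.
Proof.
rewrite (_ : (2^-1 : R[i]) = (2^-1)%:C) ?rnormRC; first by rewrite ger0_norm.
by rewrite fmorphV /= rmorph_nat.
Qed.

Lemma rnorm_halfi : rnorm ((2 * 'i)^-1 : R[i]) = 2^-1.
Proof.
by rewrite /rnorm normfV normrM normCi mulr1 -normfV -[RHS]rnorm_half.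
Qed.

Lemma L_beta_jordan a b : (L_beta E beta a < +oo)%E -> (L_beta E beta b < +oo)%E ->
  (L_beta E beta (jordan a b) <=
    (F_beta (cnorm a) (cnorm b) (fine (L_beta E beta a)) (fine (L_beta E beta b)))%:E)%E.
Proof.
move=> La Lb; apply: le_trans (L_beta_half _ _ rnorm_half) _.
rewrite ge_max L_betaM//=; apply: le_trans (L_betaM Lb La) _.
by rewrite lee_fin /F_beta addrC mulrC [_ * fine _]mulrC; lra.
Qed.

Lemma L_betaN a : L_beta E beta (- a) = L_beta E beta a.
Proof. by rewrite -scaleN1r L_betaZ /rnorm normrN normr1 mul1e. Qed.

Lemma L_beta_lie a b : (L_beta E beta a < +oo)%E -> (L_beta E beta b < +oo)%E ->
  (L_beta E beta (lie a b) <=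
    (F_beta (cnorm a) (cnorm b) (fine (L_beta E beta a)) (fine (L_beta E beta b)))%:E)%E.
Proof.
move=> La Lb; apply: le_trans (L_beta_half _ _ rnorm_halfi) _.
rewrite ge_max L_betaM//= L_betaN; apply: le_trans (L_betaM Lb La) _.
by rewrite lee_fin /F_beta; lra.
Qed.

Lemma L_beta_re a : (L_beta E beta (re_part a) <= L_beta E beta a)%E.
Proof.
by apply: le_trans (L_beta_half _ _ rnorm_half) _; rewrite ge_max L_beta_star lexx.
Qed.

Lemma L_beta_im a : (L_beta E beta (im_part a) <= L_beta E beta a)%E.
Proof.
by apply: le_trans (L_beta_half _ _ rnorm_halfi) _; rewrite ge_max L_betaN L_beta_star lexx.
Qed.

Lemma L_beta_closed : closed [set a | (L_beta E beta a <= 1)%E].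
Proof.
apply: rnorm_closed => a Ha /=; apply/L_beta_le => n; rewrite mul1r.
apply/ler_addgt0Pr => e e0.
have [b /= /L_beta_le/(_ n) Lb ab] := Ha _ (divr_gt0 e0 (ltr0n R 2)).
have -> : a - E n a = (b - E n b) + ((a - b) - E n (a - b)).
  by rewrite (ceB (EP n)) [- (_ - _)]opprB addrACA subrKC addKr.
apply: le_trans (cnormD _ _) _; have := cnormB (a - b) (E n (a - b)).
have := ce_contr (EP n) (a - b); move: ab; rewrite rnorm_cnorm; lra.
Qed.

Lemma L_beta_dense : @sa R A `<=` closure (dom (L_beta E beta)).
Proof.
move=> a sa_a; apply/rnorm_closure => e e0.
have [n [b Ab ab]] := af_approx a e0.
exists (re_part b).
  split; [exact: sa_re|exact: le_lt_trans (L_beta_re b) (L_beta_subalg Ab)].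
have aE : a = re_part a.
  by rewrite /re_part sa_a scale_half.
rewrite rnorm_cnorm {1}aE /re_part -scalerBr opprD addrACA -starB cnormZ rnorm_half.
apply: le_lt_trans ab; have := cnormD (a - b) (star (a - b)).
by rewrite cnorm_starE; lra.
Qed.

Lemma L_beta_ker : [set a | dom (L_beta E beta) a /\ L_beta E beta a = 0%E] =
  [set r%:C *: 1 | r in [set: R]].
Proof.
apply/seteqP; split=> [a [[sa_a _] L0]|_ [r _ <-]] /=.
  have : cnorm (a - E 0%N a) <= 0.
    have /L_beta_le/(_ 0%N) : (L_beta E beta a <= 0%:E)%E by rewrite L0.
    by rewrite mul0r.
  move=> a0; have /eqP : a - E 0%N a = 0.
    by apply: cnorm0_eq0; apply/eqP; rewrite eq_le a0 cnorm_ge0.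
  rewrite subr_eq0 => /eqP aE; have := ce_range (EP 0%N) a.
  rewrite -aE (af_zero AF) => -[c _ cE]; exists (complex.Re c) => //.
  move: sa_a; rewrite -cE /sa /= starZ star1 => /eqP.
  rewrite -subr_eq0 -scalerBl scaler_eq0 oner_eq0 orbF subr_eq0 => /eqP cc.
  by rewrite RRe_real//; apply/CrealP.
have A0r : A_ 0%N (r%:C *: 1) by apply: (fdsZ (af_fd AF 0%N)).
have L0 : (L_beta E beta (r%:C *: 1) <= 0%:E)%E.
  apply/L_beta_le => n; rewrite mul0r (ce_id (EP n)) ?subrr ?cnorm0//.
  exact: (af_le (leq0n n)).
have L0' : L_beta E beta (r%:C *: 1) = 0%E.
  by apply/eqP; rewrite eq_le L0 L_beta_ge0.
split => //; split; last by rewrite L0'.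
by rewrite /sa /= starZ star1 conjC_real.
Qed.

End LipschitzSeminorm.

(** * The quantum compact metric space of [L_beta] *)

Section QuantumCompactMetricSpace.
Variables (R : realType) (A : cstarType R) (A_ : nat -> set A)
  (tau : A -> R[i]) (E : nat -> A -> A) (beta : nat -> R).
Hypothesis AF : af_setting A_ tau E beta.
Implicit Types a b : A.

Let EP n : is_cond_exp (A_ n) (E n) := tce_ce (af_ce AF n).
Let beta_gt0 n : 0 < beta n := af_beta_gt0 AF n.
Local Notation L := (L_beta E beta).

(** A single finite-dimensional level approximates all of [S]. The criterion serves Lipschitz balls,
    module unit balls and sets of ideal units alike. *)
Lemma af_tot_bounded (S : set A) (M : R) :
  (forall e : R, 0 < e -> exists N, forall v, S v ->
     exists w, [/\ A_ N w, cnorm w <= M & cnorm (v - w) < e]) ->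
  tot_bounded S.
Proof.
move=> HS e e0; have e2 := divr_gt0 e0 (ltr0n R 2).
have [N HN] := HS _ e2; have [s As] := fds_fin (af_fd AF N).
have [t Ht] := @lspan_tot_bounded R A s M _ e2.
exists t => v /HN[w [Aw wM vw]].
have [|x xt wx] := Ht w; first by split => //; exact: As.
exists x => //; have := rnormD (v - w) (w - x); rewrite subrKA.
by move=> /le_lt_trans; apply; rewrite [ltRHS]splitr ltrD.
Qed.

Lemma state_ce0 (phi psi : A -> R[i]) a : is_state phi -> is_state psi ->
  phi (E 0%N a) = psi (E 0%N a).
Proof.
move=> phiP psiP; have := ce_range (EP 0%N) a; rewrite (af_zero AF) => -[c _ <-].
by rewrite (stateZ phiP) (stateZ psiP) (state_unit phiP) (state_unit psiP).
Qed.

Lemma state_dist_le (phi psi : A -> R[i]) a : is_state phi -> is_state psi ->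
  rnorm (phi a - psi a) <= 2 * cnorm a.
Proof.
move=> phiP psiP; apply: le_trans (rnormD _ _) _; rewrite rnormN.
by have := state_le phiP a; have := state_le psiP a; lra.
Qed.

Lemma state_dist_ce0 (phi psi : A -> R[i]) a : is_state phi -> is_state psi ->
  phi a - psi a = phi (a - E 0%N a) - psi (a - E 0%N a).
Proof.
move=> phiP psiP; rewrite (stateB phiP) (stateB psiP) (state_ce0 a phiP psiP).
by ring.
Qed.

Lemma mk_fin (phi psi : A -> R[i]) : is_state phi -> is_state psi ->
  (mk L phi psi < +oo)%E.
Proof.
move=> phiP psiP; apply: (@le_lt_trans _ _ (2 * beta 0%N)%:E); last exact: ltry.
apply: ge_ereal_sup => _ [a [_ /(L_beta_le AF)/(_ 0%N) La] <-]; rewrite lee_fin.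
rewrite (state_dist_ce0 _ phiP psiP); apply: le_trans (state_dist_le _ phiP psiP) _.
by rewrite ler_pM2l//; move: La; rewrite mul1r.
Qed.

(** The Lipschitz ball contains all real scalars; subtracting [E 0%N a] makes it bounded, and
    differences of states do not see the change. *)
Lemma lip_ball_tot_bounded :
  tot_bounded [set a - E 0%N a | a in lip_ball L].
Proof.
apply: (@af_tot_bounded _ (beta 0%N)) => e e0.
have [N HN] := af_beta_small AF e0; exists N => _ [a [_ /(L_beta_le AF) La] <-].
have := La 0%N; have := La N; rewrite !mul1r => LN L0.
exists (E N (a - E 0%N a)); split; first exact: ce_range (EP N) _.
  exact: le_trans (ce_contr (EP N) _) L0.
rewrite (ceB (EP N)) (ce_ge AF a (leq0n N)) opprB addrA subrK.
exact: le_lt_trans LN (HN _ (leqnn N)).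
Qed.

(** Closeness on a finite net of the reduced Lipschitz ball, a weak* condition, controls the whole
    supremum. *)
Lemma mk_lt_nbhs (phi : {ptws A -> R[i]^o}) (e : R) : is_state phi -> 0 < e ->
  nbhs phi [set psi : {ptws A -> R[i]^o} | is_state psi -> (mk L phi psi < e%:E)%E].
Proof.
move=> phiP e0; have e8 : 0 < e / 8 by rewrite divr_gt0.
have [s Hs] := lip_ball_tot_bounded e8.
have : nbhs phi [set psi : {ptws A -> R[i]^o} |
    forall x, x \in s -> rnorm (phi x - psi x : R[i]) < e / 8].
  elim: s {Hs} => [|x s IH]; first by apply: filterS filterT.
  have : nbhs phi [set psi : {ptws A -> R[i]^o} | rnorm (phi x - psi x : R[i]) < e / 8].
    have : nbhs (phi x : R[i]^o) [set c : R[i]^o | rnorm (phi x - c : R[i]) < e / 8].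
      by apply/rnorm_nbhs; exists (e / 8).
    exact: (@proj_continuous A (fun=> R[i]^o) x phi).
  move=> H; apply: filterS (filterI H IH) => psi [Hx Hs] y.
  by rewrite inE => /orP[/eqP -> //|]; exact: Hs.
apply: filterS => psi Hpsi psiP.
(* The net contributes [e / 8] and the two states twice [e / 8]. Room below [e] is required because
   [mk] is a supremum. *)
apply: (@le_lt_trans _ _ (e / 2)%:E); last by rewrite lte_fin; lra.
apply: ge_ereal_sup => _ [a La <-]; rewrite lee_fin.
have [|x xs ax] := Hs (a - E 0%N a); first by exists a.
rewrite (state_dist_ce0 _ phiP psiP).
have -> : phi (a - E 0%N a) - psi (a - E 0%N a) =
    (phi x - psi x) + (phi (a - E 0%N a - x) - psi (a - E 0%N a - x)).
  by rewrite (stateB phiP _ x) (stateB psiP _ x); ring.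
apply: le_trans (rnormD _ _) _.
have := Hpsi x xs; have := state_dist_le (a - E 0%N a - x) phiP psiP.
by move: ax; rewrite rnorm_cnorm; lra.
Qed.

(** States close in [mk] are close on every Lipschitz element; density and contractivity extend this
    to self-adjoint elements, and real and imaginary parts to all of [A]. *)
Lemma mk_ball_cvg (phi : {ptws A -> R[i]^o}) : is_state phi ->
  filter_from [set e : R | 0 < e]
    (fun e => [set psi : {ptws A -> R[i]^o} | is_state psi /\ (mk L phi psi < e%:E)%E])
  --> phi.
Proof.
move=> phiP; set F := filter_from _ _.
have FF : Filter F.
  apply: filter_from_filter; first by exists 1 => /=.
  move=> e1 e2 /= e10 e20; exists (Num.min e1 e2); first by rewrite /= lt_min e10.
  move=> psi [psiP]; rewrite EFin_min lt_min => /andP[h1 h2].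
  by split; split.
have saF a (e : R) : sa a -> 0 < e ->
    F [set psi | is_state psi /\ rnorm (phi a - psi a : R[i]) < e].
  move=> sa_a e0; have e4 : 0 < e / 4 by rewrite divr_gt0.
  have /rnorm_closure/(_ _ e4)[b [sb Lb] ab] := L_beta_dense AF sa_a.
  have [_ l0] := L_beta_fin AF Lb; have HL := L_beta_fineP AF Lb.
  set l := fine _ in l0 HL; have l1 : 0 < l + 1 by lra.
  have i0 : 0 <= (l + 1)^-1 by rewrite invr_ge0 ltW.
  (* Dividing by [l + 1] instead of [l] brings [b] into the Lipschitz ball even when its seminorm is
     0. *)
  exists (e / 4 / (l + 1)); first by rewrite /= divr_gt0.
  move=> psi [psiP mk_lt]; split => //.
  have bB : rnorm (phi b - psi b : R[i]) <= (l + 1) * (e / 4 / (l + 1)).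
    rewrite -ler_pdivrMl//.
    have : ((rnorm (phi (((l + 1)^-1)%:C *: b) - psi (((l + 1)^-1)%:C *: b)))%:E <= mk L phi psi)%E.
      apply: ereal_sup_ubound; exists (((l + 1)^-1)%:C *: b) => //; split.
        by rewrite /sa /= starZ conjC_real sb.
      apply/(L_beta_le AF) => n; rewrite (ceZ (EP n)) -scalerBr cnormZr_ge0//.
      rewrite ler_pdivrMl// mul1r (le_trans (HL n))// ler_pM2r//; lra.
    move=> /le_lt_trans/(_ mk_lt); rewrite lte_fin => /ltW.
    by rewrite (stateZ phiP) (stateZ psiP) -mulrBr rnormM rnormRC ger0_norm.
  have -> : phi a - psi a = (phi b - psi b) + (phi (a - b) - psi (a - b)) :> R[i].
    by rewrite (stateB phiP a b) (stateB psiP a b); ring.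
  apply: le_lt_trans (rnormD _ _) _.
  have := state_dist_le (a - b) phiP psiP; move: bB ab; rewrite rnorm_cnorm.
  by rewrite mulrC divfK ?gt_eqF//; lra.
apply/pointwise_cvgP => a U /rnorm_nbhs[e e0 eU].
have e2 := divr_gt0 e0 (ltr0n R 2).
have [re_sa im_sa] := (sa_re a, sa_im a).
apply: filterS (filterI (saF _ _ re_sa e2) (saF _ _ im_sa e2)) => psi /= [[psiP re_lt] [_ im_lt]].
apply: eU; rewrite (re_im a); move: (re_part a) (im_part a) re_lt im_lt => b c re_lt im_lt.
rewrite (stateD phiP) (stateD psiP) (stateZ phiP) (stateZ psiP).
rewrite opprD addrACA -mulrBr; apply: le_lt_trans (rnormD _ _) _.
rewrite rnormM [X in _ + X * _](_ : _ = 1) ?mul1r; first by rewrite [ltRHS]splitr ltrD.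
by rewrite /rnorm (_ : `|_| = 1)//; exact: normCi.
Qed.

Lemma L_beta_metrizes : metrizes_weak_star L.
Proof.
split; first exact: mk_fin.
move=> phi phiP; apply/seteqP; split=> P.
- move=> HP; have [e e0 eP] := mk_ball_cvg phiP HP.
  by exists e => // psi Hpsi; apply: eP => //; case: Hpsi.
- move=> [e /= e0 eP]; apply: filterS (mk_lt_nbhs phiP e0) => psi Hpsi psiP.
  by apply: eP; split => //; exact: Hpsi.
Qed.

Lemma L_beta_qcms : is_qcms L (@F_beta R).
Proof.
split.
- by move=> a _; exact: L_beta_ge0 AF a.
- by move=> r a _; rewrite (L_betaZ AF) rnormRC.
- by move=> a b _ _; exact: L_betaD AF a b.
- exact: L_beta_dense AF.
- move=> a b [sa_a La] [sb Lb]; split; first exact: sa_jordan.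
  by apply: le_lt_trans (L_beta_jordan AF La Lb) _; rewrite ltry.
- move=> a b [sa_a La] [sb Lb]; split; first exact: sa_lie.
  by apply: le_lt_trans (L_beta_lie AF La Lb) _; rewrite ltry.
- exact: L_beta_ker AF.
- exact: L_beta_metrizes.
- exact: closedI (@sa_closed R A) (L_beta_closed AF).
- move=> a b [_ La] [_ Lb]; rewrite ge_max (L_beta_jordan AF La Lb) /=.
  exact: (L_beta_lie AF La Lb).
Qed.

End QuantumCompactMetricSpace.

(** * Bundles of ideals *)

Section IdealUnits.
Variables (R : realType) (A : cstarType R) (A_ : nat -> set A)
  (tau : A -> R[i]) (E : nat -> A -> A) (beta : nat -> R).
Hypothesis AF : af_setting A_ tau E beta.
Implicit Types (a b w : A) (I : ideals A).

(** A unit exists, so the default of [xget] plays no part, and two units of one algebra coincide, so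
    the chosen one inherits being a projection. *)
Lemma ideal_unitP I n :
  [/\ (I `&` A_ n) (ideal_unit A_ I n), is_proj (ideal_unit A_ I n) &
    forall b, (I `&` A_ n) b ->
      ideal_unit A_ I n * b = b /\ b * ideal_unit A_ I n = b].
Proof.
have [e [Ie eP eU]] := ideal_subalg_unit (af_tau AF) (af_fd AF n) (af_unital AF n) (idealP I).
have : [set f | (I `&` A_ n) f /\ forall b, (I `&` A_ n) b -> f * b = b /\ b * f = b] e by [].
move=> /(@xgetI _ 0); rewrite -/(ideal_unit A_ I n) => -[Iu uU].
have ue : ideal_unit A_ I n = e by rewrite -(proj1 (eU _ Iu)) (proj2 (uU _ Ie)).
by rewrite ue.
Qed.

Lemma ideal_unit_cap I n : (I `&` A_ n) (ideal_unit A_ I n).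
Proof. by case: (ideal_unitP I n). Qed.

Lemma ideal_unit_mem I n : ideal_set I (ideal_unit A_ I n).
Proof. by case: (ideal_unit_cap I n). Qed.

Lemma ideal_unit_sub I n : A_ n (ideal_unit A_ I n).
Proof. by case: (ideal_unit_cap I n). Qed.

Lemma ideal_unit_proj I n : is_proj (ideal_unit A_ I n).
Proof. by case: (ideal_unitP I n). Qed.

Lemma mulr_ideal_unit I n b : ideal_set I b -> A_ n b -> b * ideal_unit A_ I n = b.
Proof. by case: (ideal_unitP I n) => _ _ H Ib Ab; case: (H b). Qed.

Lemma ideal_unit_mulr I n b : ideal_set I b -> A_ n b -> ideal_unit A_ I n * b = b.
Proof. by case: (ideal_unitP I n) => _ _ H Ib Ab; case: (H b). Qed.

Lemma af_ball_compact n : compact [set a | A_ n a /\ cnorm a <= 1].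
Proof.
apply: tot_bounded_compact.
- exact: cstar_complete.
- apply: rnorm_closed => a Ha; split.
    rewrite (_ : a = E n a); first exact: ce_range (tce_ce (af_ce AF n)) _.
    apply/eqP; rewrite -subr_eq0; apply/eqP; apply: eps_cnorm_eq0 => e e0.
    have EP := tce_ce (af_ce AF n).
    have [b [Ab _] ab] := Ha _ (divr_gt0 e0 (ltr0n R 2)).
    have -> : a - E n a = (a - b) - E n (a - b).
      by rewrite (ceB EP) (ce_id EP Ab) opprB addrA subrK.
    have := cnormB (a - b) (E n (a - b)); have := ce_contr EP (a - b).
    by move: ab; rewrite rnorm_cnorm; lra.
  apply/ler_addgt0Pr => e e0; have [b [_ b1] ab] := Ha _ e0.
  by have := cnorm_le_dist a b; move: ab b1; rewrite rnorm_cnorm; lra.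
- apply: (@af_tot_bounded _ _ _ _ _ _ AF _ 1) => e e0; exists n => v [Av v1].
  by exists v; split; rewrite ?subrr ?cnorm0.
Qed.

(* Otherwise [d = b'^* b' / |b'|^2], with [b' = b (1 - u)], has distance [< 1] to
   [I], so its powers [d^(2^k)], of norm 1, tend to [I]; a cluster point of them
   is a nonzero element of [I `&` A_ n] annihilated by the unit [u]. *)
Lemma dist_ideal_unit I n b w : A_ n b -> ideal_set I w ->
  cnorm (b - b * ideal_unit A_ I n) <= cnorm (b - w).
Proof.
move=> Ab Iw; rewrite leNgt; apply/negP => bw.
set u := ideal_unit A_ I n in bw *.
have [us uu] := ideal_unit_proj I n; have Au : A_ n u := ideal_unit_sub I n.
have IP := idealP I; have BP := af_fd AF n.
have uc : is_proj (1 - u) by apply: is_projB => //; [exact: is_proj1|rewrite mulr1].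
pose b' := b - b * u; have b'E : b' = b * (1 - u) by rewrite mulrBr mulr1.
have b'u : b' * u = 0 by rewrite /b' mulrBl -mulrA uu subrr.
have Ab' : A_ n b' by apply: (fdsB BP) => //; exact: (fdsM BP).
have b'0 : 0 < cnorm b' by apply: le_lt_trans bw; exact: cnorm_ge0.
pose k := (cnorm b' ^+ 2)^-1; have k0 : 0 < k by rewrite invr_gt0 exprn_gt0.
pose d := k%:C *: (star b' * b').
have d_sa : star d = d by rewrite /d starZ conjC_real starM starK.
have d1 : cnorm d = 1.
  by rewrite cnormZr_ge0 ?(ltW k0)// cnorm_star mulVf// expf_neq0// gt_eqF.
have Ad : A_ n d by apply: (fdsZ BP); apply: (fdsM BP) => //; exact: (fds_star BP).
have du : d * u = 0 by rewrite -scalerAl -mulrA b'u mulr0 scaler0.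
(* Then [d - y] is [k] times [star b' * (b - w) * (1 - u)], of norm at most
   [cnorm (b - w) / cnorm b'], which is below 1. *)
pose y := k%:C *: (star b' * (w * (1 - u))).
have Iy : ideal_set I y.
  rewrite /y -mulr_algl; do 2!apply: (idealMl IP); exact: (Defs.idealMr IP).
have dy : cnorm (d - y) < 1.
  rewrite /d /y -scalerBr -mulrBr cnormZr_ge0 ?(ltW k0)// {2}b'E -mulrBl.
  apply: (@le_lt_trans _ _ (k * (cnorm b' * cnorm (b - w)))).
    rewrite ler_wpM2l ?(ltW k0)//; apply: le_trans (cnormM _ _) _.
    rewrite cnorm_starE ler_wpM2l ?(ltW b'0)//; apply: le_trans (cnormM _ _) _.
    by rewrite -[leRHS]mulr1 ler_wpM2l ?cnorm_ge0// proj_cnorm_le1.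
  by rewrite /k ltr_pdivrMl ?exprn_gt0// mulr1 expr2 ltr_pM2l.
pose x j := d ^+ (2 ^ j).
(* A successor exponent is what [pow_near_ideal] handles; the bound [j <= m] sends it to infinity
   with [j]. *)
have xS j : exists m, (2 ^ j = m.+1)%N /\ (j <= m)%N.
  by exists (2 ^ j).-1; have := ltn_expl j (ltnSn 1); case: (2 ^ j)%N.
have x1 j : cnorm (x j) = 1 by rewrite /x cnorm_saX// d1 expr1n.
have Ax j : A_ n (x j).
  rewrite /x; elim: (2 ^ j)%N => [|m IH]; first by rewrite expr0; exact: af_unital AF n.
  by rewrite exprS; exact: (fdsM BP).
have xu j : x j * u = 0.
  by rewrite /x; have [m [-> _]] := xS j; rewrite exprSr -mulrA du mulr0.
have [|q [[Aq _] xq]] := @af_ball_compact n (x @ \oo).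
  by exists 0%N => // j _ /=; rewrite x1.
have {}xq (e : R) N : 0 < e -> exists2 j, (N <= j)%N & cnorm (q - x j) < e.
  move=> e0; have [||v [[j Nj <-] qx]] :=
      xq (x @` [set j | (N <= j)%N]) [set v | rnorm (q - v) < e].
  - by exists N => // j Nj; exists j.
  - by apply/rnorm_nbhs; exists e.
  - by exists j.
have Iq : ideal_set I q.
  apply: (rnorm_closedP (ideal_closed IP)) => e e0.
  have e2 := divr_gt0 e0 (ltr0n R 2).
  have [N HN] := expr_lt_eps (cnorm_ge0 _) dy e2.
  have [j Nj qx] := xq _ N e2; have [m [mE jm]] := xS j.
  have [z Iz xz] := pow_near_ideal d m IP Iy; exists z => //.
  rewrite rnorm_cnorm; have := cnorm_triangle (x j) q z.
  move=> /le_lt_trans; apply; rewrite [ltRHS]splitr ltrD// /x mE.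
  by apply: le_lt_trans xz (HN _ _); rewrite (leq_trans Nj)// (leq_trans jm).
have : q = 0.
  rewrite -(mulr_ideal_unit Iq Aq) -/u; apply: eps_cnorm_eq0 => e e0.
  have [j _ qx] := xq _ 0%N e0.
  rewrite -[q * u](subr0 _) -(xu j) -mulrBl (le_trans (cnormM _ _))//.
  rewrite -[leRHS]mulr1 ler_pM ?cnorm_ge0// ?(ltW qx)// proj_cnorm_le1//.
move=> q0; have [j _] := xq _ 0%N (ltr01 : 0 < 1 :> R).
by rewrite q0 sub0r cnormN x1 ltxx.
Qed.

(** Closed ideals of an AF algebra are recovered from their finite-dimensional parts: if [b] in
    [A_ n] is near [w], cutting [b] by the unit moves it no further than its distance to [w]. *)
Lemma ideal_approx I w (e : R) : ideal_set I w -> 0 < e ->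
  exists n, exists2 b, (I `&` A_ n) b & cnorm (w - b) < e.
Proof.
move=> Iw e0; have [n [b Ab wb]] := af_approx AF w (divr_gt0 e0 (ltr0n R 2)).
exists n, (b * ideal_unit A_ I n).
  split; first exact: idealMl (idealP I) _ _ (ideal_unit_mem I n).
  by apply: (fdsM (af_fd AF n) Ab); exact: ideal_unit_sub.
have := dist_ideal_unit Ab Iw; have := cnorm_triangle b w (b * ideal_unit A_ I n).
by rewrite (cnorm_distC b w); lra.
Qed.

End IdealUnits.

Section IdealBundles.
Variables (R : realType) (A : cstarType R) (A_ : nat -> set A)
  (tau : A -> R[i]) (E : nat -> A -> A) (beta : nat -> R).
Hypothesis AF : af_setting A_ tau E beta.
Variable I : ideals A.

Let EP n : is_cond_exp (A_ n) (E n) := tce_ce (af_ce AF n).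
Let beta_gt0 n : 0 < beta n := af_beta_gt0 AF n.
Let u n := ideal_unit A_ I n.
Local Notation D := (@D_beta R A A_ E beta I).
Implicit Types w v : ideal_mod I.

Lemma ideal_modP w : ideal_set I (val w).
Proof. by have := valP w; rewrite inE. Qed.

Lemma D_beta_le w (r : R) : (D w <= r%:E)%E <->
  [/\ forall n, cnorm (val w - E n (val w)) <= r * beta n, cnorm (val w) <= r &
    forall n, cnorm (val w - val w * u n) <= r * beta n].
Proof.
rewrite /D_beta !ge_max lee_fin; split.
  move=> /and3P[/(L_beta_le AF) h1 h2 h3]; split => // n.
  rewrite -ler_pdivrMr// -lee_fin; apply: le_trans h3.
  by apply: ereal_sup_ubound; exists n.
move=> [/(L_beta_le AF) h1 h2 h3]; apply/and3P; split => //.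
by apply: ge_ereal_sup => _ [n _ <-]; rewrite lee_fin ler_pdivrMr.
Qed.

Lemma D_beta_ge w : ((rnorm w)%:E <= D w)%E.
Proof. by rewrite /D_beta !le_max lexx orbT. Qed.

Lemma D_beta_fin w : (D w < +oo)%E -> D w = (fine (D w))%:E /\ 0 <= fine (D w).
Proof.
move=> Dfin; have D0 : (0 <= D w)%E.
  by apply: le_trans (D_beta_ge w); rewrite lee_fin rnorm_ge0.
by split; [rewrite fineK// ge0_fin_numE|rewrite fine_ge0].
Qed.

Lemma D_beta_fineP w : (D w < +oo)%E ->
  [/\ forall n, cnorm (val w - E n (val w)) <= fine (D w) * beta n,
    cnorm (val w) <= fine (D w) &
    forall n, cnorm (val w - val w * u n) <= fine (D w) * beta n].
Proof. by move=> /D_beta_fin[Df _]; apply/D_beta_le; rewrite -Df. Qed.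

Lemma D_betaZ (c : R[i]) w : D (c *: w) = ((rnorm c)%:E * D w)%E.
Proof.
rewrite /D_beta !maxe_pMr ?lee_fin ?rnorm_ge0//.
have -> : val (c *: w) = c *: val w by [].
rewrite (L_betaZ AF) cnormZ -EFinM; do 2!congr maxe.
rewrite -ereal_supZl ?rnorm_ge0//; last by apply/set0P; eexists; exists 0%N.
congr ereal_sup; rewrite image_comp; apply: eq_imagel => n _ /=.
by rewrite -scalerAl -scalerBr cnormZ -EFinM mulrA.
Qed.

Lemma D_betaD w v : (D (w + v)%R <= D w + D v)%E.
Proof.
have vE : val (w + v) = val w + val v by [].
have le1 : (D w + D v >= L_beta E beta (val w) + L_beta E beta (val v))%E.
  by apply: leeD; rewrite le_max lexx.
have le2 : (D w + D v >= (cnorm (val w))%:E + (cnorm (val v))%:E)%E.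
  by apply: leeD; rewrite !le_max lexx orbT.
have le3 n : (D w + D v >= (cnorm (val w - val w * u n) / beta n)%:E +
    (cnorm (val v - val v * u n) / beta n)%:E)%E.
  by apply: leeD; rewrite !le_max; apply/orP; right; apply/orP; right;
    apply: ereal_sup_ubound; exists n.
rewrite {1}/D_beta vE !ge_max; apply/and3P; split.
- by apply: le_trans le1; exact: L_betaD AF _ _.
- by apply: le_trans le2; rewrite -EFinD lee_fin cnormD.
- apply: ge_ereal_sup => _ [n _ <-]; apply: le_trans (le3 n).
  rewrite -EFinD lee_fin -mulrDl ler_pM2r ?invr_gt0//.
  by rewrite mulrDl opprD addrACA cnormD.
Qed.

Lemma D_beta_subalg n w : A_ n (val w) -> (D w < +oo)%E.
Proof.
move=> Aw; have := L_beta_subalg AF Aw => /(L_beta_fin AF) [Lf L0].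
pose M := \sum_(k < n) cnorm (val w - val w * u k) / beta k.
have f0 k : 0 <= cnorm (val w - val w * u k) / beta k by rewrite divr_ge0 ?cnorm_ge0// ltW.
have M0 : 0 <= M by apply: sumr_ge0.
rewrite /D_beta !gt_max Lf !ltry /=.
apply: (@le_lt_trans _ _ M%:E); last by rewrite ltry.
apply: ge_ereal_sup => _ [k _ <-]; rewrite lee_fin.
have [kn|nk] := ltnP k n.
  by rewrite /M (bigD1 (Ordinal kn))//= lerDl sumr_ge0.
rewrite /u (mulr_ideal_unit AF (ideal_modP w)) ?subrr ?cnorm0 ?mul0r//.
exact: (af_le AF nk).
Qed.

Lemma ideal_mod_mem a : ideal_set I a -> exists w, val w = a.
Proof.
move=> Ia; have Ha : (mem (ideal_set I) : {pred A}) a by apply: mem_set.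
by exists (exist _ a Ha).
Qed.

Lemma D_beta_dense : closure [set w : ideal_mod I | (D w < +oo)%E] = setT.
Proof.
apply/seteqP; split=> // w _; apply/rnorm_closure => e e0.
have [n [b [Ib Ab] wb]] := ideal_approx AF (ideal_modP w) e0.
have [v vE] := ideal_mod_mem Ib; exists v; first by apply: (@D_beta_subalg n); rewrite vE.
by move: wb; rewrite -vE.
Qed.

Lemma ideal_mod_complete (F : set_system (ideal_mod I)) :
  ProperFilter F -> cauchy F -> cvg F.
Proof.
apply: seq_complete_cvg => s sc.
have [l sl] := @cnorm_complete R A (fun n => val (s n)) sc.
have [v vE] : exists v : ideal_mod I, val v = l.
  apply: ideal_mod_mem; apply: (rnorm_closedP (ideal_closed (idealP I))) => e /sl[N HN].
  exists (val (s N)); first exact: ideal_modP.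
  by rewrite rnorm_distC; exact: HN.
by exists v => e /sl[N HN]; exists N => n /HN; rewrite -vE.
Qed.

Lemma D_beta_compact : compact [set w : ideal_mod I | (D w <= 1)%E].
Proof.
apply: tot_bounded_compact; first exact: ideal_mod_complete.
- apply: rnorm_closed => w Hw /=.
  have slack (e : R) : 0 < e -> exists v, [/\ (D v <= 1%:E)%E & cnorm (val w - val v) < e].
    by move=> /Hw[v Dv wv]; exists v.
  apply/D_beta_le; split=> [n||n].
  + apply/ler_addgt0Pr => e e0.
    have [v [/D_beta_le[/(_ n) h _ _] wv]] := slack _ (divr_gt0 e0 (ltr0n R 2)).
    have -> : val w - E n (val w) = (val v - E n (val v)) + ((val w - val v) - E n (val w - val v)).
      by rewrite (ceB (EP n)) [- (_ - _)]opprB addrACA subrKC addKr.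
    apply: le_trans (cnormD _ _) _; have := cnormB (val w - val v) (E n (val w - val v)).
    by have := ce_contr (EP n) (val w - val v); lra.
  + apply/ler_addgt0Pr => e e0; have [v [/D_beta_le[_ h _] wv]] := slack _ e0.
    by have := cnorm_le_dist (val w) (val v); lra.
  + apply/ler_addgt0Pr => e e0.
    have [v [/D_beta_le[_ _ /(_ n) h] wv]] := slack _ (divr_gt0 e0 (ltr0n R 2)).
    have -> : val w - val w * u n =
        (val v - val v * u n) + ((val w - val v) - (val w - val v) * u n).
      by rewrite [(val w - val v) * _]mulrBl [- (_ - _)]opprB addrACA subrKC addKr.
    apply: le_trans (cnormD _ _) _; have := cnormB (val w - val v) ((val w - val v) * u n).
    have := cnormM (val w - val v) (u n).
    have := ler_wpM2l (cnorm_ge0 (val w - val v)) (proj_cnorm_le1 (ideal_unit_proj AF I n)).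
    by rewrite -/(u n); lra.
have Stb : tot_bounded [set val w | w in [set w : ideal_mod I | (D w <= 1)%E]].
  apply: (af_tot_bounded AF) 1 _ => e e0.
  have [N HN] := af_beta_small AF e0; exists N => _ [w /D_beta_le[wE w1 _] <-].
  exists (E N (val w)); split; first exact: ce_range (EP N) _.
    exact: le_trans (ce_contr (EP N) _) w1.
  by apply: le_lt_trans (wE N) _; rewrite mul1r HN.
(* The centers have to lie in the image of the ball, so that [insubd] lifts them instead of
   returning its default 0. *)
move=> e e0; have [s [sS Hs]] := tot_bounded_in Stb e0.
exists [seq insubd 0 x | x <- s] => w Dw.
have [|x xs wx] := Hs (val w); first by exists w.
exists (insubd 0 x); first exact: map_f.
have [v _ vx] := sS x xs.
suff -> : insubd 0 x = v by rewrite -vx in wx.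
by rewrite -vx valKd.
Qed.

Lemma ideal_mod_hilbert : is_hilbert_module (@ideal_act R A I) (@ideal_inner R A I).
Proof.
split.
- by move=> a b w; apply: val_inj; rewrite /= mulrDl.
- by move=> a w v; apply: val_inj; rewrite /= mulrDr.
- by move=> a b w; apply: val_inj; rewrite /= mulrA.
- by move=> w; apply: val_inj; rewrite /= mul1r.
- by move=> c a w; apply: val_inj; rewrite /= -scalerAl.
- by move=> c a w; apply: val_inj; rewrite /= -scalerAr.
- by move=> w v x; rewrite /ideal_inner /= mulrDl.
- by move=> a w v; rewrite /ideal_inner /= mulrA.
- by move=> w v; rewrite /ideal_inner starM starK.
- by move=> w; exists (star (val w)); rewrite /ideal_inner starK.
- move=> w; rewrite /ideal_inner cnorm_stars sqrtr_sqr ger0_norm//.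
  exact: cnorm_ge0.
- exact: ideal_mod_complete.
Qed.

Lemma Omega_beta_mqvb : is_mqvb (triple_beta R) (Omega_beta A_ E beta I).
Proof.
split => /=.
- exact: (L_beta_qcms AF).
- exact: ideal_mod_hilbert.
- exact: D_betaZ.
- exact: D_betaD.
- exact: D_beta_dense.
- exact: D_beta_ge.
- exact: D_beta_compact.
- move=> a w [_ La] Dw.
  have [wE w1 wu] := D_beta_fineP Dw; have [_ d0] := D_beta_fin Dw.
  have aE := L_beta_fineP AF La; have [_ l0] := L_beta_fin AF La.
  rewrite /G_beta /F_beta; set l := fine (L_beta _ _ _) in aE l0 *.
  set d := fine _ in wE w1 wu d0 *.
  have a0 := cnorm_ge0 a; have w0 := cnorm_ge0 (val w).
  have dl : 0 <= d * l by exact: mulr_ge0.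
  have ad : 0 <= cnorm a * d by exact: mulr_ge0.
  apply/D_beta_le => /=; split.
  + move=> n; have := ce_leibniz (EP n) (af_unital AF n) a (val w).
    have := ler_wpM2l a0 (wE n).
    have : cnorm (a - E n a) * cnorm (val w) <= l * beta n * d.
      by apply: ler_pM => //; exact: cnorm_ge0.
    have : 0 <= d * l * beta n by rewrite mulr_ge0// ltW.
    by move=> *; lra.
  + have := cnormM a (val w); have := ler_wpM2l a0 w1.
    by move=> *; lra.
  (* The action is on the left and the units multiply on the right, so the two commute and this term
     needs no Leibniz estimate. *)
  + move=> n; rewrite -mulrA -mulrBr; have := cnormM a (val w - val w * u n).
    have := ler_wpM2l a0 (wu n).
    have : 0 <= d * l * beta n by rewrite mulr_ge0// ltW.
    have : 0 <= cnorm a * d * beta n by rewrite mulr_ge0// ltW.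
    by move=> *; lra.
- move=> w v Dw Dv.
  have [wE w1 _] := D_beta_fineP Dw; have [_ d0] := D_beta_fin Dw.
  have [vE v1 _] := D_beta_fineP Dv; have [_ d'0] := D_beta_fin Dv.
  suff H : (L_beta E beta (ideal_inner w v) <= (H_beta (fine (D w)) (fine (D v)))%:E)%E.
    rewrite ge_max; apply/andP; split.
      exact: le_trans (L_beta_re AF _) H.
    exact: le_trans (L_beta_im AF _) H.
  rewrite /H_beta /F_beta; set d := fine _ in wE w1 d0 *.
  set d' := fine _ in vE v1 d'0 *.
  apply/(L_beta_le AF) => n; rewrite /ideal_inner.
  have := ce_leibniz (EP n) (af_unital AF n) (val w) (star (val v)).
  rewrite (ce_star (EP n)) -starB !cnorm_starE => /le_trans; apply.
  have : cnorm (val w) * cnorm (val v - E n (val v)) <= d * (d' * beta n).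
    by apply: ler_pM => //; exact: cnorm_ge0.
  have : cnorm (val w - E n (val w)) * cnorm (val v) <= d * beta n * d'.
    by apply: ler_pM => //; exact: cnorm_ge0.
  have : 0 <= d * d' * beta n by rewrite !mulr_ge0// ltW.
  by move=> *; lra.
Qed.

End IdealBundles.

(** * The GNS representation *)

Section GNS.
Variables (R : realType) (A : cstarType R) (phi : A -> R[i]).
Hypothesis phiP : is_state phi.
Implicit Types (a b x y : A) (f g : A -> R[i]).

Definition gns_semi a : R := Num.sqrt (sqnorm phi a).
Local Notation s := gns_semi.

Lemma gns_semi_ge0 a : 0 <= s a.
Proof. exact: sqrtr_ge0. Qed.

Lemma gns_semi_sq a : s a ^+ 2 = sqnorm phi a.
Proof. by rewrite sqr_sqrtr// sqnorm_ge0. Qed.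

Lemma gns_CS x b : rnorm (phi (star b * x)) <= s x * s b.
Proof.
rewrite -(@ler_pXn2r _ 2) ?nnegrE ?rnorm_ge0 ?mulr_ge0 ?gns_semi_ge0//.
by rewrite exprMn !gns_semi_sq; exact: state_CS.
Qed.

Lemma gns_semiM a b : s (a * b) <= cnorm a * s b.
Proof.
rewrite -(@ler_pXn2r _ 2) ?nnegrE ?mulr_ge0 ?gns_semi_ge0 ?cnorm_ge0//.
by rewrite exprMn !gns_semi_sq; exact: sqnorm_mul.
Qed.

Lemma gns_semi_le a : s a <= cnorm a.
Proof.
rewrite -(@ler_pXn2r _ 2) ?nnegrE ?gns_semi_ge0 ?cnorm_ge0//.
by rewrite gns_semi_sq; exact: sqnorm_le.
Qed.

(** Scalars embed isometrically in the complete algebra [A] as multiples of 1, and the contraction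
    [phi] brings the limit back. *)
Lemma complex_complete (u : nat -> R[i]) :
  (forall e : R, 0 < e -> exists N, forall m n, (N <= m)%N -> (N <= n)%N ->
     rnorm (u m - u n) < e) ->
  exists c, forall e : R, 0 < e -> exists N, forall n, (N <= n)%N ->
     rnorm (u n - c) < e.
Proof.
move=> uc; have [|l ul] := @cnorm_complete R A (fun n => u n *: 1).
  move=> e /uc[N HN]; exists N => m n Nm Nn.
  by rewrite -scalerBl cnormZ cnorm1 mulr1 HN.
exists (phi l) => e /ul[N HN]; exists N => n /HN; apply: le_lt_trans.
have -> : u n - phi l = phi (u n *: 1 - l).
  by rewrite (stateB phiP) (stateZ phiP) (state_unit phiP) mulr1.
exact: state_le.
Qed.

Definition gns_vec x : A -> R[i] := fun b => phi (star b * x).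
Local Notation psi := gns_vec.

Definition gns_bound f (M : R) : Prop :=
  0 <= M /\ forall b, rnorm (f b) <= M * s b.

(* The Hilbert space of the representation is realized as the closure of the
   functionals [b |-> <x, b>] among the bounded conjugate-linear functionals. *)
Definition gns_mem f : Prop := forall e : R, 0 < e ->
  exists x, gns_bound (f - psi x) e.

Lemma gns_boundD f g M K :
  gns_bound f M -> gns_bound g K -> gns_bound (f + g) (M + K).
Proof.
move=> [M0 fM] [K0 gK]; split=> [|b]; first exact: addr_ge0.
by apply: le_trans (rnormD _ _) _; rewrite mulrDl lerD.
Qed.

Lemma gns_boundZ (c : R[i]) f M : gns_bound f M -> gns_bound (c *: f) (rnorm c * M).
Proof.
move=> [M0 fM]; split=> [|b]; first by rewrite mulr_ge0 ?rnorm_ge0.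
have -> : (c *: f) b = c * f b by [].
by rewrite rnormM -mulrA ler_wpM2l ?rnorm_ge0.
Qed.

Lemma gns_bound_vec x : gns_bound (psi x) (s x).
Proof. by split; [exact: gns_semi_ge0|move=> b; exact: gns_CS]. Qed.

Lemma gns_vecD x y : psi (x + y) = psi x + psi y.
Proof. by apply/funext => b; rewrite /psi mulrDr (stateD phiP). Qed.

Lemma gns_vecZ (c : R[i]) x : psi (c *: x) = c *: psi x.
Proof. by apply/funext => b; rewrite /psi -scalerAr (stateZ phiP). Qed.

Lemma gns_vecB x y : psi (x - y) = psi x - psi y.
Proof. by rewrite gns_vecD -scaleN1r gns_vecZ scaleN1r. Qed.

Let memH : {pred (A -> R[i])} := fun f => `[< gns_mem f >].

Let memH_submod_closed : submod_closed memH.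
Proof.
split=> [|c f g].
  apply/asboolP => e e0; exists 0; split => [|b]; first exact: ltW.
  have -> : ((0 : A -> R[i]) - psi 0) b = 0.
    transitivity (0 - phi (star b * 0)); first by [].
    by rewrite mulr0 (state0 phiP) subr0.
  by rewrite rnorm0 mulr_ge0 ?gns_semi_ge0// ltW.
move=> /asboolP Hf /asboolP Hg; apply/asboolP => e e0.
have c1 : 0 < rnorm c + 1 by have := rnorm_ge0 c; lra.
have [x fx] := Hf _ (divr_gt0 (divr_gt0 e0 (ltr0n R 2)) c1).
have [y gy] := Hg _ (divr_gt0 e0 (ltr0n R 2)).
exists (c *: x + y).
have -> : c *: f + g - psi (c *: x + y) = c *: (f - psi x) + (g - psi y).
  by rewrite gns_vecD gns_vecZ opprD addrACA scalerBr.
have [_ cfg] := gns_boundD (gns_boundZ c fx) gy; split=> [|b]; first exact: ltW.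
apply: le_trans (cfg b) _; rewrite ler_wpM2r ?gns_semi_ge0//.
have : rnorm c * (e / 2 / (rnorm c + 1)) <= e / 2; last by lra.
rewrite mulrCA -[leRHS]mulr1 ler_pM2l ?divr_gt0// ler_pdivrMr// mul1r.
by have := rnorm_ge0 c; lra.
Qed.

HB.instance Definition _ := GRing.isSubmodClosed.Build R[i] (A -> R[i]) memH
  memH_submod_closed.

(** The proof that [phi] is a state is a parameter of the type because the structures declared on it
    depend on that proof. *)
Definition gns (_ : is_state phi) : Type := {f : A -> R[i] | memH f}.
Local Notation H := (gns phiP).

HB.instance Definition _ := SubChoice.on H.
HB.instance Definition _ := [SubChoice_isSubLmodule of H by <:].
Implicit Types v w : H.

Lemma gnsP v : gns_mem (val v).
Proof. by have /asboolP := valP v. Qed.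

(** The operator norm of the functional with respect to the seminorm [s]; the infimum is attained,
    see [gns_norm_bound]. *)
Definition gns_norm v : R := inf [set M | gns_bound (val v) M].

Lemma gns_norm_has_inf v : has_inf [set M | gns_bound (val v) M].
Proof.
split; last by exists 0 => M [].
have [x vx] := gnsP v ltr01; exists (1 + s x).
by have := gns_boundD vx (gns_bound_vec x); rewrite subrK.
Qed.

Lemma gns_norm_le v M : gns_bound (val v) M -> gns_norm v <= M.
Proof. by move=> vM; apply: ge_inf => //; exists 0 => K []. Qed.

Lemma gns_norm_ge0 v : 0 <= gns_norm v.
Proof.
by apply: lb_le_inf; [exact: (gns_norm_has_inf v).1|move=> M []].
Qed.

Lemma gns_norm_bound v : gns_bound (val v) (gns_norm v).
Proof.
split=> [|b]; first exact: gns_norm_ge0.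
apply/ler_addgt0Pr => e e0; have sb := gns_semi_ge0 b.
have s1 : 0 < s b + 1 by lra.
have [M [M0 vM] ME] := inf_adherent (divr_gt0 e0 s1) (gns_norm_has_inf v).
apply: le_trans (vM b) _; apply: le_trans (ler_wpM2r sb (ltW ME)) _.
rewrite mulrDl lerD2l mulrAC ler_pdivrMr// ler_pM2l//; lra.
Qed.

Let norm v : R[i] := (gns_norm v)%:C.

Let norm_ler_normD v w : norm (v + w) <= norm v + norm w.
Proof.
rewrite /norm -rmorphD lecR; apply: gns_norm_le.
exact: gns_boundD (gns_norm_bound v) (gns_norm_bound w).
Qed.

Let normZ_le (c : R[i]) v : gns_norm (c *: v) <= rnorm c * gns_norm v.
Proof. by apply: gns_norm_le; exact: gns_boundZ (gns_norm_bound v). Qed.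

Let norm_normrZ (c : R[i]) v : norm (c *: v) = `|c| * norm v.
Proof.
rewrite (rnormE c) /norm -rmorphM /=; congr (_%:C); apply/eqP; rewrite eq_le normZ_le /=.
have [->|c0] := eqVneq c 0; first by rewrite rnorm0 mul0r gns_norm_ge0.
have c1 : rnorm c * rnorm c^-1 = 1 by rewrite -rnormM mulfV// /rnorm normr1.
rewrite -{1}(scalerK c0 v) -[leRHS]mul1r -c1 -mulrA ler_wpM2l ?rnorm_ge0//.
Qed.

Let norm_eq0 v : norm v = 0 -> v = 0.
Proof.
move=> /complexI v0; apply: val_inj; apply/funext => b; apply: rnorm_eq0.
apply/eqP; rewrite eq_le rnorm_ge0 andbT.
by have [_ /(_ b)] := gns_norm_bound v; rewrite v0 mul0r.
Qed.

HB.instance Definition _ := Lmodule_isNormed.Build R[i] H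
  norm_ler_normD norm_normrZ norm_eq0.

Lemma gns_rnorm v : rnorm v = gns_norm v.
Proof. by []. Qed.

Lemma gns_le v b : rnorm (val v b) <= rnorm v * s b.
Proof. by rewrite gns_rnorm; case: (gns_norm_bound v). Qed.

Lemma gns_rnorm_le v (M : R) : 0 <= M -> (forall b, rnorm (val v b) <= M * s b) ->
  rnorm v <= M.
Proof. by move=> *; apply: gns_norm_le; split. Qed.

Lemma gns_eq (z : R[i]) (K : R) : (forall e : R, 0 < e -> rnorm z <= e * K) -> z = 0.
Proof.
move=> zK; apply: rnorm_eq0; apply/eqP; rewrite eq_le rnorm_ge0 andbT.
apply/ler_addgt0Pr => e e0; rewrite add0r.
have K1 : 0 < `|K| + 1 by rewrite ltr_wpDl.
apply: le_trans (zK _ (divr_gt0 e0 K1)) _.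
rewrite mulrAC ler_pdivrMr// ler_pM2l// (le_trans (ler_norm _))// lerDl.
exact: ler01.
Qed.

Lemma gns_complete (F : set_system H) : ProperFilter F -> cauchy F -> cvg F.
Proof.
apply: seq_complete_cvg => u uc.
have diff m n b : rnorm (val (u m) b - val (u n) b) <= rnorm (u m - u n) * s b.
  exact: (gns_le (u m - u n) b).
have /choice[g gP] : forall b, exists c : R[i], forall e : R, 0 < e ->
    exists N, forall n, (N <= n)%N -> rnorm (val (u n) b - c) < e.
  move=> b; apply: complex_complete => e e0.
  have s1 : 0 < s b + 1 by have := gns_semi_ge0 b; lra.
  have [N HN] := uc _ (divr_gt0 e0 s1); exists N => m n Nm Nn.
  apply: le_lt_trans (diff m n b) _.
  apply: le_lt_trans (_ : e / (s b + 1) * s b < e).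
    by rewrite ler_wpM2r ?gns_semi_ge0// ltW// HN.
  by rewrite mulrAC ltr_pdivrMr// ltr_pM2l//; lra.
have gB (e : R) : 0 < e -> exists N, forall n, (N <= n)%N -> gns_bound (val (u n) - g) e.
  move=> e0; have [N HN] := uc _ e0; exists N => n Nn; split=> [|b]; first exact: ltW.
  apply/ler_addgt0Pr => d d0; have [M HM] := gP b _ d0.
  have -> : (val (u n) - g) b =
      (val (u n) b - val (u (maxn N M)) b) + (val (u (maxn N M)) b - g b).
    by rewrite subrKA.
  apply: le_trans (rnormD _ _) _; apply: lerD; last by rewrite ltW// HM// leq_maxr.
  apply: le_trans (diff _ _ _) _; rewrite ler_wpM2r ?gns_semi_ge0//.
  by rewrite ltW// HN// leq_maxl.
have gH : gns_mem g.
  move=> e e0; have e2 := divr_gt0 e0 (ltr0n R 2).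
  have [N /(_ N (leqnn N)) uNg] := gB _ e2; have [x ux] := gnsP (u N) e2.
  exists x; have := gns_boundD (gns_boundZ (-1) uNg) ux.
  rewrite /rnorm normrN normr1 mul1r -splitr scaleN1r opprB.
  by rewrite (_ : g - val (u N) + (val (u N) - psi x) = g - psi x)// subrKA.
have [w wE] : exists w, val w = g.
  have Hg : memH g by apply/asboolP.
  by exists (exist _ g Hg).
exists w => e e0; have [N HN] := gB _ (divr_gt0 e0 (ltr0n R 2)).
exists N => n /HN uB; apply: (@le_lt_trans _ _ (e / 2)); last by lra.
by rewrite gns_rnorm; apply: gns_norm_le; rewrite -wE in uB.
Qed.

HB.instance Definition _ := Uniform_isComplete.Build H gns_complete.

Lemma gns_vec_mem x : memH (psi x).
Proof.
apply/asboolP => e e0; exists x; rewrite subrr; split=> [|b]; first exact: ltW.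
by rewrite rnorm0 mulr_ge0 ?gns_semi_ge0// ltW.
Qed.

Definition gns_of x : H := exist _ (psi x) (gns_vec_mem x).

Lemma gns_ofB x y : gns_of (x - y) = gns_of x - gns_of y.
Proof. by apply: val_inj; exact: gns_vecB. Qed.

Lemma gns_ofZ (c : R[i]) x : gns_of (c *: x) = c *: gns_of x.
Proof. by apply: val_inj; exact: gns_vecZ. Qed.

Lemma rnorm_gns_of x : rnorm (gns_of x) = s x.
Proof.
apply/eqP; rewrite eq_le gns_rnorm_le ?gns_semi_ge0//=; last first.
  by move=> b; exact: gns_CS.
have [->|sx] := eqVneq (s x) 0; first exact: rnorm_ge0.
have := gns_le (gns_of x) x.
rewrite /= /psi sqnormE// -gns_semi_sq rnormRC ger0_norm ?sqr_ge0// expr2.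
by rewrite ler_pM2r// lt_neqAle eq_sym sx gns_semi_ge0.
Qed.

Lemma gns_approx v (e : R) : 0 < e -> exists x, rnorm (v - gns_of x) < e.
Proof.
move=> e0; have [x vx] := gnsP v (divr_gt0 e0 (ltr0n R 2)); exists x.
apply: (@le_lt_trans _ _ (e / 2)); last by lra.
by rewrite gns_rnorm; exact: gns_norm_le.
Qed.

Lemma gns_conj_linear v (c : R[i]) a b :
  val v (c *: a + b) = Num.conj c * val v a + val v b.
Proof.
apply/eqP; rewrite -subr_eq0; apply/eqP.
apply: (@gns_eq _ (s (c *: a + b) + rnorm (Num.conj c) * s a + s b)) => e e0.
have [x vx] := gns_approx v e0.
have vB d : rnorm (val v d - psi x d) <= e * s d.
  apply: le_trans (gns_le (v - gns_of x) d) _.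
  by rewrite ler_wpM2r ?gns_semi_ge0// ltW.
have psiL : psi x (c *: a + b) = Num.conj c * psi x a + psi x b.
  by rewrite /psi starD starZ mulrDl -scalerAl (stateD phiP) (stateZ phiP).
have -> : val v (c *: a + b) - (Num.conj c * val v a + val v b) =
    (val v (c *: a + b) - psi x (c *: a + b)) +
    (- (Num.conj c * (val v a - psi x a)) - (val v b - psi x b)).
  by rewrite psiL; ring.
apply: le_trans (rnormD _ _) _; rewrite -addrA [e * _]mulrDr; apply: lerD => //.
apply: le_trans (rnormD _ _) _; rewrite !rnormN [e * (_ + _)]mulrDr; apply: lerD => //.
by rewrite rnormM mulrCA ler_wpM2l ?rnorm_ge0.
Qed.

(** The functional [val v] is Lipschitz for [s], so it extends by continuity from the vectors
    [gns_of y] to every [w]. The value [c] of the extension at [w] is the inner product. *)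
Lemma gns_ip_exists v w : exists c : R[i], forall y,
  rnorm (val v y - c) <= rnorm v * rnorm (w - gns_of y).
Proof.
have v1 : 0 < rnorm v + 1 by have := rnorm_ge0 v; lra.
have vB x y : val v x - val v y = val v (x - y).
  have := gns_conj_linear v (-1) y x; rewrite scaleN1r addrC => ->.
  by rewrite rmorphN1 mulN1r addrC.
have vd x y : rnorm (val v x - val v y) <= rnorm v * rnorm (gns_of x - gns_of y).
  by rewrite vB -gns_ofB rnorm_gns_of; exact: gns_le.
have tri (x y z : H) : rnorm (x - z) <= rnorm (x - y) + rnorm (y - z).
  by rewrite -[x - z](subrKA y) rnormD.
have /choice[u uP] : forall n, exists x, rnorm (w - gns_of x) < n.+1%:R^-1.
  by move=> n; apply: gns_approx; rewrite invr_gt0.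
have small (e : R) : 0 < e -> exists N, forall n, (N <= n)%N ->
    rnorm v * rnorm (w - gns_of (u n)) <= e.
  move=> e0; have [N HN] := invS_lt (divr_gt0 e0 v1).
  exists N => n /HN Nn; apply: (@le_trans _ _ ((rnorm v + 1) * (e / (rnorm v + 1)))).
    by apply: ler_pM; rewrite ?rnorm_ge0 ?lerDl ?ler01// ltW// (lt_trans (uP n)).
  by rewrite mulrC divfK// gt_eqF.
have vuy n y : rnorm (val v y - val v (u n)) <=
    rnorm v * rnorm (w - gns_of y) + rnorm v * rnorm (w - gns_of (u n)).
  apply: le_trans (vd _ _) _; rewrite -mulrDr ler_wpM2l ?rnorm_ge0//.
  by rewrite (rnorm_distC w (gns_of y)) tri.
have [|c uc] := complex_complete (u := fun n => val v (u n)).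
  move=> e e0; have [N HN] := small _ (divr_gt0 (divr_gt0 e0 (ltr0n R 2)) (ltr0n R 2)).
  exists N => m n /HN Nm /HN Nn; apply: le_lt_trans (vuy n (u m)) _.
  by lra.
exists c => y; apply/ler_addgt0Pr => e e0; have e2 := divr_gt0 e0 (ltr0n R 2).
have [N HN] := small _ e2; have [M HM] := uc _ e2.
have -> : val v y - c = (val v y - val v (u (maxn N M))) + (val v (u (maxn N M)) - c).
  by rewrite subrKA.
apply: le_trans (rnormD _ _) _.
have := vuy (maxn N M) y; have := HN _ (leq_maxl N M); have := HM _ (leq_maxr N M).
by lra.
Qed.

Definition gns_ip v w : R[i] := projT1 (cid (gns_ip_exists v w)).

Lemma gns_ip_le v w y :
  rnorm (val v y - gns_ip v w) <= rnorm v * rnorm (w - gns_of y).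
Proof. exact: (projT2 (cid (gns_ip_exists v w))). Qed.

(** A Lipschitz estimate with any constant identifies the inner product, by density of the vectors
    [gns_of y]; linearity and the adjoint relation follow this way. *)
Lemma gns_ip_uniq v w c (K : R) :
  (forall y, rnorm (val v y - c) <= K * rnorm (w - gns_of y)) -> gns_ip v w = c.
Proof.
move=> cP; apply/eqP; rewrite -subr_eq0; apply/eqP.
apply: (@gns_eq _ (rnorm v + `|K|)) => e e0; have [y wy] := gns_approx w e0.
have -> : gns_ip v w - c = - (val v y - gns_ip v w) + (val v y - c) by ring.
apply: le_trans (rnormD _ _) _; rewrite rnormN mulrDr.
apply: lerD; [apply: le_trans (gns_ip_le v w y) _|apply: le_trans (cP y) _].
  by rewrite mulrC ler_wpM2r ?rnorm_ge0// ltW.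
rewrite [e * _]mulrC (le_trans (ler_wpM2r (rnorm_ge0 _) (ler_norm K)))//.
by rewrite ler_wpM2l// ltW.
Qed.

Lemma gns_ip_approx v w x y (e : R) : 0 <= e -> e <= 1 ->
  rnorm (v - gns_of x) <= e -> rnorm (w - gns_of y) <= e ->
  rnorm (phi (star y * x) - gns_ip v w) <= e * (rnorm v + rnorm w + 1).
Proof.
move=> e0 e1 vx wy.
have -> : phi (star y * x) - gns_ip v w =
    (val v y - gns_ip v w) - (val (v - gns_of x) y).
  have -> : val (v - gns_of x) y = val v y - phi (star y * x) by [].
  by ring.
apply: le_trans (rnormD _ _) _; rewrite rnormN.
have sy : s y <= rnorm w + 1.
  rewrite -rnorm_gns_of -[gns_of y](subrK w) addrC (le_trans (rnormD _ _))// lerD2l.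
  by rewrite rnorm_distC (le_trans wy).
rewrite -addrA mulrDr; apply: lerD.
  apply: le_trans (gns_ip_le v w y) _; rewrite mulrC.
  by apply: ler_wpM2r => //; exact: rnorm_ge0.
apply: le_trans (gns_le _ _) _.
by apply: ler_pM => //; [exact: rnorm_ge0|exact: gns_semi_ge0].
Qed.

Lemma gns_approx2 v w (e : R) : 0 < e -> exists d x y, [/\ 0 < d, d <= 1, d <= e,
  rnorm (v - gns_of x) <= d & rnorm (w - gns_of y) <= d].
Proof.
move=> e0; pose d := Num.min 1 e; have d0 : 0 < d by rewrite lt_min ltr01.
have [x vx] := gns_approx v d0; have [y wy] := gns_approx w d0.
by exists d, x, y; split=> //; rewrite ?ge_min ?lexx ?orbT// ltW.
Qed.

Lemma gns_inner_product : is_inner_product gns_ip.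
Proof.
split=> [c v1 v2 w|v w|v].
- apply: (@gns_ip_uniq _ _ _ (rnorm c * rnorm v1 + rnorm v2)) => y.
  have -> : val (c *: v1 + v2) y - (c * gns_ip v1 w + gns_ip v2 w) =
      c * (val v1 y - gns_ip v1 w) + (val v2 y - gns_ip v2 w).
    have -> : val (c *: v1 + v2) y = c * val v1 y + val v2 y by [].
    by ring.
  apply: le_trans (rnormD _ _) _; rewrite mulrDl rnormM -mulrA.
  by apply: lerD; rewrite ?ler_wpM2l ?rnorm_ge0 ?gns_ip_le.
- apply/eqP; rewrite -subr_eq0; apply/eqP.
  apply: (@gns_eq _ (2 * (rnorm v + rnorm w + 1))) => e e0.
  have [d [x [y [d0 d1 de vx wy]]]] := gns_approx2 v w e0.
  have conjB (a b : R[i]) : (a - b)^*%C = a^*%C - b^*%C by rewrite -(rmorphB Num.conj).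
  have -> : gns_ip w v - (gns_ip v w)^*%C =
      (phi (star y * x) - gns_ip v w)^*%C - (phi (star x * y) - gns_ip w v).
    rewrite conjB -(state_star phiP) starM starK; ring.
  apply: le_trans (rnormD _ _) _; rewrite rnormN.
  have -> : rnorm ((phi (star y * x) - gns_ip v w)^*%C) = rnorm (phi (star y * x) - gns_ip v w).
    by rewrite /rnorm normcJ.
  have := gns_ip_approx (ltW d0) d1 vx wy; have := gns_ip_approx (ltW d0) d1 wy vx.
  rewrite [rnorm w + _]addrC.
  have : d * (rnorm v + rnorm w + 1) <= e * (rnorm v + rnorm w + 1).
    by rewrite ler_wpM2r// !addr_ge0 ?rnorm_ge0// ler01.
  by lra.
- apply/eqP; rewrite rnormE -rmorphXn /= -subr_eq0; apply/eqP.
  apply: (@gns_eq _ (2 * (rnorm v + rnorm v + 1))) => e e0.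
  have [d [x [_ [d0 d1 de vx _]]]] := gns_approx2 v v e0.
  have -> : gns_ip v v - (rnorm v ^+ 2)%:C =
      (s x ^+ 2 - rnorm v ^+ 2)%:C - (phi (star x * x) - gns_ip v v).
    by rewrite (sqnormE phiP) -gns_semi_sq rmorphB /=; ring.
  apply: le_trans (rnormD _ _) _; rewrite rnormN.
  have K0 : 0 <= rnorm v + rnorm v + 1 by rewrite !addr_ge0 ?rnorm_ge0// ler01.
  have := gns_ip_approx (ltW d0) d1 vx vx.
  suff : rnorm ((s x ^+ 2 - rnorm v ^+ 2)%:C : R[i]) <= d * (rnorm v + rnorm v + 1).
    have : d * (rnorm v + rnorm v + 1) <= e * (rnorm v + rnorm v + 1).
      by rewrite ler_wpM2r.
    by lra.
  rewrite rnormRC subr_sqr normrM -rnorm_gns_of.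
  have xd : `|rnorm (gns_of x) - rnorm v| <= d.
    rewrite ler_norml; apply/andP; split.
      have := rnormD (v - gns_of x) (gns_of x); rewrite subrK.
      by move: vx; lra.
    have := rnormD (gns_of x - v) v; rewrite subrK rnorm_distC.
    by move: vx; lra.
  apply: ler_pM; rewrite ?normr_ge0//.
  rewrite ger0_norm ?addr_ge0 ?rnorm_ge0//.
  by move: xd; rewrite ler_norml => /andP[_]; move: d1; lra.
Qed.

Lemma gns_act_bound a f M : gns_bound f M -> gns_bound (fun b => f (star a * b)) (cnorm a * M).
Proof.
move=> [M0 fM]; split=> [|b]; first by rewrite mulr_ge0 ?cnorm_ge0.
apply: le_trans (fM _) _; rewrite [_ * M]mulrC -mulrA ler_wpM2l//.
by rewrite -(cnorm_starE a); exact: gns_semiM.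
Qed.

Lemma gns_act_mem a v : memH (fun b => val v (star a * b)).
Proof.
apply/asboolP => e e0; have a1 : 0 < cnorm a + 1 by have := cnorm_ge0 a; lra.
have [x vx] := gnsP v (divr_gt0 e0 a1); exists (a * x).
have [_ av] := gns_act_bound a vx; split=> [|b]; first exact: ltW.
have -> : ((fun b => val v (star a * b)) - psi (a * x)) b =
    (val v - psi x) (star a * b).
  transitivity (val v (star a * b) - phi (star b * (a * x))); first by [].
  by rewrite mulrA -{2}(starK a) -starM.
apply: le_trans (av b) _; rewrite ler_wpM2r ?gns_semi_ge0//.
by rewrite mulrCA -[leRHS]mulr1 ler_pM2l// ler_pdivrMr// mul1r; lra.
Qed.

(** Forced by the adjoint relation: the pairing of [a v] with [b] is that of [v] with
    [star a * b]. *)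
Definition gns_act a v : H := exist (fun f => is_true (memH f)) _ (gns_act_mem a v).

Lemma gns_actB a v w : gns_act a (v - w) = gns_act a v - gns_act a w.
Proof. exact: val_inj. Qed.

Lemma rnorm_gns_act a v : rnorm (gns_act a v) <= cnorm a * rnorm v.
Proof. by rewrite !gns_rnorm; apply: gns_norm_le; exact: gns_act_bound (gns_norm_bound v). Qed.

Lemma gns_act_of a x : gns_act a (gns_of x) = gns_of (a * x).
Proof.
apply: val_inj; apply/funext => b; rewrite /= /psi.
by rewrite starM starK mulrA.
Qed.

Lemma gns_ip_act a v w : gns_ip (gns_act a v) w = gns_ip v (gns_act (star a) w).
Proof.
apply: (@gns_ip_uniq _ _ _ (rnorm v * cnorm a)) => y; rewrite rnorm_distC rnorm_distC /=.
apply: le_trans (gns_ip_le v (gns_act (star a) w) (star a * y)) _.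
rewrite -mulrA ler_wpM2l ?rnorm_ge0// -gns_act_of -gns_actB.
by rewrite -(cnorm_starE a); exact: rnorm_gns_act.
Qed.

End GNS.

(** * Pure states from chains of minimal projections *)

Section PureState.
Variables (R : realType) (A : cstarType R) (A_ : nat -> set A)
  (tau : A -> R[i]) (E : nat -> A -> A) (beta : nat -> R).
Hypothesis AF : af_setting A_ tau E beta.
Variable J : ideals A.

(** The shift by [N] starts the chain at the level of [p]. Minimality takes the form of a
    one-dimensional corner, from which scalars can be read off. *)
Record proj_chain (N : nat) (p : A) (q : nat -> A) : Prop := {
  chain_sub : forall n, A_ (N + n)%N (q n);
  chain_proj : forall n, is_proj (q n);
  chain_notin : forall n, ~ ideal_set J (q n);
  chain_head : q 0%N * p = q 0%N;
  chain_decr : forall n, q n.+1 * q n = q n.+1;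
  chain_min : forall n x, A_ (N + n)%N x ->
    exists c : R[i], q n * x * q n = c *: q n }.

Lemma proj_chain_exists N p : A_ N p -> is_proj p -> ~ ideal_set J p ->
  exists q, proj_chain N p q.
Proof.
move=> Ap pP Jp.
pose good n q := [/\ A_ (N + n)%N q, is_proj q, ~ ideal_set J q &
  forall x, A_ (N + n)%N x -> exists c : R[i], q * x * q = c *: q].
(* The hypotheses sit inside the existential so that the choice function is total; pairs violating
   them receive the dummy value 0. *)
have /choice[g gP] : forall nq : nat * A, exists q',
    A_ (N + nq.1)%N nq.2 -> is_proj nq.2 -> ~ ideal_set J nq.2 ->
    good nq.1 q' /\ q' * nq.2 = q'.
  move=> [n q] /=.
  have [[Aq qP Jq]|H] := pselect [/\ A_ (N + n)%N q, is_proj q & ~ ideal_set J q].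
    have [q' [? ? ? ? ?]] :=
      minimal_proj (af_tau AF) (af_fd AF _) (af_unital AF _) (idealP J) Aq qP Jq.
    by exists q'.
  by exists 0 => *; exfalso; apply: H.
pose q := fix q n := if n is m.+1 then g (m.+1, q m) else g (0%N, p).
have q0 : good 0%N (q 0%N) /\ q 0%N * p = q 0%N.
  by have := gP (0%N, p); rewrite /= addn0; apply.
have qS n : good n (q n) -> good n.+1 (q n.+1) /\ q n.+1 * q n = q n.+1.
  move=> [Aq qP Jq _]; apply: (gP (n.+1, q n)) => //=.
  by rewrite addnS; exact: af_incr AF _ _ Aq.
have qg n : good n (q n).
  by elim: n => [|n /qS[]//]; case: q0.
exists q; split=> [n|n|n||n|n].
- by case: (qg n).
- by case: (qg n).
- by case: (qg n).
- by case: q0.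
- by case: (qS n (qg n)).
- by case: (qg n).
Qed.

Variables (N : nat) (p : A) (q : nat -> A).
Hypothesis qP : proj_chain N p q.

Let q_sa n : star (q n) = q n := (chain_proj qP n).1.
Let qq n : q n * q n = q n := (chain_proj qP n).2.

Lemma chain_neq0 n : q n <> 0.
Proof. by move=> q0; apply: (@chain_notin _ _ _ qP n); rewrite q0; exact: ideal0 (idealP J). Qed.

Lemma chain_le m n : (m <= n)%N -> q n * q m = q n.
Proof.
elim: n => [|n IH]; first by rewrite leqn0 => /eqP ->; exact: qq.
rewrite leq_eqVlt => /orP[/eqP -> |]; first exact: qq.
by rewrite ltnS => /IH qnm; rewrite -(chain_decr qP n) -mulrA qnm.
Qed.

Lemma chain_ge m n : (m <= n)%N -> q m * q n = q n.
Proof. by move=> mn; rewrite -(q_sa m) -(q_sa n) -starM (chain_le mn). Qed.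

Lemma chain_compress m n b (c : R[i]) : (m <= n)%N -> q m * b * q m = c *: q m ->
  q n * b * q n = c *: q n.
Proof.
move=> mn qbq; rewrite -{1}(chain_le mn) -{2}(chain_ge mn).
transitivity (q n * (q m * b * q m) * q n); first by rewrite !mulrA.
by rewrite qbq -scalerAr -scalerAl (chain_le mn) qq.
Qed.

Let tauP := fts_state (af_tau AF).

Let tau_q_neq0 n : tau (q n) != 0.
Proof.
apply/eqP; rewrite -(qq n) -{1}(q_sa n) => /(fts_faithful (af_tau AF)).
exact: chain_neq0.
Qed.

Let psi n a := tau (q n * a * q n) / tau (q n).

Let psi_state n : is_state (psi n).
Proof.
split=> [c a b|a|]; rewrite /psi.
- rewrite mulrDr mulrDl -scalerAr -scalerAl (stateD tauP) (stateZ tauP).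
  by rewrite mulrDl mulrA.
- apply: divr_ge0.
    have -> : q n * (star a * a) * q n = star (a * q n) * (a * q n).
      by rewrite starM q_sa !mulrA.
    exact: state_pos tauP _.
  by rewrite -(qq n) -{1}(q_sa n); exact: state_pos tauP _.
- by rewrite mulr1 qq mulfV.
Qed.

Let psi_scal n b (c : R[i]) : q n * b * q n = c *: q n -> psi n b = c.
Proof. by move=> qbq; rewrite /psi qbq (stateZ tauP) mulfK. Qed.

Lemma complex_limit_ge0 (z : R[i]) :
  (forall e : R, 0 < e -> exists2 w : R[i], 0 <= w & rnorm (w - z) < e) -> 0 <= z.
Proof.
move=> H; have close (e : R) : 0 < e -> exists2 r : R, 0 <= r &
    `|r - complex.Re z| < e /\ `|complex.Im z| < e.
  move=> /H[[r t]]; rewrite lecE /= => /andP[/eqP -> r0] wz.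
  exists r => //; move: wz; case: z {H} => x y /=.
  rewrite /rnorm normc_def /= sub0r sqrrN => wz; split; apply: le_lt_trans wz.
    by rewrite -sqrtr_sqr ler_sqrt ?addr_ge0 ?sqr_ge0// lerDl sqr_ge0.
  by rewrite -sqrtr_sqr ler_sqrt ?addr_ge0 ?sqr_ge0// lerDr sqr_ge0.
rewrite lecE /=; apply/andP; split.
  rewrite -normr_le0; apply/ler_addgt0Pr => e /close[r _ [_ h]].
  by rewrite add0r ltW.
apply/ler_addgt0Pr => e /close[r r0 [h _]].
by move: h; rewrite ltr_norml => /andP[]; lra.
Qed.

(** For [b] in [A_ (N + m)] the value [psi n b] is constant from [n = m] on, since compression by
    [q m] already makes [b] scalar. Contractivity of states carries convergence over to the
    closure. *)
Lemma chain_state : exists phi, is_state phi /\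
  forall m n b, A_ (N + m)%N b -> (m <= n)%N -> q n * b * q n = phi b *: q n.
Proof.
have psi_eq m n b : A_ (N + m)%N b -> (m <= n)%N -> psi n b = psi m b.
  move=> Ab mn; have [c qbq] := chain_min qP Ab.
  by rewrite (psi_scal qbq) (psi_scal (chain_compress mn qbq)).
have approx a (e : R) : 0 < e -> exists m, exists2 b, A_ (N + m)%N b & cnorm (a - b) < e.
  move=> /(af_approx AF a)[m [b Ab ab]]; exists m, b => //.
  by apply: (af_le AF) Ab; exact: leq_addl.
have /choice[phi phiE] : forall a, exists c : R[i], forall e : R, 0 < e ->
    exists M, forall n, (M <= n)%N -> rnorm (psi n a - c) < e.
  move=> a; apply: (complex_complete tauP) => e e0.
  have [m [b Ab ab]] := approx a _ (divr_gt0 (divr_gt0 e0 (ltr0n R 2)) (ltr0n R 2)).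
  exists m => k l mk ml.
  have -> : psi k a - psi l a = psi k (a - b) - psi l (a - b).
    rewrite (stateB (psi_state k)) (stateB (psi_state l)).
    by rewrite (psi_eq _ _ _ Ab mk) (psi_eq _ _ _ Ab ml); ring.
  apply: le_lt_trans (rnormD _ _) _; rewrite rnormN.
  have := state_le (psi_state k) (a - b); have := state_le (psi_state l) (a - b).
  by move: ab; lra.
have phi_eq m b : A_ (N + m)%N b -> phi b = psi m b.
  move=> Ab; apply/eqP; rewrite -subr_eq0; apply/eqP; apply: rnorm_eq0.
  apply/eqP; rewrite eq_le rnorm_ge0 andbT; apply/ler_addgt0Pr => e e0.
  have [M HM] := phiE b _ e0.
  rewrite add0r rnorm_distC -(psi_eq _ _ _ Ab (leq_maxr M m)).
  by rewrite ltW// HM// leq_maxl.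
exists phi; split; last first.
  move=> m n b Ab mn; have [c qbq] := chain_min qP Ab.
  by rewrite (chain_compress mn qbq) (phi_eq _ _ Ab) (psi_scal qbq).
split=> [c a b|a|].
- apply/eqP; rewrite -subr_eq0; apply/eqP; apply: rnorm_eq0.
  apply/eqP; rewrite eq_le rnorm_ge0 andbT; apply/ler_addgt0Pr => e e0.
  have e3 : 0 < e / 3 by rewrite divr_gt0.
  have c1 : 0 < rnorm c + 1 by have := rnorm_ge0 c; lra.
  have [M1 H1] := phiE (c *: a + b) _ e3; have [M2 H2] := phiE b _ e3.
  have [M3 H3] := phiE a _ (divr_gt0 e3 c1).
  pose n := maxn M1 (maxn M2 M3).
  have -> : phi (c *: a + b) - (c * phi a + phi b) =
      - (psi n (c *: a + b) - phi (c *: a + b)) +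
      (c * (psi n a - phi a) + (psi n b - phi b)).
    by rewrite (state_linear (psi_state n)); ring.
  rewrite add0r; apply: le_trans (rnormD _ _) _; rewrite rnormN.
  have := rnormD (c * (psi n a - phi a)) (psi n b - phi b); rewrite rnormM.
  have : rnorm c * rnorm (psi n a - phi a) <= e / 3.
    have /ltW/(ler_wpM2l (rnorm_ge0 c))/le_trans : rnorm (psi n a - phi a) < e / 3 / (rnorm c + 1).
      by apply: H3; rewrite !leq_max leqnn !orbT.
    apply; rewrite mulrCA -[leRHS]mulr1 ler_pM2l// ler_pdivrMr// mul1r; lra.
  have : rnorm (psi n (c *: a + b) - phi (c *: a + b)) < e / 3.
    by apply: H1; rewrite leq_maxl.
  have : rnorm (psi n b - phi b) < e / 3 by apply: H2; rewrite !leq_max leqnn !orbT.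
  by lra.
- apply: complex_limit_ge0 => e e0; have [M /(_ M (leqnn M)) HM] := phiE (star a * a) _ e0.
  by exists (psi M (star a * a)) => //; exact: state_pos (psi_state M) _.
- rewrite (phi_eq 0%N); last exact: af_unital AF _.
  exact: state_unit (psi_state _).
Qed.

Variable phi : A -> R[i].
Hypothesis phiP : is_state phi.
Hypothesis phi_chain : forall m n b, A_ (N + m)%N b -> (m <= n)%N ->
  q n * b * q n = phi b *: q n.

Lemma chain_cnorm n : cnorm (q n) = 1.
Proof.
have := cnorm_star (q n); rewrite q_sa qq expr2.
have q0 : cnorm (q n) != 0 by apply/eqP => /cnorm0_eq0; exact: chain_neq0.
by move=> /esym/(canRL (mulfK q0)); rewrite divff.
Qed.

Lemma phi_scal m n b (c : R[i]) : A_ (N + m)%N b -> (m <= n)%N ->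
  q n * b * q n = c *: q n -> phi b = c.
Proof.
move=> Ab mn; rewrite (phi_chain Ab mn) => /eqP.
rewrite -subr_eq0 -scalerBl scaler_eq0 subr_eq0 => /orP[/eqP //|/eqP].
by move/chain_neq0.
Qed.

Lemma phi_chain1 n : phi (q n) = 1.
Proof. by apply: (phi_scal (chain_sub qP n) (leqnn n)); rewrite !qq scale1r. Qed.

Lemma phi_head : A_ N p -> phi p = 1.
Proof.
move=> Ap; apply: (@phi_scal 0 0) => //; first by rewrite addn0.
by rewrite (chain_head qP) qq scale1r.
Qed.

(* If [phi x <> 0], then [q_n x q_n / phi x] is an element of [J] at distance
   [< 1] from the projection [q_n]. *)
Lemma phi_ideal x : ideal_set J x -> phi x = 0.
Proof.
move=> Jx; apply/eqP; apply: contrapT => /negP x0.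
have rx0 : 0 < rnorm (phi x).
  by rewrite lt_neqAle rnorm_ge0 andbT eq_sym; apply/eqP => /rnorm_eq0/eqP; apply/negP.
have [m [b Ab xb]] := af_approx AF x (divr_gt0 rx0 (ltr0n R 2)).
have {}Ab : A_ (N + m)%N b by apply: (af_le AF) Ab; exact: leq_addl.
apply: (@chain_notin _ _ _ qP m).
pose y := (phi x)^-1 *: (q m * x * q m).
have Jy : ideal_set J y.
  rewrite /y -mulr_algl; apply: (idealMl (idealP J)); apply: (Defs.idealMr (idealP J)).
  exact: (idealMl (idealP J)).
apply: (proj_near_ideal (idealP J) (chain_proj qP m) Jy).
have -> : q m - y = (phi x)^-1 *: (phi (x - b) *: q m - q m * (x - b) * q m).
  rewrite /y (stateB phiP) scalerBl mulrBr mulrBl (phi_chain Ab (leqnn m)).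
  by rewrite opprB addrA subrK scalerBr scalerA mulVf// scale1r.
rewrite cnormZ; have -> : rnorm (phi x)^-1 = (rnorm (phi x))^-1.
  apply: (mulfI (lt0r_neq0 rx0)); rewrite -rnormM !mulfV ?(lt0r_neq0 rx0)//.
  by rewrite /rnorm normr1.
rewrite ltr_pdivrMl// mulr1; apply: le_lt_trans (cnormB _ _) _.
rewrite cnormZ chain_cnorm mulr1.
have : cnorm (q m * (x - b) * q m) <= cnorm (x - b).
  apply: le_trans (cnormM _ _) _; rewrite chain_cnorm mulr1.
  by apply: le_trans (cnormM _ _) _; rewrite chain_cnorm mul1r.
have := state_le phiP (x - b); move: xb; lra.
Qed.

Local Notation H := (gns phiP).
Local Notation vec := (gns_of phiP).

(** Since [phi (1 - q n) = 0], every [q n] fixes the cyclic vector. *)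
Lemma gns_semi_chain n y : gns_semi phi (y * (1 - q n)) = 0.
Proof.
have uP : is_proj (1 - q n).
  by apply: is_projB; [exact: is_proj1|exact: chain_proj qP n|rewrite mulr1].
have u0 : sqnorm phi (1 - q n) = 0.
  by rewrite /sqnorm (proj1 uP) (proj2 uP) (stateB phiP) (state_unit phiP)
    phi_chain1 subrr.
apply/eqP; rewrite sqrtr_eq0 (le_trans (sqnorm_mul phiP _ _))// u0 mulr0//.
Qed.

Lemma gns_of_eq x y : gns_semi phi (x - y) = 0 -> vec x = vec y.
Proof.
rewrite -(rnorm_gns_of phiP) gns_ofB => /rnorm_eq0/eqP.
by rewrite subr_eq0 => /eqP.
Qed.

(** The cyclic vector absorbs a [q n] on the right, and [q n * b * q n] is scalar; so on vectors of
    level [m] the limit projection is reached exactly. *)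
Lemma gns_chain_act m n b : A_ (N + m)%N b -> (m <= n)%N ->
  gns_act (q n) (vec b) = phi b *: vec 1.
Proof.
move=> Ab mn; rewrite gns_act_of -gns_ofZ.
transitivity (vec (q n * b * q n)).
  apply: gns_of_eq; rewrite -[X in X - _]mulr1 -mulrBr; exact: gns_semi_chain.
rewrite (phi_chain Ab mn); apply/esym/gns_of_eq.
by rewrite -scalerBr -[1 - _]mul1r scalerAl; exact: gns_semi_chain.
Qed.

Lemma rnorm_gns_of1 : rnorm (vec 1) = 1.
Proof.
by rewrite rnorm_gns_of /gns_semi /sqnorm star1 mulr1 (state_unit phiP) sqrtr1.
Qed.

(* The [q n] converge strongly to the orthogonal projection onto the cyclic
   vector, since [val v 1] is the inner product of [v] with it. *)
Lemma gns_chain_lim (v : H) (e : R) : 0 < e ->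
  exists n, rnorm (gns_act (q n) v - val v 1 *: vec 1) < e.
Proof.
move=> e0; have e4 : 0 < e / 4 by rewrite divr_gt0.
have [x vx] := gns_approx v e4.
have [m [b Ab xb]] := af_approx AF x e4.
have {}Ab : A_ (N + m)%N b by apply: (af_le AF) Ab; exact: leq_addl.
have vb : rnorm (v - vec b) < e / 2.
  rewrite -[v - _](subrKA (vec x)); apply: le_lt_trans (rnormD _ _) _.
  rewrite -gns_ofB rnorm_gns_of; have := gns_semi_le phiP (x - b).
  by move: vx xb; lra.
exists m.
have -> : gns_act (q m) v - val v 1 *: vec 1 =
    gns_act (q m) (v - vec b) - (val (v - vec b) 1) *: vec 1.
  have -> : val (v - vec b) 1 = val v 1 - phi b.
    transitivity (val v 1 - phi (star 1 * b)); first by [].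
    by rewrite star1 mul1r.
  rewrite gns_actB (gns_chain_act Ab (leqnn m)) scalerBl opprB.
  by rewrite subrKA.
apply: le_lt_trans (rnormD _ _) _; rewrite rnormN rnormZ rnorm_gns_of1 mulr1.
have := rnorm_gns_act (q m) (v - vec b); rewrite chain_cnorm mul1r.
have := gns_le (v - vec b) 1; rewrite -(rnorm_gns_of phiP) rnorm_gns_of1 mulr1.
by move: vb; lra.
Qed.

Lemma gns_chain_irrep : is_irrep (@gns_ip R A phi phiP) (@gns_act R A phi phiP).
Proof.
split.
- move=> c a b v; apply: val_inj; apply/funext => d.
  transitivity (val v (star (c *: a + b) * d)); first by [].
  rewrite starD starZ mulrDl -scalerAl gns_conj_linear conjCK.
  by [].
- by move=> a c v w; apply: val_inj.
- move=> a b v; apply: val_inj; apply/funext => d.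
  by rewrite /= starM mulrA.
- exact: gns_ip_act.
- move=> a v U /rnorm_nbhs[e e0 eU].
  have a1 : 0 < cnorm a + 1 by have := cnorm_ge0 a; lra.
  apply/rnorm_nbhs; exists (e / (cnorm a + 1)); first by rewrite divr_gt0.
  move=> w vw; apply: eU; rewrite -gns_actB.
  apply: le_lt_trans (rnorm_gns_act _ _) _.
  apply: le_lt_trans (ler_wpM2l (cnorm_ge0 a) (ltW vw)) _.
  rewrite mulrCA -[ltRHS]mulr1 ltr_pM2l// ltr_pdivrMr// mul1r; lra.
- exists 1, (vec 1); rewrite gns_act_of mulr1 => v0.
  by have := rnorm_gns_of1; rewrite v0 rnorm0 => /eqP; rewrite eq_sym oner_eq0.
- move=> K Kcl K0 Klin Kinv.
  (* A closed invariant [K] contains the components of its members along the cyclic vector. If one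
     is nonzero, cyclicity fills the space; if all vanish, invariance makes [K] orthogonal to every
     [vec b]. *)
  have Kxi v : K v -> K (val v 1 *: vec 1).
    move=> Kv; apply: (rnorm_closedP Kcl) => e e0.
    have [n vn] := gns_chain_lim v e0.
    by exists (gns_act (q n) v); [exact: Kinv|rewrite rnorm_distC].
  have KZ (c : R[i]) v : K v -> K (c *: v).
    by move=> Kv; rewrite -[_ *: _]addr0; exact: Klin.
  have [[v [Kv v1]]|nK] := pselect (exists v, K v /\ val v 1 <> 0).
    right; apply/seteqP; split=> // w _.
    have K1 : K (vec 1).
      rewrite -[vec 1]scale1r -(mulVf (introN eqP v1)) -scalerA.
      by apply: KZ; exact: Kxi.
    apply: (rnorm_closedP Kcl) => e e0; have [x wx] := gns_approx w e0.
    by exists (vec x) => //; rewrite -[x]mulr1 -gns_act_of; exact: Kinv.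
  left; apply/seteqP; split=> [v Kv|_ ->//] /=.
  apply: val_inj; apply/funext => b; apply: contrapT => vb.
  apply: nK; exists (gns_act (star b) v); split; first exact: Kinv.
  by rewrite /= starK mulr1.
Qed.

Definition chain_kernel : set A := [set a | forall v : H, gns_act a v = 0].

Lemma chain_kernel_primitive : is_primitive chain_kernel.
Proof.
exists (gns phiP : completeNormedModType R[i]), (@gns_ip R A phi phiP), (@gns_act R A phi phiP).
split => //; [exact: gns_inner_product|exact: gns_chain_irrep].
Qed.

Lemma chain_kernel_ideal : ideal_set J `<=` chain_kernel.
Proof.
move=> x Jx v; apply: val_inj; apply/funext => b.
transitivity (val v (star x * b)); first by [].
apply: (@gns_eq _ _ (gns_semi phi (star x * b))) => e e0.
have [y vy] := gns_approx v e0.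
have -> : val v (star x * b) = val (v - vec y) (star x * b).
  transitivity (val v (star x * b) - phi (star (star x * b) * y)); last by [].
  rewrite phi_ideal ?subr0// starM starK.
  by apply: (Defs.idealMr (idealP J)); apply: (idealMl (idealP J)).
by apply: le_trans (gns_le _ _) _; rewrite ler_wpM2r ?gns_semi_ge0// ltW.
Qed.

Lemma chain_kernel_head : A_ N p -> ~ chain_kernel p.
Proof.
move=> Ap /(_ (vec 1)); rewrite gns_act_of mulr1 => /(congr1 (fun v : H => val v 1)).
rewrite /= /gns_vec star1 mul1r phi_head// => /eqP.
by rewrite oner_eq0.
Qed.

End PureState.

Lemma primitive_separation (R : realType) (A : cstarType R) (A_ : nat -> set A)
    (tau : A -> R[i]) (E : nat -> A -> A) (beta : nat -> R)
    (AF : af_setting A_ tau E beta) (J : ideals A) n p :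
  A_ n p -> is_proj p -> ~ ideal_set J p ->
  exists P : prim A, ideal_set J `<=` prim_set P /\ ~ prim_set P p.
Proof.
move=> Ap pP Jp; have [q qP] := proj_chain_exists AF Ap pP Jp.
have [phi [phiP phi_chain]] := chain_state AF qP.
exists (Prim (chain_kernel_primitive AF qP phiP phi_chain)); split.
  exact: (chain_kernel_ideal AF qP phi_chain).
exact: (chain_kernel_head qP phi_chain Ap).
Qed.

(** * The Fell topology *)

Section PrimitiveIdeals.
Variables (R : realType) (A : cstarType R).

Lemma irrep0 (H : completeNormedModType R[i]) (ip : H -> H -> R[i])
    (pi : A -> H -> H) (a : A) : is_irrep ip pi -> pi a 0 = 0.
Proof.
move=> piP; have := irr_linr piP a 1 0 0; rewrite !scale1r addr0 => /eqP.
by rewrite -subr_eq subrr => /eqP.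
Qed.

Lemma ip_form_state (H : completeNormedModType R[i]) (ip : H -> H -> R[i])
    (pi : A -> H -> H) (x : H) :
  is_inner_product ip -> is_irrep ip pi -> rnorm x = 1 -> pi 1 x = x ->
  is_state (fun a => ip (pi a x) x).
Proof.
move=> ipP piP x1 pix; split=> [c a b|a|].
- by rewrite (irr_linl piP) (ip_linear ipP).
- rewrite (irr_mul piP) (irr_star piP) starK (ip_norm ipP).
  by rewrite exprn_ge0.
- by rewrite pix (ip_norm ipP) rnormE x1 expr1n.
Qed.

(** The kernel of [pi 1] is a closed invariant subspace containing every [x - pi 1 x], and
    nontriviality of [pi] rules out that it is everything. *)
Lemma irrep_unit (H : completeNormedModType R[i]) (ip : H -> H -> R[i])
    (pi : A -> H -> H) (x : H) :
  is_irrep ip pi -> pi 1 x = x.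
Proof.
move=> piP; pose K := [set y | pi 1 y = 0].
have pi0 a : pi a 0 = 0 := irrep0 a piP.
have Kcl : closed K.
  apply: (@closed_comp _ _ (pi 1) [set 0]) => [y _|]; first exact: (irr_cont piP).
  exact/accessible_closed_set1/hausdorff_accessible/norm_hausdorff.
have [|||K0|KT] := irr_irr piP Kcl.
- exact: pi0.
- by move=> c y z Ky Kz; rewrite /K /= (irr_linr piP) Ky Kz scaler0 addr0.
- by move=> a y Ky; rewrite /K /= -(irr_mul piP) mul1r -[a]mulr1 (irr_mul piP) Ky pi0.
- have : K ((-1) *: pi 1 x + x).
    by rewrite /K /= (irr_linr piP) -(irr_mul piP) mulr1 scaleN1r addNr.
  by rewrite K0 /= scaleN1r addrC => /eqP; rewrite subr_eq0 => /eqP.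
- have [a [y]] := irr_neq0 piP; rewrite -[a]mulr1 (irr_mul piP).
  have -> : pi 1 y = 0 by have : K y by rewrite KT.
  by rewrite pi0.
Qed.

(** [irr_cont] treats each [a] separately and gives no bound uniform in [a]; the bound comes from
    the vector state of a unit vector. It makes primitive ideals closed. *)
Lemma irrep_contractive (H : completeNormedModType R[i]) (ip : H -> H -> R[i])
    (pi : A -> H -> H) (a : A) (x : H) :
  is_inner_product ip -> is_irrep ip pi -> rnorm (pi a x) <= cnorm a * rnorm x.
Proof.
move=> ipP piP; have [/eqP x0|x0] := boolP (rnorm x == 0).
  have -> : x = 0 by exact: rnorm_eq0.
  by rewrite (irrep0 a piP) rnorm0 mulr0.
have piZ (c : R[i]) y : pi a (c *: y) = c *: pi a y.
  by have := irr_linr piP a c y 0; rewrite !addr0 (irrep0 a piP) addr0.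
have xp : 0 < rnorm x by rewrite lt_neqAle eq_sym x0 rnorm_ge0.
suff unit y : rnorm y = 1 -> rnorm (pi a y) <= cnorm a.
  have := unit ((rnorm x)^-1%:C *: x).
  rewrite piZ !rnormZ rnormRC ger0_norm ?invr_ge0 ?rnorm_ge0// mulVf//.
  by move=> /(_ erefl); rewrite ler_pdivrMl// mulrC.
move=> y1; have st := ip_form_state ipP piP y1 (irrep_unit y piP).
rewrite -(@ler_pXn2r _ 2) ?nnegrE ?rnorm_ge0 ?cnorm_ge0//.
apply: le_trans (sqnorm_le st a).
rewrite /sqnorm (irr_mul piP) (irr_star piP) starK (ip_norm ipP) rnormE.
by rewrite -rmorphXn.
Qed.

Lemma prim_ideal (P : prim A) : is_closed_ideal (prim_set P).
Proof.
case: P => P [H [ip [pi [ipP piP PE]]]] /=; rewrite {}PE.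
have pi0 a : pi a 0 = 0 := irrep0 a piP.
have piD a b x : pi (a + b) x = pi a x + pi b x.
  by have := irr_linl piP 1 a b x; rewrite !scale1r.
have piN a x : pi (- a) x = - pi a x.
  have := irr_linl piP (-1) a 0 x; rewrite addr0 !scaleN1r => ->.
  by have := piD 0 0 x; rewrite addr0 => /eqP; rewrite -subr_eq subrr => /eqP <-; rewrite addr0.
split=> /= [x|a b Ha Hb x|a b Hb x|a b Ha x|].
- by have := piD 0 0 x; rewrite addr0 => /eqP; rewrite -subr_eq subrr => /eqP.
- by rewrite piD Ha Hb addr0.
- by rewrite (irr_mul piP) Hb pi0.
- by rewrite (irr_mul piP) Ha.
- apply: rnorm_closed => a Ha x; apply: rnorm_eq0; apply/eqP.
  rewrite eq_le rnorm_ge0 andbT; apply/ler_addgt0Pr => e e0; rewrite add0r.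
  have x1 : 0 < rnorm x + 1 by have := rnorm_ge0 x; lra.
  have [b Hb ab] := Ha _ (divr_gt0 e0 x1).
  have -> : pi a x = pi (a - b) x by rewrite piD piN Hb subr0.
  apply: le_trans (irrep_contractive (a - b) x ipP piP) _.
  apply: le_trans (ler_wpM2r (rnorm_ge0 x) (ltW ab)) _.
  by rewrite mulrAC ler_pdivrMr// ler_pM2l//; lra.
Qed.

Lemma closure_ideal (I : set A) : I 0 ->
  (forall a b, I a -> I b -> I (a + b)) -> (forall a b, I b -> I (a * b)) ->
  (forall a b, I a -> I (a * b)) -> is_closed_ideal (closure I).
Proof.
move=> I0 ID Il Ir; split.
- exact: subset_closure.
- move=> a b /rnorm_closure Ha /rnorm_closure Hb; apply/rnorm_closure => e e0.
  have e2 := divr_gt0 e0 (ltr0n R 2).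
  have [a' Ia' aa'] := Ha _ e2; have [b' Ib' bb'] := Hb _ e2.
  exists (a' + b'); first exact: ID.
  by rewrite opprD addrACA [ltRHS]splitr (le_lt_trans (rnormD _ _))// ltrD.
- move=> a b /rnorm_closure Hb; apply/rnorm_closure => e e0.
  have a1 : 0 < cnorm a + 1 by have := cnorm_ge0 a; lra.
  have [b' Ib' bb'] := Hb _ (divr_gt0 e0 a1); exists (a * b'); first exact: Il.
  rewrite -mulrBr (le_lt_trans (cnormM _ _))//.
  rewrite (le_lt_trans (ler_wpM2l (cnorm_ge0 a) (ltW bb')))//.
  by rewrite mulrCA -[ltRHS]mulr1 ltr_pM2l// ltr_pdivrMr// mul1r; lra.
- move=> a b /rnorm_closure Ha; apply/rnorm_closure => e e0.
  have b1 : 0 < cnorm b + 1 by have := cnorm_ge0 b; lra.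
  have [a' Ia' aa'] := Ha _ (divr_gt0 e0 b1); exists (a' * b); first exact: Ir.
  rewrite -mulrBl (le_lt_trans (cnormM _ _))//.
  rewrite (le_lt_trans (ler_wpM2r (cnorm_ge0 b) (ltW aa')))//.
  by rewrite mulrAC ltr_pdivrMr// ltr_pM2l//; lra.
- exact: closed_closure.
Qed.

End PrimitiveIdeals.

Section FellTopology.
Variables (R : realType) (A : cstarType R) (A_ : nat -> set A)
  (tau : A -> R[i]) (E : nat -> A -> A) (beta : nat -> R).
Hypothesis AF : af_setting A_ tau E beta.
Implicit Types I J : ideals A.

(* A filter containing this set clusters at every primitive ideal above the union
   of the kernels of its members, and some such ideal misses [e]. *)
Lemma proj_hull_compl_compact n e : A_ n e -> is_proj e ->
  compact [set P : prim A | ~ prim_set P e].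
Proof.
move=> Ae eP F FF FK.
pose J0 : set A := [set x | exists2 B, F B & forall Q, B Q -> prim_set Q x].
have JP : is_closed_ideal (closure J0).
  apply: closure_ideal.
  - by exists setT => [|Q _]; [exact: filterT|exact: ideal0 (prim_ideal Q)].
  - move=> a b [B FB Ba] [C FC Cb]; exists (B `&` C); first exact: filterI.
    by move=> Q [BQ CQ]; apply: (idealD (prim_ideal Q)); [exact: Ba|exact: Cb].
  - by move=> a b [B FB Bb]; exists B => // Q /Bb; exact: (idealMl (prim_ideal Q)).
  - by move=> a b [B FB Ba]; exists B => // Q /Ba; exact: (Defs.idealMr (prim_ideal Q)).
(* Elements of [J0] stay at distance at least 1 from [e]: a closer one would put [e] into some [Q]
   of the filtered set, all of whose members miss [e]. *)
have Je : ~ ideal_set (Ideal JP) e.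
  move=> /= /rnorm_closure/(_ 1 ltr01)[x [B FB Bx] ex].
  have [Q [BQ Qe]] := filter_ex (filterI FB FK); apply: Qe.
  exact: (proj_near_ideal (prim_ideal Q) eP (Bx Q BQ) ex).
have [P [JP' Pe]] := primitive_separation AF Ae eP Je.
exists P; split => //= B U FB.
rewrite nbhsE => -[V [[S ->] /= SP] VU].
have [s Ss Ps] : exists2 s, S s & ~ prim_set P s.
  by apply: contrapT => H; apply: SP => s Ss; apply: contrapT => Ps; apply: H; exists s.
have [Q [BQ Qs]] : exists Q, B Q /\ ~ prim_set Q s.
  apply: contrapT => H; apply: Ps; apply: JP'; apply: subset_closure.
  by exists B => // Q BQ; apply: contrapT => Qs; apply: H; exists Q.
by exists Q; split => //; apply: VU => /= /(_ s Ss).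
Qed.

Lemma fell_basic_open (X : topologicalType) (CPhi : set X * set (set X)) :
  fell_index CPhi -> open (@fell_basic X CPhi).
Proof.
move=> CI; exists [set CPhi]; first by move=> _ ->.
by rewrite bigcup_set1.
Qed.

Lemma ideal_unit_near I J n :
  cnorm (ideal_unit A_ I n - ideal_unit A_ J n) < 1 ->
  ideal_unit A_ I n = ideal_unit A_ J n.
Proof.
move=> IJ; have JI : ideal_set J (ideal_unit A_ I n).
  by apply: (proj_near_ideal (idealP J) (ideal_unit_proj AF I n) _ IJ); exact: (ideal_unit_mem AF).
have IJ' : ideal_set I (ideal_unit A_ J n).
  rewrite cnorm_distC in IJ.
  by apply: (proj_near_ideal (idealP I) (ideal_unit_proj AF J n) _ IJ); exact: (ideal_unit_mem AF).
rewrite -(mulr_ideal_unit AF JI (ideal_unit_sub AF I n)).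
by rewrite (ideal_unit_mulr AF IJ' (ideal_unit_sub AF J n)).
Qed.

Lemma fell_nbhs_subalg I n :
  nbhs I [set J | ideal_unit A_ J n = ideal_unit A_ I n].
Proof.
pose u J := ideal_unit A_ J n.
have utb : tot_bounded (range u).
  apply: (af_tot_bounded AF) 1 _ => e e0; exists n => _ [J _ <-].
  exists (u J); rewrite subrr cnorm0; split => //; first exact: (ideal_unit_sub AF).
  exact: proj_cnorm_le1 (ideal_unit_proj AF J n).
have [s [su Hs]] := tot_bounded_in utb ltr01.
pose C := [set P : prim A | ~ prim_set P (u I)].
pose W x := [set P : prim A | ~ prim_set P x].
pose Phi := [set V | exists x, [/\ x \in s, ~ ideal_set I x & V = W x]].
have CPhi : fell_index (C, Phi).
  split=> /=.
  - exact: proj_hull_compl_compact (ideal_unit_sub AF I n) (ideal_unit_proj AF I n).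
  - apply: (@sub_finite_set _ _ [set W x | x in [set` s]]).
      by move=> _ [x [xs _ ->]]; exists x.
    by apply: finite_image; exact: finite_seq.
  - move=> _ [x [_ _ ->]]; exists [set x]; apply/seteqP; split => P /=.
      by move=> Px /(_ x erefl).
    by move=> H Px; apply: H => _ ->.
have VI : fell_basic (C, Phi) (hull I).
  split=> /=.
    apply/seteqP; split=> // P [/= IP]; apply; apply: IP; exact: (ideal_unit_mem AF).
  move=> _ [x [xs Ix ->]]; have [J _ uJ] := su x xs; rewrite -uJ in Ix *.
  have [P [IP Px]] := primitive_separation AF (ideal_unit_sub AF J n) (ideal_unit_proj AF J n) Ix.
  by exists P.
have : nbhs (hull I) (fell_basic (C, Phi)).
  by apply: open_nbhs_nbhs; split => //; exact: fell_basic_open.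
move=> HI; have : nbhs I (@hull R A @^-1` fell_basic (C, Phi)).
  exact: (@initial_continuous _ _ (@hull R A) I).
apply: filterS => J [/= JC JPhi].
have JuI : ideal_set J (u I).
  apply: contrapT => Ju.
  have [P [JP Pu]] := primitive_separation AF (ideal_unit_sub AF I n) (ideal_unit_proj AF I n) Ju.
  have : (hull J `&` C) P by [].
  by rewrite JC.
have IuJ : ideal_set I (u J).
  apply: contrapT => Iu; have [|x xs ux] := Hs (u J); first by exists J.
  (* The net was taken inside [range u], so the nearby center [x] is itself a unit and therefore
     equals [u J]. *)
  have [K _ uK] := su x xs; have uJx : u J = x.
    by rewrite -uK; apply: ideal_unit_near; rewrite -[_ K n]/(u K) uK.
  have [|P [/= JP Px]] := JPhi (W x); first by exists x; split => //; rewrite -uJx.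
  by apply: Px; apply: JP; rewrite -uJx; exact: (ideal_unit_mem AF).
rewrite /= -/(u J) -/(u I).
rewrite -(mulr_ideal_unit AF IuJ (ideal_unit_sub AF J n)) -/(u I).
by rewrite (ideal_unit_mulr AF JuI (ideal_unit_sub AF I n)).
Qed.

End FellTopology.

(** * The bridge *)

(** From some [N1] on [beta] is nonincreasing, so for [m >= N1] the last ratio alone gives the
    bound; the finitely many [m < N1] are handled by [beta n] tending to 0. *)
Lemma ratio_decay (R : realType) (beta : nat -> R) :
  (forall n, 0 < beta n) -> beta @ \oo --> (0 : R) ->
  (fun n => beta n.+1 / beta n) @ \oo --> (0 : R) ->
  forall e : R, 0 < e -> exists N, forall n, (N <= n)%N ->
    forall m, (m < n)%N -> beta n <= e * beta m.
Proof.
move=> beta_gt0 beta0 ratio0 e e0.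
have small (f : nat -> R) (d : R) : f @ \oo --> (0 : R) -> (forall n, 0 < f n) ->
    0 < d -> exists N, forall n, (N <= n)%N -> f n <= d.
  move=> /cvgrPdist_lt f0 fp /f0[N _ HN]; exists N => n /HN /=.
  by rewrite sub0r normrN gtr0_norm// => /ltW.
have rp n : 0 < beta n.+1 / beta n by rewrite divr_gt0.
have [N1 H1] := small _ 1 ratio0 rp ltr01; have [N2 H2] := small _ _ ratio0 rp e0.
have decr m k : (N1 <= m)%N -> beta (m + k)%N <= beta m.
  move=> Nm; elim: k => [|k IH]; first by rewrite addn0.
  apply: le_trans IH; rewrite addnS -[leRHS]mul1r -ler_pdivrMr//.
  by apply: H1; rewrite (leq_trans Nm) ?leq_addr.
have [N3 H3] : exists N, forall n, (N <= n)%N -> forall m, (m < N1)%N -> beta n <= e * beta m.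
  elim: N1 {H1 decr} => [|k [N HN]]; first by exists 0%N.
  have [M HM] := small _ (e * beta k) beta0 beta_gt0 (mulr_gt0 e0 (beta_gt0 k)).
  exists (maxn N M) => n; rewrite geq_max => /andP[Nn Mn] m.
  by rewrite ltnS leq_eqVlt => /orP[/eqP ->|]; [exact: HM|exact: HN].
(* The successor makes [n] positive with a predecessor at least [N2], where the ratio bound
   applies. *)
exists (maxn N2.+1 N3) => n; rewrite geq_max => /andP[Nn Mn] m mn.
have [mN|Nm] := ltnP m N1; first exact: H3.
case: n Nn Mn mn => // n; rewrite ltnS => Nn _; rewrite ltnS => mn.
have : beta n.+1 <= e * beta n by rewrite -ler_pdivrMr// H2.
by move=> /le_trans; apply; rewrite ler_pM2l// -(subnKC mn) decr.
Qed.

Lemma haus_le (R : realType) (X : Type) (rho : X -> X -> \bar R) (P Q : set X)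
    (c : \bar R) :
  (forall p, P p -> exists2 q, Q q & (rho p q <= c)%E) ->
  (forall q, Q q -> exists2 p, P p & (rho p q <= c)%E) ->
  (haus rho P Q <= c)%E.
Proof.
move=> PQ QP; rewrite /haus ge_max; apply/andP; split; apply: ge_ereal_sup => _ [x Hx <-].
  by have [q Qq pq] := PQ x Hx; apply: ge_ereal_inf; exists (rho x q) => //; exists q.
by have [p Pp pq] := QP x Hx; apply: ge_ereal_inf; exists (rho p x) => //; exists p.
Qed.

Section IdentityBridge.
Variables (R : realType) (A : cstarType R) (A_ : nat -> set A)
  (tau : A -> R[i]) (E : nat -> A -> A) (beta : nat -> R).
Hypothesis AF : af_setting A_ tau E beta.

Let EP n : is_cond_exp (A_ n) (E n) := tce_ce (af_ce AF n).
Let beta_gt0 n : 0 < beta n := af_beta_gt0 AF n.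
Local Notation Om := (Omega_beta A_ E beta).
Implicit Types I J : ideals A.

Lemma truncation I (n : nat) (delta : R) (w : ideal_mod I) : 0 <= delta ->
  (forall m, (m < n)%N -> beta n <= delta * beta m) ->
  (D_beta A_ E beta w <= 1)%E ->
  exists v : ideal_mod I, [/\ A_ n (val v), (D_beta A_ E beta v <= 1)%E &
    cnorm (val w - val v) <= 2 * beta n + 2 * delta].
Proof.
move=> d0 Hd /(D_beta_le AF)[wE w1 wu].
set u := ideal_unit A_ I in wu *.
have BP := af_fd AF n.
have Au k : A_ k (u k) := ideal_unit_sub AF I k.
have Iu k : ideal_set I (u k) := ideal_unit_mem AF I k.
have u1 k : cnorm (u k) <= 1 := proj_cnorm_le1 (ideal_unit_proj AF I k).
(* As [u n] is in [A_ n], it can be pulled out of [E n]; this places [a] in the ideal as well as in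
   [A_ n]. *)
pose a := E n (val w * u n).
have aE : a = E n (val w) * u n by rewrite /a (ceMr (EP n) (af_unital AF n)).
have Aa : A_ n a := ce_range (EP n) _.
have Ia : ideal_set I a by rewrite aE; exact: (idealMl (idealP I)).
have wun : cnorm (val w - val w * u n) <= beta n by rewrite -[leRHS]mul1r wu.
have wEn k : cnorm (val w - E k (val w)) <= beta k by rewrite -[leRHS]mul1r wE.
have wuk k : cnorm (val w - val w * u k) <= beta k by rewrite -[leRHS]mul1r wu.
have a1 : cnorm a <= 1.
  apply: le_trans (ce_contr (EP n) _) _; apply: le_trans (cnormM _ _) _.
  by rewrite -[leRHS]mulr1 ler_pM ?cnorm_ge0.
have wa : cnorm (val w - a) <= 2 * beta n.
  rewrite aE; apply: le_trans (cnorm_triangle (val w * u n) _ _) _.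
  rewrite -mulrBl; have := cnormM (val w - E n (val w)) (u n).
  have := ler_wpM2l (cnorm_ge0 (val w - E n (val w))) (u1 n).
  by have := wEn n; move: wun; lra.
(* For [k < n] replacing [w] by [w * u n] adds at most [2 * beta n <= 2 * delta * beta k] to the
   bound [beta k]; for [k >= n] the terms vanish. Division by [k1] then moves [a] by at most
   [1 - k1^-1 <= 2 * delta]. *)
pose k1 := 1 + 2 * delta; have k10 : 0 < k1 by rewrite /k1; lra.
have aEk k : cnorm (a - E k a) <= k1 * beta k.
  have [nk|kn] := leqP n k.
    rewrite (ce_id (EP k)) ?subrr ?cnorm0; first by rewrite mulr_ge0// ltW.
    exact: (af_le AF nk).
  have -> : a - E k a = (E n (val w * u n - val w) - E k (val w * u n - val w)) +
      (E n (val w) - E k (val w)).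
    rewrite /a (ce_tower AF _ (ltnW kn)) (ceB (EP n)) (ceB (EP k)) [- (E k _ - _)]opprB.
    by rewrite -addrA [E k (val w) - _ + _]addrC !subrKA.
  apply: le_trans (cnormD _ _) _.
  have := cnormB (E n (val w * u n - val w)) (E k (val w * u n - val w)).
  have := ce_contr (EP n) (val w * u n - val w); have := ce_contr (EP k) (val w * u n - val w).
  rewrite !(cnorm_distC (val w * u n)).
  have := ce_diff_le AF (val w) (ltnW kn); have := wEn k; have := Hd _ kn.
  by move: wun; rewrite /k1; lra.
have auk k : cnorm (a - a * u k) <= k1 * beta k.
  have [nk|kn] := leqP n k.
    rewrite (mulr_ideal_unit AF Ia (af_le AF nk Aa)) subrr cnorm0.
    by rewrite mulr_ge0// ltW.
  have unk : u n * u k = u k.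
    exact: (ideal_unit_mulr AF (Iu k) (af_le AF (ltnW kn) (Au k))).
  have -> : a - a * u k = E n ((val w - val w * u k) - (val w - val w * u n)).
    rewrite [X in E n X](_ : _ = val w * u n - val w * u k); last first.
      by rewrite opprB addrC subrKA.
    rewrite (ceB (EP n)) -/a aE -mulrA unk.
    by rewrite (ceMr (EP n) (af_unital AF n))//; exact: (af_le AF (ltnW kn) (Au k)).
  apply: le_trans (ce_contr (EP n) _) _; apply: le_trans (cnormB _ _) _.
  by have := wuk k; have := Hd _ kn; move: wun; have := beta_gt0 n; rewrite /k1; lra.
have [v vE] := ideal_mod_mem Ia.
have i0 : 0 <= k1^-1 by rewrite invr_ge0 ltW.
exists (k1^-1%:C *: v); have valE : val (k1^-1%:C *: v) = k1^-1%:C *: a by rewrite -vE.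
split.
- by rewrite valE; exact: (fdsZ BP).
- rewrite (D_betaZ AF) rnormRC ger0_norm//.
  have : (D_beta A_ E beta v <= k1%:E)%E.
    apply/(D_beta_le AF); rewrite vE; split => //.
    by apply: le_trans a1 _; rewrite /k1; lra.
  move=> /(lee_wpmul2l (_ : (0 <= k1^-1%:E)%E))/le_trans; apply; first by rewrite lee_fin.
  by rewrite -EFinM mulVf// gt_eqF.
- apply: le_trans (cnorm_triangle a _ _) _; rewrite valE.
  apply: lerD => //.
  have -> : a - k1^-1%:C *: a = (1 - k1^-1)%:C *: a.
    by rewrite rmorphB /= scalerBl scale1r.
  have k11 : k1^-1 <= 1 by rewrite invf_le1// /k1; lra.
  rewrite cnormZr_ge0 ?subr_ge0//.
  have : (1 - k1^-1) * cnorm a <= (1 - k1^-1) by rewrite ler_piMr// subr_ge0.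
  have : 1 - k1^-1 = 2 * delta * k1^-1 by rewrite /k1; field; rewrite gt_eqF.
  have : 2 * delta * k1^-1 <= 2 * delta by rewrite ler_piMr// mulr_ge0.
  by lra.
Qed.

(** Total, with value 0 outside [I], so that one element of [A] can index anchors in two ideals;
    [common_anchor] supplies the memberships. *)
Definition to_mod I (a : A) : ideal_mod I := insubd 0 a.

Definition common_anchor I J n a : Prop :=
  [/\ A_ n a, ideal_set I a, ideal_set J a,
      (D_beta A_ E beta (to_mod I a) <= 1)%E &
      (D_beta A_ E beta (to_mod J a) <= 1)%E].

Lemma val_ideal_mod I a : ideal_set I a -> val (to_mod I a) = a.
Proof. by move=> /ideal_mod_mem[w <-]; rewrite /to_mod valKd. Qed.

Lemma common_anchor_sym I J n a : common_anchor I J n a -> common_anchor J I n a.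
Proof. by case. Qed.

Lemma one_level1 : one_level (1 : A) = [set phi | is_state phi].
Proof.
apply/seteqP; split=> [phi []//|phi phiP]; split=> //.
  by rewrite subrr mulr0 (state0 phiP).
by rewrite subrr mul0r (state0 phiP).
Qed.

Lemma id_mono : is_unital_star_mono (@id A).
Proof. by split. Qed.

Lemma cnorm1_le1 : cnorm (1 : A) <= 1.
Proof. by rewrite cnorm1. Qed.

Lemma one_level1_neq0 : one_level (1 : A) !=set0.
Proof. by rewrite one_level1; exists tau; exact: fts_state (af_tau AF). Qed.

Lemma common_anchor0 I J n : common_anchor I J n 0.
Proof.
have D0 K : (D_beta A_ E beta (to_mod K 0%R) <= 1)%E.
  have v0 : val (to_mod K 0) = 0.
    by apply: val_ideal_mod; exact: ideal0 (idealP K).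
  apply/(D_beta_le AF); rewrite v0; split=> [k||k].
  - by rewrite (ce0 (EP k)) subrr cnorm0 mul1r ltW.
  - by rewrite cnorm0 ler01.
  - by rewrite mul0r subrr cnorm0 mul1r ltW.
split => //; [exact: fds0 (af_fd AF n)|exact: ideal0 (idealP I)|exact: ideal0 (idealP J)].
Qed.

Lemma common_inhabited I J n : inhabited {a : A | common_anchor I J n a}.
Proof. by constructor; exists 0; exact: common_anchor0. Qed.

Lemma common_anchor_l I J n (j : {a : A | common_anchor I J n a}) :
  @unit_ball R (Om I) (to_mod I (sval j)).
Proof. by case: j => a []. Qed.

Lemma common_anchor_r I J n (j : {a : A | common_anchor I J n a}) :
  @unit_ball R (Om J) (to_mod J (sval j)).
Proof. by case: j => a []. Qed.

Definition identity_bridge I J n : modular_bridge (Om I) (Om J) :=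
  @ModularBridge R (Om I) (Om J) A 1 cnorm1_le1 one_level1_neq0 id id_mono id id_mono
    {a : A | common_anchor I J n a} (common_inhabited I J n)
    (fun j => to_mod I (sval j)) (@common_anchor_l I J n)
    (fun j => to_mod J (sval j)) (@common_anchor_r I J n).

Lemma mk_refl (L : A -> \bar R) phi : (mk L phi phi <= 0)%E.
Proof. by apply: ge_ereal_sup => _ [a _ <-]; rewrite subrr rnorm0. Qed.

Lemma identity_height : (haus (mk (L_beta E beta)) [set phi | is_state phi]
  [set phi \o id | phi in one_level (1%R : A)] <= 0)%E.
Proof.
apply: haus_le => [phi phiP|_ [phi [phiP _ _] <-]].
  by exists phi; [exists phi => //; rewrite one_level1|exact: mk_refl].
by exists phi => //; exact: mk_refl.
Qed.

Lemma k_dist_le I (w v : ideal_mod I) :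
  (@k_dist R (Om I) w v <= (cnorm (val w - val v))%:E)%E.
Proof.
apply: ge_ereal_sup => _ [x /(D_beta_le AF)[_ x1 _] <-]; rewrite lee_fin.
rewrite /= /ideal_inner -mulrBl; apply: le_trans (cnormM _ _) _.
by rewrite cnorm_starE -[leRHS]mulr1 ler_wpM2l ?cnorm_ge0.
Qed.

(** The unit of index [k >= n] fixes [a]. For [k < n] the units of [I] and [J] lie in [A_ n], where
    the two ideals agree, so each belongs to both ideals and they coincide. *)
Lemma D_beta_transfer I J n a :
  ideal_unit A_ J n = ideal_unit A_ I n -> A_ n a -> ideal_set I a ->
  ideal_set J a /\ ((D_beta A_ E beta (to_mod I a) <= 1)%E ->
    (D_beta A_ E beta (to_mod J a) <= 1)%E).
Proof.
move=> JI Aa Ia.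
have sub K K' b : ideal_unit A_ K n = ideal_unit A_ K' n -> A_ n b ->
    ideal_set K b -> ideal_set K' b.
  move=> KK' Ab Kb; rewrite -(mulr_ideal_unit AF Kb Ab) KK'.
  by apply: (idealMl (idealP K')); exact: (ideal_unit_mem AF).
have Ja : ideal_set J a by exact: sub (esym JI) Aa Ia.
split => // /(D_beta_le AF); rewrite val_ideal_mod// => -[aE a1 au].
apply/(D_beta_le AF); rewrite val_ideal_mod//; split => // k.
have [nk|kn] := leqP n k.
  by rewrite (mulr_ideal_unit AF Ja (af_le AF nk Aa)) subrr cnorm0 mul1r ltW.
have -> : ideal_unit A_ J k = ideal_unit A_ I k; last exact: au.
have Au K := ideal_unit_sub AF K k.
have An K := af_le AF (ltnW kn) (Au K).
have IJk : ideal_set I (ideal_unit A_ J k) by exact: sub JI (An J) (ideal_unit_mem AF J k).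
have JIk : ideal_set J (ideal_unit A_ I k) by exact: sub (esym JI) (An I) (ideal_unit_mem AF I k).
by rewrite -(mulr_ideal_unit AF IJk (Au J)) (ideal_unit_mulr AF JIk (Au I)).
Qed.

Lemma common_imprint I J n (delta : R) : 0 <= delta ->
  (forall m, (m < n)%N -> beta n <= delta * beta m) ->
  ideal_unit A_ J n = ideal_unit A_ I n ->
  (haus (@k_dist R (Om I))
    (range (fun j : {a : A | common_anchor I J n a} => to_mod I (sval j)))
    (@unit_ball R (Om I)) <= (2 * beta n + 2 * delta)%:E)%E.
Proof.
move=> d0 Hd JI; apply: haus_le => [_ [j _ <-]|w Dw].
  exists (to_mod I (sval j)); first exact: common_anchor_l.
  apply: le_trans (k_dist_le _ _) _; rewrite subrr cnorm0 lee_fin.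
  by rewrite addr_ge0// mulr_ge0// ltW.
have [v [Av Dv wv]] := truncation d0 Hd Dw.
have Iv := ideal_modP v.
have vE : to_mod I (val v) = v by rewrite /to_mod valKd.
have [Jv DJ] := D_beta_transfer JI Av Iv.
have jP : common_anchor I J n (val v) by split => //; [rewrite vE|apply: DJ; rewrite vE].
exists v; first by exists (exist _ _ jP).
by apply: le_trans (k_dist_le _ _) _; rewrite lee_fin cnorm_distC.
Qed.

Lemma identity_bridge_length I J n (delta : R) : 0 <= delta ->
  (forall m, (m < n)%N -> beta n <= delta * beta m) ->
  ideal_unit A_ J n = ideal_unit A_ I n ->
  (br_length (identity_bridge I J n) <= (2 * beta n + 2 * delta)%:E)%E.
Proof.
move=> d0 Hd JI.
have c0 : 0 <= 2 * beta n + 2 * delta by rewrite addr_ge0// mulr_ge0// ltW.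
rewrite /br_length ge_max; apply/andP; split; last rewrite ge_max; last apply/andP; last split.
- apply: (@le_trans _ (\bar R) 0%E); last by rewrite lee_fin.
  by rewrite /br_height ge_max; apply/andP; split; exact: identity_height.
- apply: (@le_trans _ (\bar R) 0%E); last by rewrite lee_fin.
  apply: haus_le => [_ [a La <-]|_ [a La <-]].
    by exists (1 * a); [exists a|rewrite /= mul1r mulr1 subrr cnorm0].
  by exists (a * 1); [exists a|rewrite /= mul1r mulr1 subrr cnorm0].
- rewrite -[leRHS]add0e; apply: leeD.
    apply: ge_ereal_sup => _ [j _ <-]; apply: ge_ereal_sup => _ [k _ <-].
    rewrite /br_bn /= /ideal_inner.
    have [_ Ij Jj _ _] := svalP j; have [_ Ik Jk _ _] := svalP k.
    by rewrite /= !val_ideal_mod// !mul1r !mulr1 !subrr cnorm0 maxxx.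
  rewrite /br_imprint ge_max; apply/andP; split; first exact: common_imprint.
  (* By symmetry: exchanging [I] and [J] only permutes the conditions in the index type, so the two
     ranges are the same set. *)
  have := @common_imprint J I n delta d0 Hd (esym JI).
  rewrite /= (_ : range (fun j : {a : A | common_anchor J I n a} => _) =
    range (fun j : {a : A | common_anchor I J n a} => to_mod J (sval j)))//.
  apply/seteqP; split=> _ [[a aP] _ <-].
    by exists (exist _ a (common_anchor_sym aP)).
  by exists (exist _ a (common_anchor_sym aP)).
Qed.

End IdentityBridge.

Theorem theorem2p2 (R : realType) (A : cstarType R) (A_ : nat -> set A)
    (tau : A -> R[i]) (E : nat -> A -> A) (beta : nat -> R)
    (A_fd : forall n, is_fd_subalgebra (A_ n))
    (A_unital : forall n, A_ n 1)
    (A_incr : forall n, A_ n `<=` A_ n.+1)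
    (A_zero : A_ 0%N = [set c *: 1 | c in [set: R[i]]])
    (A_dense : closure (\bigcup_n A_ n) = [set: A])
    (tau_fts : is_faithful_tracial_state tau)
    (E_ce : forall n, is_tau_cond_exp tau (A_ n) (E n))
    (beta_gt0 : forall n, 0 < beta n)
    (beta_cvg0 : beta @ \oo --> (0 : R))
    (beta_ratio : (fun n => beta n.+1 / beta n) @ \oo --> (0 : R)) :
  exists Omega_mqvb : forall I : ideals A,
      is_mqvb (triple_beta R) (Omega_beta A_ E beta I),
    propinquity_continuous (fun I : ideals A => MQVB (Omega_mqvb I)).
Proof.
have AF : af_setting A_ tau E beta by split.
exists (Omega_beta_mqvb AF) => U Uo; rewrite openE => I /= UI.
have [e e0 eU] := Uo _ UI.
(* The bridge length is at most [2 * beta n + 2 * delta], four shares of size [e / 5], which leaves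
   the inequality with [e] strict. *)
have e5 : 0 < e / 5 by rewrite divr_gt0.
have [N1 H1] := ratio_decay beta_gt0 beta_cvg0 beta_ratio e5.
have [N2 H2] := af_beta_small AF e5.
pose n := maxn N1 N2.
apply: filterS (fell_nbhs_subalg AF I n) => J JI /=.
apply: eU; apply: le_lt_trans (_ : ((2 * beta n + 2 * (e / 5))%:E < e%:E)%E); last first.
  by rewrite lte_fin; have := H2 n (leq_maxr _ _); lra.
apply: le_trans (identity_bridge_length AF (ltW e5) (H1 n (leq_maxl _ _)) JI).
apply: ereal_inf_lbound.
by exists (@TrekBridge R (triple_beta R) (MQVB (Omega_beta_mqvb AF I))
  (MQVB (Omega_beta_mqvb AF J)) (identity_bridge AF I J n)).
Qed.
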